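(* For all integers $n\ge 715$, $$10q(n+3)^2+6q(n+1)q(n+5)<\bigl(15q(n+2)q(n+4)+q(n)q(n+6)\bigr)\left(1+\frac{5\pi^3}{256\sqrt{3}n^{9/2}}\right).$$
   Context: $q(n)$ denotes the number of partitions of $n$ into distinct parts. *)

(* Defs.v *)
From mathcomp Require Import all_boot.

(* A partition of n into distinct parts is a finite set of positive integers
   with sum n; every part is at most n, so the parts live in 'I_n.+1.
   In particular q 0 = 1 (the empty partition). *)
Definition q (n : nat) : nat :=
  #|[set A : {set 'I_n.+1} | (ord0 \notin A) && (\sum_(i in A) i == n)%N]|.

(* Main.v *)
(** Put m = n + 3, nu = m + 1/24, a = pi^2 / 12, x = sqrt (a / nu) and L = sqrt (a nu).  By Cauchy's formula,
    2 pi q(m + j) is the integral over a vertical line of prod_k (1 + exp (- k t)) exp ((m + j) t) at t = x (1 + i u).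
    Euler-Maclaurin summation, applied to the logarithmic derivative of the product, shows that
    prod_k (1 + exp (- k t)) exp (- a / t - t / 24) is constant for |u| <= 2 up to a negligible relative error, and
    Abel summation bounds the product on the rest of the line.  Hence q(m + j) is proportional to
    exp (j x) times the integral of exp (L v^2 / (1 + v) + j x v), v = i u, over |u| <= 2.
    The quadratic form 15 q(n+2) q(n+4) + q(n) q(n+6) - 10 q(n+3)^2 - 6 q(n+1) q(n+5) is the invariant of degree 2 of
    a binary sextic, so it is unchanged when the sequence is replaced by its differences, and its expansion in j x
    starts with x^6 (e6 - 6 e5 e1 + 15 e4 e2 - 10 e3^2), e_k being the normalised moments of v.  Integration by parts
    gives a linear recurrence for the moments, from which this is at least x^6 (- 15/2 L^-3 + 50 L^-4).  The
    correction factor contributes 15/2 x^6 L^-3, and the inequality follows as soon as L >= 140.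
    For n < 24000 the numbers q(n) are tabulated by the kernel, and the inequality is checked on them. *)

Require Import Defs.
From Stdlib Require Import Reals Lra Lia ZArith List Factorial.
From Coquelicot Require Import Coquelicot.

Local Open Scope R_scope.

(** * Complex exponentials and derivatives *)

(** The obstacle is cancellation: each coefficient must be known up to a relative error that is a
    fraction of [x^6 / L^4], where [x] is itself below [1 / L]. The correction factor matches the
    leading term [15/2 x^6 / L^3] exactly, so all the slack lies in the next term, [50 x^6 / L^4].
    Such accuracy comes from Euler-Maclaurin at order 44, where powers of [x] still beat the
    factorials; no modular transformation is used. All estimates concern the product of the first
    [N] factors, with [N] chosen last, so neither an infinite product nor a limit occurs. The
    threshold 140 is where the bound [exp (- 3 / (8 x))] on the rest of the line falls below the
    accuracy needed. The analytic argument yields the correction factor at [n + 3 + 1/24], which is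
    stronger than at [n] because the correction decreases. In the finite range the irrational
    quantities are removed by rational bounds for [pi] and [sqrt 3] and by AM-GM for [sqrt n], which
    leaves an inequality between integers. *)

Definition Cexp (z : C) : C := (exp (fst z) * cos (snd z), exp (fst z) * sin (snd z)).

Lemma Cexp_plus z w : Cexp (z + w)%C = (Cexp z * Cexp w)%C.
Proof.
  destruct z as [a b], w as [c d]; unfold Cexp, Cplus, Cmult; simpl.
  rewrite exp_plus, cos_plus, sin_plus; f_equal; ring.
Qed.

Lemma Cexp_0 : Cexp 0 = 1%C.
Proof. unfold Cexp, RtoC; simpl; rewrite exp_0, cos_0, sin_0; f_equal; ring. Qed.

Lemma Cmod_Cexp z : Cmod (Cexp z) = exp (fst z).
Proof.
  unfold Cmod, Cexp; cbn [fst snd].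
  replace (_ + _) with (exp (fst z) ^ 2 * ((sin (snd z))² + (cos (snd z))²)) by (unfold Rsqr; ring).
  rewrite sin2_cos2, Rmult_1_r; apply sqrt_pow2; left; apply exp_pos.
Qed.

Lemma Cexp_opp z : (Cexp (- z) * Cexp z)%C = 1%C.
Proof. rewrite <- Cexp_plus, <- Cexp_0; f_equal; ring. Qed.

Lemma re_le_Cmod z : Rabs (fst z) <= Cmod z.
Proof. eapply Rle_trans; [| apply Rmax_Cmod]; apply Rmax_l. Qed.

Lemma im_le_Cmod z : Rabs (snd z) <= Cmod z.
Proof. eapply Rle_trans; [| apply Rmax_Cmod]; apply Rmax_r. Qed.

Definition derivC (f : R -> C) (t : R) (l : C) : Prop :=
  is_derive (fun t => fst (f t)) t (fst l) /\ is_derive (fun t => snd (f t)) t (snd l).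

Lemma derivC_const c t : derivC (fun _ => c) t 0.
Proof. split; apply @is_derive_const. Qed.

Lemma derivC_ext f g t l : (forall s, f s = g s) -> derivC f t l -> derivC g t l.
Proof. intros E [H1 H2]; split; eapply is_derive_ext; eauto; intros s; simpl; now rewrite E. Qed.

Lemma derivC_eq f t l l' : derivC f t l -> l = l' -> derivC f t l'.
Proof. now intros H <-. Qed.

Lemma derivC_plus f g t l m : derivC f t l -> derivC g t m ->
  derivC (fun s => f s + g s)%C t (l + m)%C.
Proof. intros [A B] [A' B']; split; now apply @is_derive_plus. Qed.

Lemma derivC_mult f g t l m : derivC f t l -> derivC g t m ->
  derivC (fun s => f s * g s)%C t (l * g t + f t * m)%C.
Proof.
  intros [A B] [A' B']; split; cbn [fst snd Cmult Cplus].
  - replace (_ + _) with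
      ((fst l * fst (g t) + fst (f t) * fst m) - (snd l * snd (g t) + snd (f t) * snd m)) by ring.
    apply @is_derive_minus; apply @is_derive_mult; auto; intros; apply Rmult_comm.
  - replace (_ + _) with
      ((fst l * snd (g t) + fst (f t) * snd m) + (snd l * fst (g t) + snd (f t) * fst m)) by ring.
    apply @is_derive_plus; apply @is_derive_mult; auto; intros; apply Rmult_comm.
Qed.

Lemma derivC_RtoC f t l : is_derive f t l -> derivC (fun s => RtoC (f s)) t (RtoC l).
Proof. intros H; split; simpl; auto; apply @is_derive_const. Qed.

Lemma derivC_id t : derivC (fun s => RtoC s) t 1.
Proof. apply derivC_RtoC; apply @is_derive_id. Qed.

Lemma derivC_Cexp f t l : derivC f t l -> derivC (fun s => Cexp (f s)) t (l * Cexp (f t))%C.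
Proof.
  intros [A B]; split; unfold Cexp; cbn [fst snd Cmult].
  - evar_last. apply @is_derive_mult; [apply (is_derive_comp exp); [apply is_derive_exp | exact A]
      | apply (is_derive_comp cos); [apply is_derive_cos | exact B] | intros; apply Rmult_comm].
    unfold plus, mult, scal; simpl; unfold mult; simpl; ring.
  - evar_last. apply @is_derive_mult; [apply (is_derive_comp exp); [apply is_derive_exp | exact A]
      | apply (is_derive_comp sin); [apply is_derive_sin | exact B] | intros; apply Rmult_comm].
    unfold plus, mult, scal; simpl; unfold mult; simpl; ring.
Qed.

Lemma derivC_inv f t l : derivC f t l -> f t <> 0%C ->
  derivC (fun s => / f s)%C t (- l / (f t * f t))%C.
Proof.
  intros [A B] Hn.
  assert (Hp : fst (f t) ^ 2 + snd (f t) ^ 2 <> 0).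
  { intros H; apply Hn; apply injective_projections; simpl; nra. }
  split; unfold Cinv, Cdiv; cbn [fst snd Cmult Copp].
  - evar_last. apply (is_derive_div (fun s => fst (f s)) (fun s => fst (f s) ^ 2 + snd (f s) ^ 2)); [exact A | | exact Hp].
    apply @is_derive_plus; apply is_derive_pow; [exact A | exact B].
    unfold plus; simpl; field; split; [nra|]; intros H; apply Hp; nra.
  - evar_last. apply (is_derive_div (fun s => - snd (f s)) (fun s => fst (f s) ^ 2 + snd (f s) ^ 2)); [apply @is_derive_opp; exact B | | exact Hp].
    apply @is_derive_plus; apply is_derive_pow; [exact A | exact B].
    unfold plus, opp; simpl; field; split; [nra|]; intros H; apply Hp; nra.
Qed.

(** * Integrals and Bernoulli functions *)

Lemma derive_continuous (f : R -> R) x l : is_derive f x l -> continuous f x.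
Proof. intros H; apply (ex_derive_continuous f); now exists l. Qed.

Lemma continuous_ex_RInt (f : R -> R) a b : (forall x, continuous f x) -> ex_RInt f a b.
Proof. intros H; apply (ex_RInt_continuous (V := R_CompleteNormedModule)); auto. Qed.

Definition Int (f : R -> R) (a b : R) : R := RInt f a b.

Lemma derive_Int (f : R -> R) a x : (forall x, continuous f x) ->
  is_derive (fun s => Int f a s) x (f x).
Proof.
  intros H; apply (is_derive_RInt f (RInt f a) a); [| apply H].
  exists (mkposreal 1 Rlt_0_1); intros y _; apply (RInt_correct (V := R_CompleteNormedModule)).
  now apply continuous_ex_RInt.
Qed.

Lemma Int_of_derive (F f : R -> R) a b :
  (forall x, is_derive F x (f x)) -> (forall x, continuous f x) -> Int f a b = F b - F a.
Proof. intros HF Hf; apply is_RInt_unique; now apply (is_RInt_derive F f a b). Qed.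

Lemma eq_of_same_derive (F G f : R -> R) :
  (forall x, is_derive F x (f x)) -> (forall x, is_derive G x (f x)) ->
  forall x y, F x - G x = F y - G y.
Proof.
  intros HF HG x y.
  assert (HD : forall t, is_derive (fun t => F t - G t) t 0).
  { intros t; replace 0 with (f t - f t) by ring; apply @is_derive_minus; auto. }
  destruct (MVT_gen (fun t => F t - G t) x y (fun _ => 0)) as [c [_ Hc]];
    [intros; apply HD | | simpl in Hc; lra].
  intros t _; apply continuity_pt_filterlim; exact (derive_continuous _ _ _ (HD t)).
Qed.

Lemma Int_ext (f g : R -> R) a b : (forall x, f x = g x) -> Int f a b = Int g a b.
Proof. intros E; apply (RInt_ext (V := R_CompleteNormedModule)); intros; apply E. Qed.

Lemma Int_add (f g : R -> R) a b : (forall x, continuous f x) -> (forall x, continuous g x) ->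
  Int (fun x => f x + g x) a b = Int f a b + Int g a b.
Proof. intros; apply (RInt_plus (V := R_CompleteNormedModule) f g); now apply continuous_ex_RInt. Qed.

Lemma Int_sub (f g : R -> R) a b : (forall x, continuous f x) -> (forall x, continuous g x) ->
  Int (fun x => f x - g x) a b = Int f a b - Int g a b.
Proof. intros; apply (RInt_minus (V := R_CompleteNormedModule) f g); now apply continuous_ex_RInt. Qed.

Lemma Int_scal (f : R -> R) c a b : (forall x, continuous f x) ->
  Int (fun x => c * f x) a b = c * Int f a b.
Proof. intros; apply (RInt_scal (V := R_CompleteNormedModule) f); now apply continuous_ex_RInt. Qed.

Lemma Int_const (c a b : R) : Int (fun _ => c) a b = c * (b - a).
Proof. unfold Int; rewrite RInt_const; unfold scal; simpl; unfold mult; simpl; ring. Qed.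

Lemma Int_split (f : R -> R) a b c : (forall x, continuous f x) ->
  Int f a c = Int f a b + Int f b c.
Proof. intros; symmetry; apply (RInt_Chasles (V := R_CompleteNormedModule) f); now apply continuous_ex_RInt. Qed.

Lemma Int_le (f g : R -> R) a b : a <= b -> (forall x, continuous f x) -> (forall x, continuous g x) ->
  (forall x, a <= x <= b -> f x <= g x) -> Int f a b <= Int g a b.
Proof.
  intros; apply RInt_le; auto using continuous_ex_RInt.
  intros; apply H2; lra.
Qed.

Lemma Int_abs_le (f g : R -> R) a b : a <= b -> (forall x, continuous f x) -> (forall x, continuous g x) ->
  (forall x, a <= x <= b -> Rabs (f x) <= g x) -> Rabs (Int f a b) <= Int g a b.
Proof.
  intros Hab Hf Hg H; apply Rabs_le; split.
  - replace (- Int g a b) with (Int (fun x => (-1) * g x) a b) by (rewrite Int_scal; auto; ring).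
    apply Int_le; auto.
    + intros x; apply (continuous_scal_r (K := R_AbsRing) (-1) g); auto.
    + intros x Hx; specialize (H x Hx); apply Rabs_le_between in H; lra.
  - apply Int_le; auto.
    intros x Hx; specialize (H x Hx); apply Rabs_le_between in H; lra.
Qed.

Lemma Int_affine (f : R -> R) u v a b : (forall x, continuous f x) ->
  Int (fun y => u * f (u * y + v)) a b = Int f (u * a + v) (u * b + v).
Proof. intros; apply (RInt_comp_lin (V := R_CompleteNormedModule) f); now apply continuous_ex_RInt. Qed.

Lemma Int_swap (f : R -> R) a b : (forall x, continuous f x) -> Int f a b = - Int f b a.
Proof.
  intros; symmetry; apply (opp_RInt_swap (V := R_CompleteNormedModule) f); now apply continuous_ex_RInt.
Qed.

Fixpoint rsum (f : nat -> R) (n : nat) : R :=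
  match n with O => 0 | S n => rsum f n + f n end.

(* Bernoulli polynomials divided by factorials, on the unit interval. *)
Fixpoint bern (j : nat) : R -> R :=
  match j with
  | O => fun _ => 1
  | S j => fun s => Int (bern j) 0 s - Int (fun t => Int (bern j) 0 t) 0 1
  end.

Lemma bern_continuous j s : continuous (bern j) s.
Proof.
  revert s; induction j as [| j IH]; intros s; [apply continuous_const |]; simpl.
  apply @continuous_minus; [| apply continuous_const].
  eapply derive_continuous; now apply derive_Int.
Qed.

Lemma bern_derive j s : is_derive (bern (S j)) s (bern j s).
Proof.
  simpl; replace (bern j s) with (bern j s - 0) by ring.
  apply @is_derive_minus; [| apply @is_derive_const].
  apply derive_Int, bern_continuous.
Qed.

Lemma bern_Int j : Int (bern (S j)) 0 1 = 0.
Proof.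
  simpl; set (c := Int (fun t => Int (bern j) 0 t) 0 1).
  assert (Hc : forall x, continuous (fun t => Int (bern j) 0 t) x).
  { intros x; eapply derive_continuous, derive_Int, bern_continuous. }
  rewrite (Int_sub (fun s => Int (bern j) 0 s) (fun _ => c)), Int_const;
    [unfold c; ring | auto | intros; apply continuous_const].
Qed.

Lemma bern_0_1 j : bern (S (S j)) 1 = bern (S (S j)) 0.
Proof.
  assert (H := Int_of_derive (bern (S (S j))) (bern (S j)) 0 1
     (bern_derive (S j)) (bern_continuous (S j))).
  rewrite bern_Int in H; lra.
Qed.

(** Uniqueness: an antiderivative of [bern j] is fixed by its mean. Closed forms and the reflection
    symmetry follow without unfolding [bern]. *)
Lemma bern_const_eq (f : R -> R) j : (forall x, is_derive f x (bern j x)) -> Int f 0 1 = 0 ->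
  forall x, f x = bern (S j) x.
Proof.
  intros Hf H0 x.
  assert (E : forall t, f t = bern (S j) t + (f x - bern (S j) x)).
  { intros t; generalize (eq_of_same_derive f (bern (S j)) (bern j) Hf (bern_derive j) t x); lra. }
  rewrite (Int_ext f (fun t => bern (S j) t + (f x - bern (S j) x))) in H0
    by (intros; apply E).
  rewrite Int_add, Int_const, bern_Int in H0;
    [lra | apply bern_continuous | intros; apply continuous_const].
Qed.

Lemma bern_1 s : bern 1 s = s - 1 / 2.
Proof.
  symmetry; apply (bern_const_eq (fun s => s - 1/2) 0).
  - intros x; change (bern 0 x) with 1; auto_derive; auto; ring.
  - rewrite (Int_of_derive (fun s => s^2/2 - s/2) (fun s => s - 1/2)); [field | |].
    + intros x; auto_derive; auto; field.
    + intros x; eapply derive_continuous with (l := 1); auto_derive; auto; ring.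
Qed.

Lemma bern_2_0 : bern 2 0 = 1 / 12.
Proof.
  rewrite <- (bern_const_eq (fun s => s^2/2 - s/2 + 1/12) 1); [field | |].
  - intros x; rewrite bern_1; auto_derive; auto; field.
  - rewrite (Int_of_derive (fun s => s^3/6 - s^2/4 + s/12) (fun s => s^2/2 - s/2 + 1/12)); [field | |].
    + intros x; auto_derive; auto; field.
    + intros x; eapply derive_continuous with (l := x - 1/2); auto_derive; auto; field.
Qed.

(** The reflected function, with its sign, is again an antiderivative of mean zero, so induction and
    [bern_const_eq] apply. *)
Lemma bern_sym j s : bern j (1 - s) = (-1) ^ j * bern j s.
Proof.
  revert s; induction j as [| j IH]; intros s; [simpl; ring |].
  assert (Hm : forall t, (-1) ^ S j * ((-1) ^ S j * t) = t).
  { intros t; rewrite <- Rmult_assoc, <- Rpow_mult_distr.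
    replace (-1 * -1) with 1 by ring; rewrite pow1; ring. }
  rewrite <- (Hm (bern (S j) (1 - s))); f_equal.
  apply (bern_const_eq (fun s => (-1) ^ S j * bern (S j) (1 - s))).
  - intros x.
    replace (bern j x) with ((-1) ^ S j * (-1 * bern j (1 - x))).
    2:{ rewrite IH; change ((-1) ^ S j) with (-1 * (-1) ^ j).
        transitivity ((-1) ^ S j * ((-1) ^ S j * bern j x)); [simpl; ring | apply Hm]. }
    apply is_derive_scal with (k := (-1) ^ S j).
    apply (is_derive_comp (bern (S j)) (fun s => 1 - s)); [apply bern_derive |].
    auto_derive; auto; ring.
  - rewrite Int_scal.
    + rewrite (Int_ext _ (fun y => -1 * (-1 * bern (S j) (-1 * y + 1)))).
      2:{ intros y; replace (-1 * y + 1) with (1 - y) by ring; ring. }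
      rewrite (Int_scal (fun y => -1 * bern (S j) (-1 * y + 1))), Int_affine, Int_swap.
      * replace (-1 * 0 + 1) with 1 by ring; replace (-1 * 1 + 1) with 0 by ring.
        rewrite bern_Int; ring.
      * apply bern_continuous.
      * apply bern_continuous.
      * intros x; apply (continuous_scal_r (K := R_AbsRing) (-1) (fun y => bern (S j) (-1 * y + 1))).
        apply (continuous_comp (fun x => -1 * x + 1) (bern (S j))); [| apply bern_continuous].
        apply derive_continuous with (l := -1); auto_derive; auto; ring.
    + intros x; apply (continuous_comp (fun x => 1 - x) (bern (S j))); [| apply bern_continuous].
      apply derive_continuous with (l := -1); auto_derive; auto; ring.
Qed.

(** Reflection makes the value at 0 minus the value at 1, while [bern_0_1] says that the two
    agree. *)
Lemma bern_odd_0 i : bern (2 * i + 3) 0 = 0.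
Proof.
  assert (H := bern_sym (2 * i + 3) 0).
  rewrite Rminus_0_r in H; replace (2 * i + 3)%nat with (S (S (2 * i + 1))) in * by lia.
  rewrite bern_0_1 in H.
  replace (S (S (2 * i + 1))) with (S (2 * (i + 1)))%nat in H at 2 by lia.
  rewrite pow_1_odd in H; lra.
Qed.

(** Since [f t >= f s - M |t - s|], integration over the unit interval gives
    [0 >= f s - M (s^2 + (1 - s)^2) / 2], and [s^2 + (1 - s)^2 <= 1]. *)
Lemma mean_zero_bound (f g : R -> R) M : (forall x, is_derive f x (g x)) ->
  (forall x, 0 <= x <= 1 -> Rabs (g x) <= M) -> Int f 0 1 = 0 ->
  forall s, 0 <= s <= 1 -> f s <= M / 2.
Proof.
  intros Hf Hg H0 s Hs.
  assert (Hc : forall x, continuous f x) by (intros x; eapply derive_continuous, Hf).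
  assert (HM : 0 <= M) by (generalize (Hg 0 ltac:(lra)) (Rabs_pos (g 0)); lra).
  assert (Hl : forall t, 0 <= t <= 1 -> f s - M * Rabs (t - s) <= f t).
  { intros t Ht; destruct (MVT_gen f s t g) as [c [Hc1 Hc2]].
    - intros; apply Hf.
    - intros; apply continuity_pt_filterlim; apply Hc.
    - assert (Hc3 : 0 <= c <= 1).
      { revert Hc1; unfold Rmin, Rmax; destruct (Rle_dec s t); lra. }
      specialize (Hg c Hc3).
      assert (Rabs (f t - f s) <= M * Rabs (t - s)).
      { rewrite Hc2, Rabs_mult; apply Rmult_le_compat_r; [apply Rabs_pos | auto]. }
      apply Rabs_le_between in H; lra. }
  assert (Hp1 : f s * s - M * s ^ 2 / 2 <= Int f 0 s).
  { replace (f s * s - M * s ^ 2 / 2) with (Int (fun t => f s - M * (s - t)) 0 s).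
    - apply Int_le; [lra | | auto |].
      + intros x; eapply derive_continuous with (l := M); auto_derive; auto; ring.
      + intros x Hx; eapply Rle_trans; [| apply Hl; lra]; rewrite Rabs_left1 by lra; lra.
    - rewrite (Int_of_derive (fun t => f s * t - M * (s * t - t ^ 2 / 2)) (fun t => f s - M * (s - t)) 0 s); [field | |].
      + intros x; auto_derive; auto; field.
      + intros x; eapply derive_continuous with (l := M); auto_derive; auto; ring. }
  assert (Hp2 : f s * (1 - s) - M * (1 - s) ^ 2 / 2 <= Int f s 1).
  { replace (f s * (1 - s) - M * (1 - s) ^ 2 / 2) with (Int (fun t => f s - M * (t - s)) s 1).
    - apply Int_le; [lra | | auto |].
      + intros x; eapply derive_continuous with (l := - M); auto_derive; auto; ring.
      + intros x Hx; eapply Rle_trans; [| apply Hl; lra]; rewrite Rabs_right by lra; lra.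
    - rewrite (Int_of_derive (fun t => f s * t - M * (t ^ 2 / 2 - s * t)) (fun t => f s - M * (t - s)) s 1); [field | |].
      + intros x; auto_derive; auto; field.
      + intros x; eapply derive_continuous with (l := - M); auto_derive; auto; ring. }
  assert (Hch : Int f 0 s + Int f s 1 = 0).
  { rewrite <- (Int_split f 0 s 1); auto. }
  assert (M * (s ^ 2 + (1 - s) ^ 2) <= M * 1) by (apply Rmult_le_compat_l; nra).
  lra.
Qed.

(** Far from the true decay [(2 pi)^-j], but [2^-j] is just what cancels the [2^j] of
    [pnorm_sigtail]. *)
Lemma bern_bound j s : 0 <= s <= 1 -> Rabs (bern j s) <= (1 / 2) ^ j.
Proof.
  revert s; induction j as [| j IH]; intros s Hs; [simpl; rewrite Rabs_R1; lra |].
  replace ((1/2) ^ S j) with ((1/2) ^ j / 2) by (simpl; field).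
  apply Rabs_le; split.
  - cut (- bern (S j) s <= (1/2) ^ j / 2); [lra |].
    apply (mean_zero_bound (fun s => - bern (S j) s) (fun s => - bern j s)); auto.
    + intros x; apply @is_derive_opp, bern_derive.
    + intros x Hx; rewrite Rabs_Ropp; auto.
    + rewrite (Int_ext _ (fun s => -1 * bern (S j) s)) by (intros; ring).
      rewrite Int_scal, bern_Int by apply bern_continuous; ring.
  - apply (mean_zero_bound (bern (S j)) (bern j)); auto using bern_derive, bern_Int.
Qed.
Arguments bern : simpl never.

(** * Euler-Maclaurin summation *)

Lemma continuous_mul (f g : R -> R) x : continuous f x -> continuous g x ->
  continuous (fun x => f x * g x) x.
Proof. apply (continuous_mult (K := R_AbsRing)). Qed.

Lemma continuous_shift (f : R -> R) k x : (forall x, continuous f x) -> continuous (fun s => f (k + s)) x.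
Proof.
  intros H; apply (continuous_comp (fun s => k + s) f); auto.
  apply (ex_derive_continuous (fun s => k + s)); auto_derive; auto.
Qed.

Lemma Int_shift (f : R -> R) k : (forall x, continuous f x) ->
  Int (fun s => f (k + s)) 0 1 = Int f k (k + 1).
Proof.
  intros H; rewrite (Int_ext _ (fun s => 1 * f (1 * s + k))) by (intros; rewrite !Rmult_1_l, Rplus_comm; auto).
  rewrite Int_affine by auto; f_equal; ring.
Qed.

Lemma rsum_ext f g n : (forall i, (i < n)%nat -> f i = g i) -> rsum f n = rsum g n.
Proof. induction n; intros H; simpl; [reflexivity |]; rewrite IHn, H; auto. Qed.

Lemma rsum_add f g n : rsum (fun i => f i + g i) n = rsum f n + rsum g n.
Proof. induction n; simpl; [ring |]; rewrite IHn; ring. Qed.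

Lemma rsum_scal f c n : rsum (fun i => c * f i) n = c * rsum f n.
Proof. induction n; simpl; [ring |]; rewrite IHn; ring. Qed.

Lemma rsum_telescope f n : rsum (fun i => f (S i) - f i) n = f n - f O.
Proof. induction n; simpl; [ring |]; rewrite IHn; ring. Qed.

Lemma rsum_le f g n : (forall i, (i < n)%nat -> f i <= g i) -> rsum f n <= rsum g n.
Proof.
  induction n; intros H; simpl; [lra |].
  assert (H1 : f n <= g n) by auto; assert (rsum f n <= rsum g n) by auto; lra.
Qed.

Lemma rsum_abs f n : Rabs (rsum f n) <= rsum (fun i => Rabs (f i)) n.
Proof.
  induction n; simpl; [rewrite Rabs_R0; lra |].
  eapply Rle_trans; [apply Rabs_triang |]; lra.
Qed.

Lemma rsum_const c n : rsum (fun _ => c) n = INR n * c.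
Proof. induction n; [simpl; ring |]; rewrite S_INR; simpl rsum; rewrite IHn; ring. Qed.

Lemma rsum_exchange f m n : rsum (fun i => rsum (f i) n) m = rsum (fun j => rsum (fun i => f i j) m) n.
Proof.
  induction m; simpl.
  - induction n; simpl; [reflexivity |]; rewrite <- IHn; ring.
  - rewrite IHm, rsum_add; reflexivity.
Qed.

Lemma rsum_S_l f n : rsum f (S n) = f O + rsum (fun i => f (S i)) n.
Proof. induction n; simpl in *; [ring |]; rewrite IHn; ring. Qed.

Section EulerMaclaurin.

Variable G : nat -> R -> R.
Hypothesis HG : forall j s, is_derive (G j) s (G (S j) s).

Lemma em_continuous j s : continuous (G j) s.
Proof. eapply derive_continuous, HG. Qed.

(** [J] integrations by parts, in which [bern] is integrated and [G] differentiated. *)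
Lemma em_unit k J :
  Int (G 0%nat) k (k + 1) =
    rsum (fun j => (-1) ^ j * (bern (S j) 1 * G j (k + 1) - bern (S j) 0 * G j k)) J
    + (-1) ^ J * Int (fun s => bern J s * G J (k + s)) 0 1.
Proof.
  induction J as [| J IH].
  - simpl; rewrite <- Int_shift by apply em_continuous.
    rewrite (Int_ext (fun s => 1 * G 0%nat (k + s)) (fun s => G 0%nat (k + s))) by (intros; ring); ring.
  - rewrite IH; cbn [rsum]; rewrite Rplus_assoc; apply (f_equal (Rplus _)).
    assert (C1 : forall x, continuous (fun s => bern J s * G J (k + s)) x).
    { intros x; apply continuous_mul; [apply bern_continuous | apply continuous_shift, em_continuous]. }
    assert (C2 : forall x, continuous (fun s => bern (S J) s * G (S J) (k + s)) x).
    { intros x; apply continuous_mul; [apply bern_continuous | apply continuous_shift, em_continuous]. }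
    assert (E : Int (fun s => bern J s * G J (k + s) + bern (S J) s * G (S J) (k + s)) 0 1
      = bern (S J) 1 * G J (k + 1) - bern (S J) 0 * G J k).
    { rewrite (Int_of_derive (fun s => bern (S J) s * G J (k + s))); [now rewrite Rplus_0_r | |].
      - intros x.
        apply (is_derive_mult (bern (S J)) (fun s => G J (k + s))); [apply bern_derive | | intros; apply Rmult_comm].
        evar_last; [apply (is_derive_comp (G J) (fun s => k + s)); [apply HG |] |].
        + auto_derive; [auto | reflexivity].
        + apply Rmult_1_l.
      - intros x; apply (continuous_plus (V := R_NormedModule)); auto. }
    rewrite Int_add in E by auto.
    replace ((-1) ^ S J) with (- (-1) ^ J) by (simpl; ring).
    rewrite <- E; ring.
Qed.

(** From index 2 on, [bern] agrees at 0 and 1, so the boundary terms telescope over [k]; [bern 1]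
    jumps by 1 and thereby produces the sum of the values of [G 0]. *)
Lemma em_sum J N :
  Int (G 0%nat) 0 (INR N) =
    rsum (fun k => G 0%nat (INR (S k))) N - (G 0%nat (INR N) - G 0%nat 0) / 2
    + rsum (fun j => (-1) ^ S j * bern (S (S j)) 0 * (G (S j) (INR N) - G (S j) 0)) J
    + (-1) ^ S J * rsum (fun k => Int (fun s => bern (S J) s * G (S J) (INR k + s)) 0 1) N.
Proof.
  assert (E : Int (G 0%nat) 0 (INR N) = rsum (fun k => Int (G 0%nat) (INR k) (INR k + 1)) N).
  { induction N as [| N IH]; [simpl; unfold Int; now rewrite RInt_point |].
    rewrite (Int_split _ 0 (INR N)) by apply em_continuous; rewrite IH, S_INR; reflexivity. }
  rewrite E; clear E.
  rewrite (rsum_ext _ _ _ (fun k _ => em_unit (INR k) (S J))).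
  rewrite rsum_add, rsum_scal; f_equal.
  rewrite rsum_exchange, rsum_S_l; f_equal.
  - rewrite !bern_1.
    rewrite (rsum_ext _ (fun i => G 0%nat (INR (S i)) + (-1/2) * (G 0%nat (INR (S i)) - G 0%nat (INR i)))).
    2:{ intros i _; rewrite S_INR; field. }
    rewrite rsum_add, rsum_scal, (rsum_telescope (fun i => G 0%nat (INR i))); simpl INR; field.
  - apply rsum_ext; intros j _.
    change (G (S j) 0) with (G (S j) (INR 0)).
    rewrite <- (rsum_telescope (fun i => G (S j) (INR i)) N), <- rsum_scal.
    apply rsum_ext; intros i _; rewrite bern_0_1, S_INR; ring.
Qed.

Lemma em_remainder (Env : R -> R) J N : (forall s, continuous Env s) ->
  (forall s, 0 <= s -> Rabs (G (S J) s) <= Env s) ->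
  Rabs (rsum (fun k => Int (fun s => bern (S J) s * G (S J) (INR k + s)) 0 1) N)
    <= (1 / 2) ^ S J * Int Env 0 (INR N).
Proof.
  intros HE HB; induction N as [| N IH].
  - simpl; unfold Int; rewrite RInt_point, Rabs_R0; unfold zero; simpl; lra.
  - cbn [rsum]; eapply Rle_trans; [apply Rabs_triang |].
    rewrite (Int_split Env 0 (INR N)), Rmult_plus_distr_l by auto.
    apply Rplus_le_compat; [exact IH |].
    rewrite S_INR, <- Int_shift, <- Int_scal by (auto; intros; apply continuous_shift; auto).
    apply Int_abs_le; [lra | | |].
    + intros x; apply continuous_mul; [apply bern_continuous | apply continuous_shift, em_continuous].
    + intros x; apply continuous_mul; [apply continuous_const | apply continuous_shift; auto].
    + intros s Hs; rewrite Rabs_mult; apply Rmult_le_compat; try apply Rabs_pos; [now apply bern_bound |].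
      apply HB; generalize (pos_INR N); lra.
Qed.

(** At 0 only the first correction term survives: in each later one, according to parity, either the
    Bernoulli number or the derivative of [G 0] vanishes. The terms at [N] go into [eta], which will
    be made small by the choice of [N]. *)
Lemma euler_maclaurin (Env : R -> R) J N eta : (forall s, continuous Env s) ->
  (forall s, 0 <= s -> Rabs (G (S (S J)) s) <= Env s) ->
  G 0%nat 0 = 0 -> (forall i, G (2 * i + 3)%nat 0 = 0) ->
  (forall j, (j <= S J)%nat -> Rabs (G j (INR N)) <= eta) ->
  Rabs (rsum (fun k => G 0%nat (INR (S k))) N - Int (G 0%nat) 0 (INR N) + G 1%nat 0 / 12)
    <= (1 / 2) ^ S (S J) * Int Env 0 (INR N) + INR (S (S J)) * eta.
Proof.
  intros HE HB H0 Hodd Heta.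
  assert (R1 := em_remainder Env (S J) N HE HB).
  set (Rm := rsum (fun k => Int (fun s => bern (S (S J)) s * G (S (S J)) (INR k + s)) 0 1) N) in *.
  assert (Hs : forall n, Rabs ((-1) ^ n) = 1).
  { intros n; rewrite <- RPow_abs, Rabs_left by lra; replace (- -1) with 1 by ring; apply pow1. }
  assert (Hb : forall j, Rabs (bern j 0) <= 1).
  { intros j; eapply Rle_trans; [apply bern_bound; lra |].
    apply Rle_trans with (1 ^ j); [apply pow_incr; lra | rewrite pow1; lra]. }
  assert (He : 0 <= eta) by (eapply Rle_trans; [apply Rabs_pos | apply (Heta 0%nat); lia]).
  set (T := rsum (fun j => (-1) ^ S j * bern (S (S j)) 0 * G (S j) (INR N)) (S J)).
  assert (HT : Rabs T <= INR (S J) * eta).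
  { unfold T; eapply Rle_trans; [apply rsum_abs |]; rewrite <- rsum_const; apply rsum_le.
    intros j Hj; rewrite !Rabs_mult, Hs, Rmult_1_l.
    rewrite <- (Rmult_1_l eta); apply Rmult_le_compat; auto using Rabs_pos; apply Heta; lia. }
  assert (E : rsum (fun j => (-1) ^ S j * bern (S (S j)) 0 * (G (S j) (INR N) - G (S j) 0)) (S J)
     = T + G 1%nat 0 / 12).
  { unfold T; rewrite (rsum_ext _ (fun j => (-1) ^ S j * bern (S (S j)) 0 * G (S j) (INR N)
       + (-1) * ((-1) ^ S j * bern (S (S j)) 0 * G (S j) 0))) by (intros; ring).
    rewrite rsum_add; f_equal; rewrite rsum_scal, rsum_S_l, bern_2_0.
    rewrite (rsum_ext _ (fun _ => 0)).
    - rewrite rsum_const; simpl; field.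
    - intros i _; destruct (Nat.Even_or_Odd i) as [[p Hp] | [p Hp]]; subst i.
      + replace (S (S (S (2 * p)))) with (2 * p + 3)%nat by lia; rewrite bern_odd_0; ring.
      + replace (S (S (2 * p + 1))) with (2 * p + 3)%nat by lia; rewrite Hodd; ring. }
  assert (Em := em_sum (S J) N); rewrite E, H0 in Em; fold Rm in Em.
  replace (rsum _ N - _ + _) with (G 0%nat (INR N) / 2 - T - (-1) ^ S (S J) * Rm)
    by (rewrite Em; field).
  assert (Hq : Rabs ((-1) ^ S (S J) * Rm) <= (1 / 2) ^ S (S J) * Int Env 0 (INR N))
    by (rewrite Rabs_mult, Hs, Rmult_1_l; exact R1).
  assert (Hg := Heta 0%nat ltac:(lia)).
  rewrite (S_INR (S J)), Rmult_plus_distr_r, Rmult_1_l.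
  revert Hq Hg HT; generalize ((-1) ^ S (S J) * Rm) ((1 / 2) ^ S (S J) * Int Env 0 (INR N)) (INR (S J) * eta).
  intros a b c; unfold Rabs; repeat destruct Rcase_abs; lra.
Qed.

End EulerMaclaurin.

(** * Derivatives of the logistic function *)

Fixpoint peval (l : list R) (z : C) : C :=
  match l with nil => 0%C | a :: l => (RtoC a + z * peval l z)%C end.

Fixpoint padd (l m : list R) : list R :=
  match l, m with nil, m => m | l, nil => l | a :: l, b :: m => (a + b) :: padd l m end.

Definition popp (l : list R) : list R := map Ropp l.

(** Coefficients start at degree 0; the recursion is the product rule for [a + X l]. *)
Fixpoint pder (l : list R) : list R :=
  match l with
  | nil => nil
  | _ :: l => match l with nil => nil | _ :: _ => padd l (0 :: pder l) end
  end.

Fixpoint pnorm (l : list R) : R :=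
  match l with nil => 0 | a :: l => Rabs a + pnorm l end.

Lemma peval_padd l m z : peval (padd l m) z = (peval l z + peval m z)%C.
Proof.
  revert m; induction l as [| a l IH]; intros [| b m]; simpl; try ring.
  rewrite IH, RtoC_plus; ring.
Qed.

Lemma peval_popp l z : peval (popp l) z = (- peval l z)%C.
Proof. induction l as [| a l IH]; simpl; [ring | rewrite IH, RtoC_opp; ring]. Qed.

Lemma pnorm_pos l : 0 <= pnorm l.
Proof. induction l; simpl; [lra | generalize (Rabs_pos a); lra]. Qed.

Lemma pnorm_padd l m : pnorm (padd l m) <= pnorm l + pnorm m.
Proof.
  revert m; induction l as [| a l IH]; intros [| b m]; simpl; try lra.
  generalize (IH m) (Rabs_triang a b); lra.
Qed.

Lemma pnorm_popp l : pnorm (popp l) = pnorm l.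
Proof. induction l; simpl; [reflexivity | now rewrite Rabs_Ropp, IHl]. Qed.

Lemma length_padd l m : length (padd l m) = Nat.max (length l) (length m).
Proof. revert m; induction l as [| a l IH]; intros [| b m]; simpl; auto. Qed.

Lemma length_pder l : length (pder l) = (length l - 1)%nat.
Proof.
  induction l as [| a [| b l] IH]; [reflexivity | reflexivity |].
  change (pder (a :: b :: l)) with (padd (b :: l) (0 :: pder (b :: l))).
  rewrite length_padd; cbn [length] in *; rewrite IH; lia.
Qed.

Lemma pnorm_pder l n : (length l <= S n)%nat -> pnorm (pder l) <= INR n * pnorm l.
Proof.
  revert n; induction l as [| a [| b l] IH]; intros n Hn; [simpl; lra | |].
  - simpl; generalize (Rabs_pos a) (pos_INR n); nra.
  - change (pder (a :: b :: l)) with (padd (b :: l) (0 :: pder (b :: l))).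
    simpl in Hn; destruct n as [| n]; [lia |].
    specialize (IH n ltac:(simpl; lia)); rewrite S_INR.
    eapply Rle_trans; [apply pnorm_padd |].
    change (pnorm (0 :: pder (b :: l))) with (Rabs 0 + pnorm (pder (b :: l))).
    change (pnorm (a :: b :: l)) with (Rabs a + pnorm (b :: l)).
    rewrite Rabs_R0; generalize (Rabs_pos a) (pos_INR n) (pnorm_pos (b :: l)); nra.
Qed.

Lemma Cmod_peval l z : Cmod z <= 1 -> Cmod (peval l z) <= pnorm l.
Proof.
  intros Hz; induction l as [| a l IH]; simpl; [rewrite Cmod_0; lra |].
  eapply Rle_trans; [apply Cmod_triangle |]; rewrite Cmod_R, Cmod_mult.
  generalize (Cmod_ge_0 z) (Cmod_ge_0 (peval l z)); nra.
Qed.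

Lemma derivC_peval l z t z' : derivC z t z' ->
  derivC (fun s => peval l (z s)) t (peval (pder l) (z t) * z')%C.
Proof.
  intros Hz; induction l as [| a [| b l] IH].
  - eapply derivC_eq; [exact (derivC_const 0%C t) | simpl; ring].
  - eapply derivC_eq; [apply (derivC_ext (fun _ => RtoC a)); [intros; simpl; ring | apply derivC_const] | simpl; ring].
  - change (pder (a :: b :: l)) with (padd (b :: l) (0 :: pder (b :: l))).
    change (derivC (fun s => RtoC a + z s * peval (b :: l) (z s))%C t
      (peval (padd (b :: l) (0 :: pder (b :: l))) (z t) * z')%C).
    eapply derivC_eq; [apply derivC_plus; [apply derivC_const | apply derivC_mult; eassumption] |].
    rewrite peval_padd; cbn [peval]; ring.
Qed.

Fixpoint pevalR (l : list R) (r : R) : R :=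
  match l with nil => 0 | a :: l => a + r * pevalR l r end.

Lemma peval_RtoC l r : peval l (RtoC r) = RtoC (pevalR l r).
Proof. induction l; simpl; [reflexivity | now rewrite IHl, RtoC_plus, RtoC_mult]. Qed.

Lemma pevalR_padd l m r : pevalR (padd l m) r = pevalR l r + pevalR m r.
Proof.
  revert m; induction l as [| a l IH]; intros [| b m]; simpl; try ring.
  rewrite IH; ring.
Qed.

Lemma derive_pevalR l r : is_derive (pevalR l) r (pevalR (pder l) r).
Proof.
  induction l as [| a [| b l] IH]; [apply @is_derive_const | |].
  { apply (is_derive_ext (fun _ => a)); [intros; simpl; ring | apply @is_derive_const]. }
  change (pder (a :: b :: l)) with (padd (b :: l) (0 :: pder (b :: l))).
  change (is_derive (fun r => a + r * pevalR (b :: l) r) r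
    (pevalR (padd (b :: l) (0 :: pder (b :: l))) r)).
  evar_last.
  - apply @is_derive_plus; [apply @is_derive_const |].
    apply (is_derive_mult (fun r => r) (pevalR (b :: l))); [apply @is_derive_id | exact IH | intros; apply Rmult_comm].
  - rewrite pevalR_padd; cbn [pevalR]; unfold plus, zero, mult, one; simpl; ring.
Qed.

(* [0 :: sigtail j] lists the coefficients of the polynomial [P] such that the [j]-th derivative
   of [1 / (1 + exp t)] is [P (1 / (1 + exp t))]: differentiation is [P -> (X^2 - X) P']. *)
Fixpoint sigtail (j : nat) : list R :=
  match j with
  | O => 1 :: nil
  | S j => let d := pder (0 :: sigtail j) in padd (0 :: d) (popp d)
  end.

Definition sigpoly (j : nat) : list R := 0 :: sigtail j.

Lemma length_sigtail j : length (sigtail j) = S j.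
Proof.
  induction j as [| j IH]; [reflexivity |].
  cbn [sigtail]; set (d := pder (0 :: sigtail j)).
  assert (Hd : length d = S j).
  { unfold d; rewrite length_pder; simpl length; lia. }
  rewrite length_padd; unfold popp; rewrite length_map; simpl length; lia.
Qed.

(** The factor [X^2 - X] at most doubles the norm, and differentiation in degree [j + 1] multiplies
    it by at most [j + 1]. *)
Lemma pnorm_sigtail j : pnorm (sigtail j) <= 2 ^ j * INR (fact j).
Proof.
  induction j as [| j IH]; [simpl; rewrite Rabs_R1; lra |].
  cbn [sigtail]; set (d := pder (0 :: sigtail j)).
  assert (Hd : pnorm d <= INR (S j) * pnorm (sigtail j)).
  { unfold d; eapply Rle_trans; [apply (pnorm_pder _ (S j)); simpl; rewrite length_sigtail; lia |].
    simpl pnorm; rewrite Rabs_R0; lra. }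
  eapply Rle_trans; [apply pnorm_padd |]; rewrite pnorm_popp; cbn [pnorm]; rewrite Rabs_R0.
  rewrite fact_simpl, mult_INR; simpl pow.
  generalize (pos_INR (S j)); nra.
Qed.

Lemma peval_sigpoly_S j z :
  peval (sigpoly (S j)) z = (peval (pder (sigpoly j)) z * (z * z - z))%C.
Proof.
  unfold sigpoly; cbn [peval sigtail]; rewrite peval_padd, peval_popp; cbn [peval]; ring.
Qed.

Lemma Cmod_sigpoly j z : Cmod z <= 1 ->
  Cmod (peval (sigpoly j) z) <= 2 ^ j * INR (fact j) * Cmod z.
Proof.
  intros Hz; unfold sigpoly; cbn [peval].
  replace (_ + _)%C with (z * peval (sigtail j) z)%C by ring; rewrite Cmod_mult.
  generalize (Cmod_peval (sigtail j) z Hz) (pnorm_sigtail j) (Cmod_ge_0 z); nra.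
Qed.

(** The function [1 / (1 + exp t)] turns into its complement to 1 under [t -> - t], so its
    derivatives are alternately odd and even. At [r = 1/2], that is [t = 0], this kills the
    derivatives of even order from 2 on. *)
Lemma sigpoly_sym j r :
  pevalR (sigpoly (S j)) (1 - r) = (-1) ^ j * pevalR (sigpoly (S j)) r.
Proof.
  assert (HS : forall j r, pevalR (sigpoly (S j)) r = pevalR (pder (sigpoly j)) r * (r * r - r)).
  { intros i s; apply RtoC_inj; rewrite <- peval_RtoC, peval_sigpoly_S, peval_RtoC.
    rewrite RtoC_mult, RtoC_minus, RtoC_mult; ring. }
  revert r; induction j as [| j IH]; intros r.
  - rewrite !HS; simpl; ring.
  - rewrite !(HS (S j)).
    assert (D : - pevalR (pder (sigpoly (S j))) (1 - r) = (-1) ^ j * pevalR (pder (sigpoly (S j))) r).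
    { transitivity (Derive (fun r => pevalR (sigpoly (S j)) (1 - r)) r).
      - symmetry; apply is_derive_unique.
        evar_last; [apply (is_derive_comp (pevalR (sigpoly (S j))) (fun r => 1 - r)); [apply derive_pevalR |] |].
        + auto_derive; [auto | reflexivity].
        + unfold scal; simpl; unfold mult; simpl; ring.
      - apply is_derive_unique, (is_derive_ext (fun r => (-1) ^ j * pevalR (sigpoly (S j)) r)).
        + intros t; now rewrite IH.
        + apply is_derive_scal, derive_pevalR. }
    cbn [pow]; transitivity (- pevalR (pder (sigpoly (S j))) (1 - r) * -1 * (r * r - r)); [ring |].
    rewrite D; ring.
Qed.

Lemma sigpoly_half i : peval (sigpoly (2 * i + 2)) (RtoC (1 / 2)) = 0%C.
Proof.
  rewrite peval_RtoC; apply (f_equal RtoC).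
  replace (2 * i + 2)%nat with (S (S (2 * i))) by lia.
  assert (H := sigpoly_sym (S (2 * i)) (1 / 2)).
  rewrite pow_1_odd in H; replace (1 - 1/2) with (1/2) in H by field; lra.
Qed.

Lemma exp_three_quarters : 2 <= exp (3 / 4).
Proof.
  replace (3/4) with (3/32 * INR 8) by (simpl; field).
  assert (H := exp_ineq1_le (3/32)).
  assert (E : exp (3/32 * INR 8) = exp (3/32) ^ 8).
  { simpl; repeat rewrite <- exp_plus || rewrite Rmult_1_r; f_equal; field. }
  rewrite E; apply Rle_trans with ((35/32) ^ 8); [lra | apply pow_incr; lra].
Qed.

Definition slope (x u : R) : C := (x, x * u).

Section Sector.

Variables x u : R.
Hypothesis Hx : 0 < x.
Hypothesis Hu : -2 <= u <= 2.

Let tau : C := slope x u.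

Definition sg (s : R) : C := (/ (1 + Cexp (RtoC s * slope x u)))%C.

Lemma sg_denom s : (1 + Cexp (RtoC s * tau))%C <> 0%C.
Proof.
  intros H.
  assert (E : Cexp (RtoC s * tau) = (-1)%C) by (rewrite <- (Cplus_0_r (-1)), <- H; ring).
  assert (M := Cmod_Cexp (RtoC s * tau)); rewrite E in M.
  rewrite Cmod_R, Rabs_left in M by lra; replace (- -1) with 1 in M by ring.
  unfold tau, slope in M; simpl in M.
  assert (s * x - 0 * (x * u) = 0) by (apply exp_inv; rewrite exp_0, <- M; auto).
  assert (s = 0) by nra; subst s.
  replace (RtoC 0 * tau)%C with (RtoC 0) in E by ring; rewrite Cexp_0 in E.
  injection E; lra.
Qed.

Lemma derivC_sg s : derivC sg s (tau * (sg s * sg s - sg s))%C.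
Proof.
  eapply derivC_eq.
  - apply derivC_inv; [| apply sg_denom].
    apply derivC_plus; [apply derivC_const |].
    apply derivC_Cexp, derivC_mult; [apply derivC_id | apply derivC_const].
  - unfold sg; fold tau; field; apply sg_denom.
Qed.

(** The bound [|u| <= 2] keeps [1 + exp (s t)] away from its zeros. If the cosine is nonnegative,
    adding 1 does not lower the modulus. Otherwise [2 s x > pi / 2], which forces [exp (s x) >= 2]
    and hence [exp (s x) - 1 >= exp (s x) / 2]. *)
Lemma sg_denom_lower s : 0 <= s ->
  1 <= Cmod (1 + Cexp (RtoC s * tau))%C /\ exp (s * x) / 2 <= Cmod (1 + Cexp (RtoC s * tau))%C.
Proof.
  intros Hs.
  set (e := exp (s * x)); set (c := cos (s * (x * u))).
  assert (Hsx : 0 <= s * x) by nra.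
  assert (He : 1 <= e) by (unfold e; generalize (exp_ineq1_le (s * x)); lra).
  assert (E : Cexp (RtoC s * tau) = (e * c, e * sin (s * (x * u)))).
  { unfold Cexp, tau, slope, e, c; simpl; f_equal; f_equal; f_equal; ring. }
  assert (M : Cmod (Cexp (RtoC s * tau)) = e).
  { rewrite Cmod_Cexp; unfold tau, slope, e; simpl; f_equal; ring. }
  destruct (Rle_lt_dec 0 c) as [Hc | Hc].
  - assert (Hm : sqrt (e ^ 2) <= Cmod (1 + Cexp (RtoC s * tau))%C).
    { rewrite <- M, E; unfold Cmod; rewrite <- Rsqr_pow2, sqrt_Rsqr_abs, Rabs_pos_eq by apply sqrt_pos.
      apply sqrt_le_1_alt; cbn [fst snd Cplus RtoC]; nra. }
    rewrite sqrt_pow2 in Hm by lra. lra.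
  - assert (Hh : 3 / 4 <= s * x).
    { destruct (Rle_lt_dec (3/4) (s * x)) as [H | H]; [exact H | exfalso].
      assert (- (PI / 2) <= s * (x * u) <= PI / 2).
      { assert (HP := PI2_3_2); split; nra. }
      generalize (cos_ge_0 (s * (x * u))); fold c; lra. }
    assert (He2 : 2 <= e).
    { eapply Rle_trans; [apply exp_three_quarters |]; unfold e.
      destruct Hh as [Hh | Hh]; [left; now apply exp_increasing | rewrite Hh; lra]. }
    assert (Ht : e - 1 <= Cmod (1 + Cexp (RtoC s * tau))%C).
    { rewrite <- M.
      assert (T := Cmod_triangle (1 + Cexp (RtoC s * tau)) (- (1))).
      replace (1 + Cexp (RtoC s * tau) + - (1))%C with (Cexp (RtoC s * tau)) in T by ring.
      rewrite Cmod_opp, Cmod_1 in T; lra. }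
    lra.
Qed.

Lemma Cmod_sg_le_1 s : 0 <= s -> Cmod (sg s) <= 1.
Proof.
  intros Hs; destruct (sg_denom_lower s Hs) as [H _]; unfold sg; fold tau.
  rewrite Cmod_inv by apply sg_denom.
  apply Rle_trans with (/ 1); [apply Rinv_le_contravar; lra | rewrite Rinv_1; lra].
Qed.

Lemma Cmod_sg_le_exp s : 0 <= s -> Cmod (sg s) <= 2 * exp (- (s * x)).
Proof.
  intros Hs; destruct (sg_denom_lower s Hs) as [_ H]; unfold sg; fold tau.
  rewrite Cmod_inv by apply sg_denom.
  rewrite exp_Ropp; assert (He := exp_pos (s * x)).
  replace (2 * / exp (s * x)) with (/ (exp (s * x) / 2)) by (field; lra).
  apply Rinv_le_contravar; lra.
Qed.

(** Leibniz formula for the [j]-th derivative in [s] of [s / (1 + exp (s t))]: the factor [s] leaves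
    only two terms. *)
Definition sgderiv (j : nat) (s : R) : C :=
  (Cpow (slope x u) j * (RtoC s * peval (sigpoly j) (sg s))
   + match j with O => 0 | S i => RtoC (INR j) * Cpow (slope x u) i * peval (sigpoly i) (sg s) end)%C.

Lemma derivC_sigpoly j s :
  derivC (fun s => peval (sigpoly j) (sg s)) s (tau * peval (sigpoly (S j)) (sg s))%C.
Proof.
  eapply derivC_eq; [apply derivC_peval, derivC_sg |].
  rewrite peval_sigpoly_S; ring.
Qed.

Lemma derivC_sgderiv j s : derivC (sgderiv j) s (sgderiv (S j) s).
Proof.
  unfold sgderiv; fold tau; eapply derivC_eq.
  - apply derivC_plus.
    + apply derivC_mult; [apply derivC_const |].
      apply derivC_mult; [apply derivC_id | apply derivC_sigpoly].
    + instantiate (1 := match j with O => 0%C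
        | S i => (RtoC (INR j) * Cpow tau j * peval (sigpoly j) (sg s))%C end).
      destruct j as [| i]; [apply derivC_const |].
      eapply derivC_eq; [apply derivC_mult; [apply derivC_const | apply derivC_sigpoly] |].
      cbn [Cpow]; ring.
  - rewrite S_INR, RtoC_plus; destruct j as [| i]; cbn [Cpow]; [simpl INR; ring | ring].
Qed.

Lemma sg_0 : sg 0 = RtoC (1 / 2).
Proof.
  unfold sg; replace (RtoC 0 * slope x u)%C with (RtoC 0) by ring; rewrite Cexp_0.
  rewrite <- RtoC_plus, <- RtoC_inv by lra; f_equal; field.
Qed.

Lemma sgderiv_0_0 : sgderiv 0 0 = 0%C.
Proof. unfold sgderiv; ring. Qed.

Lemma sgderiv_1_0 : sgderiv 1 0 = RtoC (1 / 2).
Proof.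
  unfold sgderiv; rewrite sg_0; unfold sigpoly; simpl; unfold Cmult, Cplus, RtoC; simpl; f_equal; field.
Qed.

(** At [s = 0] only the second Leibniz term is left, and it carries a derivative of even order of
    the logistic function. *)
Lemma sgderiv_odd_0 i : sgderiv (2 * i + 3) 0 = 0%C.
Proof.
  unfold sgderiv; replace (2 * i + 3)%nat with (S (2 * i + 2)) by lia.
  rewrite sg_0, sigpoly_half; ring.
Qed.

Lemma Cmod_sgderiv j s : 0 <= s -> Cmod tau <= 1 ->
  Cmod (sgderiv (S j) s)
    <= 2 ^ S j * INR (fact (S j)) * Cmod tau ^ j * ((Cmod tau * s + 1) * (2 * exp (- (s * x)))).
Proof.
  intros Hs Ht; unfold sgderiv; fold tau.
  assert (H1 := Cmod_sg_le_1 s Hs); assert (H2 := Cmod_sg_le_exp s Hs).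
  assert (P1 := Cmod_sigpoly (S j) _ H1); assert (P0 := Cmod_sigpoly j _ H1).
  eapply Rle_trans; [apply Cmod_triangle |].
  rewrite !Cmod_mult, !Cmod_pow, !Cmod_R, !Rabs_pos_eq by (auto using pos_INR).
  assert (G := Cmod_ge_0 tau); assert (G2 := Cmod_ge_0 (sg s)).
  assert (Gp := pow_le _ j G); assert (F2 : 0 <= 2 ^ j) by (apply pow_le; lra).
  assert (F := pos_INR (fact j)); assert (FS := pos_INR (S j)).
  assert (K : INR (fact (S j)) = INR (S j) * INR (fact j)) by (rewrite fact_simpl, mult_INR; auto).
  rewrite K in *; simpl pow in *.
  set (m := Cmod (sg s)) in *; set (t := Cmod tau) in *; set (T := t ^ j) in *.
  set (A := INR (S j) * INR (fact j)) in *.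
  apply Rle_trans with ((2 * 2 ^ j * A) * T * ((t * s + 1) * m)).
  - replace (2 * 2 ^ j * A * T * ((t * s + 1) * m))
      with (t * T * (s * (2 * 2 ^ j * A * m)) + INR (S j) * T * (2 * (2 ^ j * INR (fact j) * m))) by (unfold A; ring).
    assert (0 <= 2 ^ j * INR (fact j) * m) by (repeat apply Rmult_le_pos; auto).
    apply Rplus_le_compat.
    + apply Rmult_le_compat_l; [now apply Rmult_le_pos |].
      now apply Rmult_le_compat_l.
    + apply Rmult_le_compat_l; [now apply Rmult_le_pos |]; lra.
  - apply Rmult_le_compat_l.
    + repeat apply Rmult_le_pos; auto; lra.
    + apply Rmult_le_compat_l; [nra | lra].
Qed.

End Sector.

(** * The integral of s / (1 + exp (s t)) *)

Fixpoint csum (f : nat -> C) (n : nat) : C :=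
  match n with O => 0%C | S n => (csum f n + f n)%C end.

Lemma csum_mult_l c f n : csum (fun i => c * f i)%C n = (c * csum f n)%C.
Proof. induction n; simpl; [ring | rewrite IHn; ring]. Qed.

Lemma Cmod_csum f n : Cmod (csum f n) <= rsum (fun i => Cmod (f i)) n.
Proof.
  induction n; simpl; [rewrite Cmod_0; lra |].
  eapply Rle_trans; [apply Cmod_triangle | lra].
Qed.

Lemma derivC_csum f g n t : (forall i, derivC (f i) t (g i)) ->
  derivC (fun s => csum (fun i => f i s) n) t (csum g n).
Proof. intros H; induction n; simpl; [apply derivC_const | now apply derivC_plus]. Qed.

(** Partial sums of [1 - 1/4 + 1/9 - ...], whose limit is [pi^2 / 12]. *)
Definition eta2 (n : nat) : R := rsum (fun i => (-1) ^ i / INR (S i) ^ 2) n.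

Section SigmoidIntegral.

Variables x u : R.
Hypothesis Hx : 0 < x.
Hypothesis Hu : -2 <= u <= 2.

Let tau : C := slope x u.

Lemma slope_neq_0 : tau <> 0%C.
Proof. unfold tau, slope; intros H; injection H; lra. Qed.

Lemma slope_ge : x <= Cmod tau.
Proof. eapply Rle_trans; [| apply re_le_Cmod]; unfold tau, slope; simpl; apply Rle_abs. Qed.

Lemma slope_le : Cmod tau <= 9 / 4 * x.
Proof.
  unfold tau, slope, Cmod; cbn [fst snd].
  apply Rsqr_incr_0_var; [| lra].
  rewrite Rsqr_sqrt by (generalize (pow2_ge_0 x) (pow2_ge_0 (x * u)); lra).
  assert (u ^ 2 <= 4) by nra.
  unfold Rsqr; replace ((x * u) ^ 2) with (x ^ 2 * u ^ 2) by ring.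
  assert (0 <= x ^ 2) by apply pow2_ge_0; nra.
Qed.

Let w (i : nat) : C := (RtoC (INR (S i)) * tau)%C.
Let A (i : nat) (s : R) : C := (- (RtoC s / w i + / (w i * w i)) * Cexp (- (RtoC s * w i)))%C.

Lemma w_neq_0 i : w i <> 0%C.
Proof.
  apply Cmult_neq_0; [| apply slope_neq_0].
  intros H; apply RtoC_inj in H; generalize (pos_INR i); rewrite S_INR in H; lra.
Qed.

Lemma derivC_A i s : derivC (A i) s (RtoC s * Cexp (- (RtoC s * w i)))%C.
Proof.
  unfold A; eapply derivC_eq.
  - apply derivC_mult.
    + apply (derivC_ext (fun s => (- (1)) * (RtoC s * / w i + / (w i * w i)))%C); [intros; unfold Cdiv; ring |].
      apply derivC_mult; [apply derivC_const |].
      apply derivC_plus; [| apply derivC_const].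
      apply derivC_mult; [apply derivC_id | apply derivC_const].
    + apply derivC_Cexp, (derivC_ext (fun s => (RtoC s * - w i)%C)); [intros; ring |].
      apply derivC_mult; [apply derivC_id | apply derivC_const].
  - cbv beta; replace (RtoC s * - w i)%C with (- (RtoC s * w i))%C by ring; field; apply w_neq_0.
Qed.

(** Finite geometric expansion in powers of [- exp (- s t)]; its exact remainder avoids exchanging
    an infinite sum with the integral. *)
Lemma sigmoid_expansion s J :
  sg x u s = (csum (fun i => RtoC ((-1) ^ i) * Cexp (- (RtoC s * w i))) J
              + RtoC ((-1) ^ J) * Cexp (- (RtoC (INR J * s) * tau)) * sg x u s)%C.
Proof.
  assert (Hz : forall n, Cexp (- (RtoC s * w n))%C
     = (Cexp (- (RtoC (INR n * s) * tau)) * Cexp (- (RtoC s * tau)))%C).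
  { intros n; rewrite <- Cexp_plus; f_equal; unfold w; rewrite S_INR, RtoC_plus, RtoC_mult; ring. }
  assert (Hs : sg x u s = (Cexp (- (RtoC s * tau)) - Cexp (- (RtoC s * tau)) * sg x u s)%C).
  { unfold sg; fold tau; assert (Hd := sg_denom x u Hx s); fold tau in Hd.
    transitivity (Cexp (- (RtoC s * tau)) * Cexp (RtoC s * tau) * / (1 + Cexp (RtoC s * tau)))%C;
      [rewrite Cexp_opp; ring | field; exact Hd]. }
  induction J as [| J IH].
  - simpl; rewrite Rmult_0_l; replace (- (RtoC 0 * tau))%C with (RtoC 0) by ring; rewrite Cexp_0; ring.
  - rewrite IH at 1; cbn [csum]; rewrite Hz.
    replace (Cexp (- (RtoC (INR (S J) * s) * tau))%C)
      with (Cexp (- (RtoC (INR J * s) * tau)) * Cexp (- (RtoC s * tau)))%C.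
    2:{ rewrite <- Cexp_plus; f_equal; rewrite S_INR, !RtoC_mult, RtoC_plus; ring. }
    replace (RtoC ((-1) ^ S J)) with (- RtoC ((-1) ^ J))%C by (rewrite <- RtoC_opp; f_equal; simpl; ring).
    revert Hs; generalize (sg x u s) (Cexp (- (RtoC s * tau))); intros g z Hs.
    transitivity (csum (fun i => RtoC ((-1) ^ i) * Cexp (- (RtoC s * w i))) J
      + RtoC ((-1) ^ J) * Cexp (- (RtoC (INR J * s) * tau)) * (z - z * g))%C; [now rewrite <- Hs | ring].
Qed.

Lemma sgderiv_0 s : sgderiv x u 0 s = (RtoC s * sg x u s)%C.
Proof. unfold sgderiv, sigpoly; simpl; ring. Qed.

Let B (J : nat) (s : R) : C := csum (fun i => RtoC ((-1) ^ i) * A i s)%C J.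
Let Rem (J : nat) (s : R) : C := (sgderiv x u 0 s - csum (fun i => RtoC ((-1) ^ i) * (RtoC s * Cexp (- (RtoC s * w i)))) J)%C.

Lemma derivC_B J s :
  derivC (B J) s (csum (fun i => RtoC ((-1) ^ i) * (RtoC s * Cexp (- (RtoC s * w i)))) J)%C.
Proof.
  apply derivC_csum; intros i.
  eapply derivC_eq; [apply derivC_mult; [apply derivC_const | apply derivC_A] | cbv beta; ring].
Qed.

Lemma Cmod_Rem J s : 0 <= s -> Cmod (Rem J s) <= s * exp (- (INR J * x * s)).
Proof.
  intros Hs.
  replace (Rem J s) with (RtoC s * (RtoC ((-1) ^ J) * Cexp (- (RtoC (INR J * s) * tau)) * sg x u s))%C.
  - rewrite !Cmod_mult, !Cmod_R, Cmod_Cexp, <- RPow_abs, (Rabs_left (-1)) by lra.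
    replace (- -1) with 1 by ring; rewrite pow1, Rmult_1_l, Rabs_pos_eq by auto.
    apply Rmult_le_compat_l; [auto |].
    rewrite <- (Rmult_1_r (exp (- (INR J * x * s)))).
    apply Rmult_le_compat; [left; apply exp_pos | apply Cmod_ge_0 | | now apply Cmod_sg_le_1].
    right; f_equal; unfold tau, slope; simpl; ring.
  - unfold Rem; rewrite sgderiv_0.
    replace (csum (fun i => RtoC ((-1) ^ i) * (RtoC s * Cexp (- (RtoC s * w i)))) J)%C
      with (RtoC s * csum (fun i => RtoC ((-1) ^ i) * Cexp (- (RtoC s * w i))) J)%C.
    + generalize (sigmoid_expansion s J).
      generalize (csum (fun i => RtoC ((-1) ^ i) * Cexp (- (RtoC s * w i))) J)%C.
      generalize (RtoC ((-1) ^ J) * Cexp (- (RtoC (INR J * s) * tau)))%C.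
      intros y c Hse; transitivity (RtoC s * (c + y * sg x u s) - RtoC s * c)%C; [ring | now rewrite <- Hse].
    + rewrite <- csum_mult_l; clear; induction J; cbn [csum]; [reflexivity | rewrite IHJ; ring].
Qed.

Lemma B_0 J : B J 0 = (- (RtoC (eta2 J) / (tau * tau)))%C.
Proof.
  unfold B, eta2; induction J as [| J IH]; cbn [csum rsum].
  - field; apply slope_neq_0.
  - rewrite IH; unfold A.
    replace (- (RtoC 0 * w J))%C with (RtoC 0) by ring; rewrite Cexp_0.
    rewrite RtoC_plus, RtoC_div by (apply pow_nonzero; rewrite S_INR; generalize (pos_INR J); lra).
    replace (RtoC (INR (S J) ^ 2)) with (RtoC (INR (S J)) * RtoC (INR (S J)))%C
      by (rewrite <- RtoC_mult; f_equal; ring).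
    unfold w; field; split; [| apply slope_neq_0].
    intros H; apply RtoC_inj in H; generalize (pos_INR J); rewrite S_INR in H; lra.
Qed.

Lemma Cmod_B J s : 0 <= s -> Cmod (B J s) <= INR J * ((s / x + / x ^ 2) * exp (- (s * x))).
Proof.
  intros Hs; unfold B; eapply Rle_trans; [apply Cmod_csum |].
  rewrite <- rsum_const; apply rsum_le; intros i _.
  rewrite Cmod_mult, Cmod_R, <- RPow_abs, (Rabs_left (-1)) by lra.
  replace (- -1) with 1 by ring; rewrite pow1, Rmult_1_l.
  unfold A; rewrite Cmod_mult, Cmod_opp, Cmod_Cexp.
  assert (Hi : 1 <= INR (S i)) by (rewrite S_INR; generalize (pos_INR i); lra).
  assert (Hw : x <= Cmod (w i)).
  { unfold w; rewrite Cmod_mult, Cmod_R, Rabs_pos_eq by lra; generalize slope_ge; nra. }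
  apply Rmult_le_compat; [apply Cmod_ge_0 | left; apply exp_pos | |].
  - eapply Rle_trans; [apply Cmod_triangle |].
    rewrite Cmod_div, Cmod_inv, Cmod_mult, Cmod_R, Rabs_pos_eq
      by (auto using w_neq_0, Cmult_neq_0).
    apply Rplus_le_compat.
    + apply Rmult_le_compat_l; [auto |]; now apply Rinv_le_contravar.
    + apply Rinv_le_contravar; [apply pow_lt; lra |].
      replace (x ^ 2) with (x * x) by ring; apply Rmult_le_compat; lra.
  - assert (E : fst (- (RtoC s * w i))%C = - (INR (S i) * (s * x))).
    { unfold w, tau, slope; simpl; ring. }
    assert (0 <= s * x) by (apply Rmult_le_pos; lra).
    rewrite E; assert (1 * (s * x) <= INR (S i) * (s * x)) by (apply Rmult_le_compat_r; lra).
    rewrite Rmult_1_l in *.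
    destruct H0 as [H0 | H0]; [left; apply exp_increasing; lra | rewrite <- H0; lra].
Qed.

Lemma Int_s_exp c N : 0 < c -> 0 <= N -> Int (fun s => s * exp (- (c * s))) 0 N <= / c ^ 2.
Proof.
  intros Hc HN.
  rewrite (Int_of_derive (fun s => - (s / c + / c ^ 2) * exp (- (c * s)))).
  - replace (- (c * 0)) with 0 by ring; rewrite exp_0.
    assert (H := exp_pos (- (c * N))).
    assert (0 < / c) by now apply Rinv_0_lt_compat.
    assert (0 < / c ^ 2) by (apply Rinv_0_lt_compat; apply pow_lt; auto).
    unfold Rdiv; assert (0 <= N * / c) by (apply Rmult_le_pos; lra).
    nra.
  - intros s; auto_derive; [auto |]; field; lra.
  - intros s; apply (ex_derive_continuous (fun s => s * exp (- (c * s)))); auto_derive; auto.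
Qed.

(** In order: truncation of the alternating series, the antiderivatives at the upper end, the
    remainder of the geometric expansion. The same [N] is the number of terms and the upper
    limit. *)
Definition sigint_err (N : nat) : R :=
  Rabs (eta2 N - PI ^ 2 / 12) / x ^ 2
  + INR N * ((INR N / x + / x ^ 2) * exp (- (INR N * x))) + / (INR N * x) ^ 2.

(** [pr] is meant to be [fst] or [snd]; the hypotheses on it are what both share, so one real
    computation covers both components. *)
Lemma sigmoid_integral (pr : C -> R) N : (0 < N)%nat ->
  (forall a b, pr (a + b)%C = pr a + pr b) -> (forall a, pr (- a)%C = - pr a) ->
  (forall z, Rabs (pr z) <= Cmod z) ->
  (forall f s l, derivC f s l -> is_derive (fun s => pr (f s)) s (pr l)) ->
  Rabs (Int (fun s => pr (sgderiv x u 0 s)) 0 (INR N) - pr (RtoC (PI ^ 2 / 12) / (tau * tau))%C)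
    <= sigint_err N.
Proof.
  intros HN Hp Ho Hm Hd.
  assert (HN' : 0 < INR N) by now apply lt_0_INR.
  assert (Cd : forall f f' : R -> C, (forall s, derivC f s (f' s)) -> forall s, continuous (fun s => pr (f s)) s).
  { intros f f' H s; eapply derive_continuous, Hd, H. }
  assert (CT : forall i s, derivC (fun s => RtoC ((-1) ^ i) * (RtoC s * Cexp (- (RtoC s * w i))))%C s
     (RtoC ((-1) ^ i) * (Cexp (- (RtoC s * w i)) + RtoC s * (- w i * Cexp (- (RtoC s * w i)))))%C).
  { intros i s; eapply derivC_eq.
    - apply derivC_mult; [apply derivC_const |]; apply derivC_mult; [apply derivC_id |].
      apply derivC_Cexp, (derivC_ext (fun s => (RtoC s * - w i)%C)); [intros; ring |].
      apply derivC_mult; [apply derivC_id | apply derivC_const].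
    - cbv beta; replace (RtoC s * - w i)%C with (- (RtoC s * w i))%C by ring; ring. }
  assert (CS : forall s, continuous (fun s => pr (csum (fun i => RtoC ((-1) ^ i) * (RtoC s * Cexp (- (RtoC s * w i)))) N)%C) s).
  { eapply Cd; intros s; apply derivC_csum; intros i; apply CT. }
  assert (C0 : forall s, continuous (fun s => pr (sgderiv x u 0 s)) s).
  { eapply Cd; intros; now apply derivC_sgderiv. }
  assert (CR : forall s, continuous (fun s => pr (Rem N s)) s).
  { intros s; apply (continuous_ext (fun s => pr (sgderiv x u 0 s)
       - pr (csum (fun i => RtoC ((-1) ^ i) * (RtoC s * Cexp (- (RtoC s * w i)))) N)%C)).
    - intros t; unfold Rem, Cminus; rewrite Hp, Ho; reflexivity.
    - apply (continuous_minus (V := R_NormedModule)); auto. }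
  assert (E : Int (fun s => pr (sgderiv x u 0 s)) 0 (INR N)
     = pr (B N (INR N)) - pr (B N 0) + Int (fun s => pr (Rem N s)) 0 (INR N)).
  { rewrite <- (Int_of_derive (fun s => pr (B N s))
      (fun s => pr (csum (fun i => RtoC ((-1) ^ i) * (RtoC s * Cexp (- (RtoC s * w i)))) N)%C));
      [| intros; apply Hd, derivC_B | auto].
    rewrite <- Int_add by auto; apply Int_ext; intros s; rewrite <- Hp; f_equal; unfold Rem; ring. }
  rewrite E, B_0, Ho.
  assert (H1 : Rabs (pr (B N (INR N))) <= INR N * ((INR N / x + / x ^ 2) * exp (- (INR N * x)))).
  { eapply Rle_trans; [apply Hm | apply Cmod_B; lra]. }
  assert (H2 : Rabs (Int (fun s => pr (Rem N s)) 0 (INR N)) <= / (INR N * x) ^ 2).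
  { eapply Rle_trans; [| apply (Int_s_exp (INR N * x) (INR N)); nra].
    apply Int_abs_le; [lra | auto | |].
    - intros s; apply (ex_derive_continuous (fun s => s * exp (- (INR N * x * s)))); auto_derive; auto.
    - intros s Hs; eapply Rle_trans; [apply Hm | apply Cmod_Rem; lra]. }
  assert (H3 : Rabs (pr (RtoC (eta2 N) / (tau * tau))%C - pr (RtoC (PI ^ 2 / 12) / (tau * tau))%C)
     <= Rabs (eta2 N - PI ^ 2 / 12) / x ^ 2).
  { unfold Rminus at 1; rewrite <- Ho, <- Hp.
    replace (_ + _)%C with (RtoC (eta2 N - PI ^ 2 / 12) / (tau * tau))%C
      by (rewrite RtoC_minus; field; apply slope_neq_0).
    eapply Rle_trans; [apply Hm |].
    rewrite Cmod_div, Cmod_R, Cmod_mult by (apply Cmult_neq_0; apply slope_neq_0).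
    apply Rmult_le_compat_l; [apply Rabs_pos |].
    apply Rinv_le_contravar; [apply pow_lt; auto |]; generalize slope_ge; simpl; nra. }
  unfold sigint_err.
  revert H1 H2 H3.
  generalize (pr (B N (INR N))) (Int (fun s => pr (Rem N s)) 0 (INR N))
    (pr (RtoC (eta2 N) / (tau * tau))%C) (pr (RtoC (PI ^ 2 / 12) / (tau * tau))%C).
  generalize (Rabs (eta2 N - PI ^ 2 / 12) / x ^ 2) (/ (INR N * x) ^ 2)
    (INR N * ((INR N / x + / x ^ 2) * exp (- (INR N * x)))).
  intros e1 e2 e3 a b c d; unfold Rabs; repeat destruct Rcase_abs; lra.
Qed.

End SigmoidIntegral.

(** * The Basel sum *)

(* Matsuoka's evaluation of the sum of inverse squares from the integrals of [cos^(2n)]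
   and [t^2 cos^(2n)] over a quarter period. *)
Definition cosI (n : nat) : R := Int (fun t => cos t ^ (2 * n)) 0 (PI / 2).
Definition cosJ (n : nat) : R := Int (fun t => t ^ 2 * cos t ^ (2 * n)) 0 (PI / 2).

Lemma continuous_smul (c : R) (f : R -> R) x : continuous f x -> continuous (fun x => c * f x) x.
Proof. apply (continuous_scal_r (V := R_NormedModule) c f). Qed.

Lemma continuous_sub (f g : R -> R) x : continuous f x -> continuous g x ->
  continuous (fun x => f x - g x) x.
Proof. apply (continuous_minus (V := R_NormedModule)). Qed.

Lemma INR_double n : INR (2 * n) = 2 * INR n.
Proof. now rewrite mult_INR. Qed.

Lemma cosI_continuous n t : continuous (fun t => cos t ^ (2 * n)) t.
Proof. apply (ex_derive_continuous (fun t => cos t ^ (2 * n))); auto_derive; auto. Qed.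

Lemma cosJ_continuous n t : continuous (fun t => t ^ 2 * cos t ^ (2 * n)) t.
Proof. apply (ex_derive_continuous (fun t => t ^ 2 * cos t ^ (2 * n))); auto_derive; auto. Qed.

Lemma cosI_rec n : 2 * INR (S n) * cosI (S n) = (2 * INR n + 1) * cosI n.
Proof.
  apply Rminus_diag_uniq; unfold cosI.
  rewrite <- !Int_scal, <- Int_sub; try (intros; apply cosI_continuous);
    try (intros; apply continuous_smul, cosI_continuous).
  rewrite (Int_of_derive (fun t => sin t * cos t ^ (2 * n + 1))).
  - rewrite sin_0, cos_PI2, pow_i by lia; ring.
  - intros t; auto_derive; [auto |].
    change (n + (n + 0))%nat with (2 * n)%nat.
    replace (Init.Nat.pred (2 * n + 1)) with (2 * n)%nat by lia.
        rewrite plus_INR, INR_double, (S_INR n), INR_1; replace (2 * S n)%nat with (2 * n + 2)%nat by lia.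
    rewrite !pow_add.
    assert (H := sin2_cos2 t); unfold Rsqr in H.
    replace (1 * - sin t) with (- sin t) by ring.
    transitivity (cos t ^ (2 * n) * (cos t * cos t - (2 * INR n + 1) * (sin t * sin t))); [ring |].
    replace (sin t * sin t) with (1 - cos t * cos t) by lra; ring.
  - intros t; apply continuous_sub;
      apply continuous_smul, cosI_continuous.
Qed.

(** Two integrations by parts, raising 1 to [t] and [t] to [t^2 / 2], merged into a single
    antiderivative. *)
Lemma cosIJ n : cosI (S n) = INR (S n) * (2 * INR n + 1) * cosJ n - 2 * INR (S n) ^ 2 * cosJ (S n).
Proof.
  apply Rminus_diag_uniq; unfold cosI, cosJ.
  rewrite <- !Int_scal, <- Int_sub, <- Int_sub;
    try (intros; apply cosI_continuous);
    try (intros; apply continuous_sub);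
    try (intros; apply continuous_smul, cosJ_continuous);
    try (intros; apply cosJ_continuous).
  rewrite (Int_of_derive (fun t => t * cos t ^ (2 * n + 2) + INR (S n) * (t ^ 2 * (sin t * cos t ^ (2 * n + 1))))).
  - rewrite cos_PI2, !pow_i by lia; ring.
  - intros t; auto_derive; [auto |].
    change (n + (n + 0))%nat with (2 * n)%nat.
    replace (Init.Nat.pred (2 * n + 1)) with (2 * n)%nat by lia.
    replace (Init.Nat.pred (2 * n + 2)) with (2 * n + 1)%nat by lia.
    change (match n with O => 1 | S _ => INR n + 1 end) with (INR (S n)).
    replace (2 * S n)%nat with (2 * n + 2)%nat by lia.
    rewrite !plus_INR, INR_double, (S_INR n), INR_1, !pow_add; replace (INR 2) with 2 by (simpl; ring).
    assert (H := sin2_cos2 t); unfold Rsqr in H.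
    set (c := cos t ^ (2 * n)).
    transitivity (c * (cos t * cos t) + (INR n + 1) * t ^ 2 * c * (cos t * cos t - (2 * INR n + 1) * (sin t * sin t)));
      [ring |].
    replace (sin t * sin t) with (1 - cos t * cos t) by lra; ring.
  - intros t; apply continuous_sub; [apply cosI_continuous |].
    apply continuous_sub;
      apply continuous_smul, cosJ_continuous.
Qed.

Lemma cosI_0 : cosI 0 = PI / 2.
Proof. unfold cosI; simpl; rewrite Int_const; ring. Qed.

Lemma cosJ_0 : cosJ 0 = PI ^ 3 / 24.
Proof.
  unfold cosJ; simpl pow; rewrite (Int_of_derive (fun t => t ^ 3 / 3)); [field | |].
  - intros t; auto_derive; [auto | field].
  - intros t; apply (ex_derive_continuous (fun t => t * (t * 1) * 1)); auto_derive; auto.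
Qed.

Lemma cosI_pos n : 0 < cosI n.
Proof.
  induction n as [| n IH]; [rewrite cosI_0; generalize PI_RGT_0; lra |].
  assert (H := cosI_rec n); assert (Hn := pos_INR n); rewrite S_INR in H.
  assert (0 < (2 * INR n + 1) * cosI n) by (apply Rmult_lt_0_compat; lra).
  destruct (Rlt_le_dec 0 (cosI (S n))); [auto | nra].
Qed.

(* The quotient [J_n / I_n] drops by [1 / (2 (n+1)^2)] at each step. *)
Lemma cosJ_sum n : cosJ n / cosI n = PI ^ 2 / 12 - rsum (fun i => / INR (S i) ^ 2) n / 2.
Proof.
  induction n as [| n IH].
  - rewrite cosI_0, cosJ_0; simpl; field; generalize PI_RGT_0; lra.
  - assert (H := cosIJ n); assert (R := cosI_rec n).
    assert (P := cosI_pos n); assert (P' := cosI_pos (S n)); assert (Hn := pos_INR n).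
    cbn [rsum].
    replace (PI ^ 2 / 12 - (rsum (fun i => / INR (S i) ^ 2) n + / INR (S n) ^ 2) / 2)
      with (cosJ n / cosI n - / INR (S n) ^ 2 / 2) by (rewrite IH; field; rewrite S_INR; lra).
    assert (EJ : cosJ (S n) = (INR (S n) * (2 * INR n + 1) * cosJ n - cosI (S n)) / (2 * INR (S n) ^ 2)).
    { rewrite H; field; rewrite S_INR; lra. }
    assert (EI : (2 * INR n + 1) = 2 * INR (S n) * cosI (S n) / cosI n) by (rewrite R; field; lra).
    rewrite EJ, EI; field; rewrite S_INR; lra.
Qed.

Lemma jordan t : 0 <= t <= PI / 2 -> t <= PI / 2 * sin t.
Proof.
  intros Ht; assert (HP := PI_RGT_0).
  destruct (Req_dec t 0) as [-> | H0]; [rewrite sin_0; lra |].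
  (* [sin] is concave: compare slopes on [0, t] and [t, pi/2]. *)
  destruct (Req_dec t (PI / 2)) as [-> | H1]; [rewrite sin_PI2; lra |].
  destruct (MVT_cor2 sin cos 0 t) as [c [Hc1 Hc2]]; [lra | intros; apply derivable_pt_lim_sin |].
  destruct (MVT_cor2 sin cos t (PI / 2)) as [d [Hd1 Hd2]]; [lra | intros; apply derivable_pt_lim_sin |].
  rewrite sin_0 in Hc1; rewrite sin_PI2 in Hd1.
  assert (cos d <= cos c) by (left; apply cos_decreasing_1; lra).
  assert (sin t = cos c * t) by lra.
  assert (1 = sin t + cos d * (PI / 2 - t)) by lra.
  assert (cos d * (PI / 2 - t) <= cos c * (PI / 2 - t)) by (apply Rmult_le_compat_r; lra).
  assert (1 <= cos c * (PI / 2)) by lra.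
  rewrite H2; assert (t * 1 <= t * (cos c * (PI / 2))) by (apply Rmult_le_compat_l; lra); lra.
Qed.

(** Jordan's inequality bounds [t^2 cos^(2n)] by [pi^2 / 4] times [cos^(2n) - cos^(2n+2)], and by
    the recurrence [I_n - I_(n+1) = I_n / (2 (n + 1))]. *)
Lemma cosJ_bound n : 0 <= cosJ n / cosI n <= PI ^ 2 / 8 / INR (S n).
Proof.
  assert (P := cosI_pos n); assert (Hn := pos_INR n).
  assert (HS : 0 < INR (S n)) by (rewrite S_INR; lra).
  assert (HP := PI_RGT_0).
  assert (B : 0 <= cosJ n).
  { replace 0 with (Int (fun _ => 0) 0 (PI / 2)) by (rewrite Int_const; ring).
    apply Int_le; [lra | intros; apply continuous_const | apply cosJ_continuous |].
    intros t Ht; apply Rmult_le_pos; [apply pow2_ge_0 | rewrite pow_mult; apply pow_le, pow2_ge_0]. }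
  assert (U : cosJ n <= PI ^ 2 / 4 * (cosI n - cosI (S n))).
  { unfold cosI, cosJ; rewrite <- Int_sub, <- Int_scal; try (intros; apply cosI_continuous).
    2:{ intros; apply continuous_sub; apply cosI_continuous. }
    apply Int_le; [lra | apply cosJ_continuous | |].
    - intros; apply continuous_smul, continuous_sub; apply cosI_continuous.
    - intros t Ht; replace (2 * S n)%nat with (2 * n + 2)%nat by lia; rewrite pow_add.
      replace (PI ^ 2 / 4 * (cos t ^ (2 * n) - cos t ^ (2 * n) * cos t ^ 2))
        with ((PI / 2 * sin t) ^ 2 * cos t ^ (2 * n)).
      + apply Rmult_le_compat_r; [rewrite pow_mult; apply pow_le, pow2_ge_0 |].
        apply pow_incr; split; [lra | now apply jordan].
      + generalize (sin2_cos2 t); unfold Rsqr; intros H.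
        generalize (cos t ^ (2 * n)); intros c.
        transitivity (PI ^ 2 / 4 * c * (sin t * sin t)); [field |].
        replace (sin t * sin t) with (1 - cos t * cos t) by lra; field. }
  assert (R := cosI_rec n).
  assert (E : cosI n - cosI (S n) = cosI n / (2 * INR (S n))).
  { apply (Rmult_eq_reg_l (2 * INR (S n))); [| lra].
    rewrite Rmult_minus_distr_l, R, S_INR; field; lra. }
  split; [apply Rmult_le_pos; [auto | left; now apply Rinv_0_lt_compat] |].
  apply (Rmult_le_reg_r (cosI n)); [auto |].
  replace (cosJ n / cosI n * cosI n) with (cosJ n) by (field; lra).
  eapply Rle_trans; [exact U |]; rewrite E; right; field; lra.
Qed.

Lemma zeta2_bound n :
  Rabs (rsum (fun i => / INR (S i) ^ 2) n - PI ^ 2 / 6) <= PI ^ 2 / 4 / INR (S n).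
Proof.
  assert (H := cosJ_bound n); rewrite cosJ_sum in H.
  apply Rabs_le; unfold Rdiv in *; lra.
Qed.

(** Alternating signs subtract twice the terms with even denominators, that is half of the sum up to
    [n]. *)
Lemma eta2_even n :
  eta2 (2 * n) = rsum (fun i => / INR (S i) ^ 2) (2 * n) - rsum (fun i => / INR (S i) ^ 2) n / 2.
Proof.
  unfold eta2; induction n as [| n IH]; [simpl; field |].
  replace (2 * S n)%nat with (S (S (2 * n))) by lia; cbn [rsum]; rewrite IH.
  rewrite pow_1_even, pow_1_odd.
  replace (S (S (2 * n))) with (2 * S n)%nat by lia.
  rewrite INR_double, (S_INR (2 * n)), INR_double, (S_INR n).
  assert (H := pos_INR n); field; lra.
Qed.

Lemma eta2_bound N : (0 < N)%nat -> Rabs (eta2 N - PI ^ 2 / 12) <= 20 / INR N.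
Proof.
  intros HN; assert (HP : PI ^ 2 <= 16) by (generalize PI_4 PI_RGT_0; nra).
  assert (Ev : forall n, Rabs (eta2 (2 * n) - PI ^ 2 / 12) <= 8 / INR (S (2 * n))).
  { intros n; rewrite eta2_even.
    assert (H1 := zeta2_bound (2 * n)); assert (H2 := zeta2_bound n).
    assert (Hn := pos_INR n).
    assert (B1 : PI ^ 2 / 4 / INR (S (2 * n)) <= 4 / INR (S (2 * n))).
    { apply Rmult_le_compat_r; [| lra]; left; apply Rinv_0_lt_compat, lt_0_INR; lia. }
    assert (B2 : PI ^ 2 / 4 / INR (S n) / 2 <= 4 / INR (S (2 * n))).
    { apply Rle_trans with (4 / INR (S n) / 2).
      - unfold Rdiv; apply Rmult_le_compat_r; [lra |]; apply Rmult_le_compat_r; [| lra].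
        left; apply Rinv_0_lt_compat, lt_0_INR; lia.
      - rewrite !S_INR, mult_INR; replace (INR 2) with 2 by (simpl; ring).
        replace (4 / (INR n + 1) / 2) with (4 * / (2 * (INR n + 1))) by (field; lra).
        apply Rmult_le_compat_l; [lra |]; apply Rinv_le_contravar; lra. }
    apply Rabs_le_between in H1; apply Rabs_le_between in H2; apply Rabs_le.
    replace (8 / INR (S (2 * n))) with (4 / INR (S (2 * n)) + 4 / INR (S (2 * n))) by (field; apply not_0_INR; lia).
    lra. }
  destruct (Nat.Even_or_Odd N) as [[n ->] | [n ->]].
  - eapply Rle_trans; [apply Ev |].
    assert (0 < INR (2 * n)) by (apply lt_0_INR; lia).
    apply Rle_trans with (8 / INR (2 * n)).
    + apply Rmult_le_compat_l; [lra |]; apply Rinv_le_contravar; [auto | apply le_INR; lia].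
    + apply Rmult_le_compat_r; [left; now apply Rinv_0_lt_compat | lra].
  - replace (2 * n + 1)%nat with (S (2 * n)) by lia.
    specialize (Ev n); unfold eta2 in *; cbn [rsum].
    rewrite pow_1_even.
    assert (Hp : 1 <= INR (S (2 * n))) by (rewrite S_INR; generalize (pos_INR (2 * n)); lra).
    assert (Hq : 1 / INR (S (2 * n)) ^ 2 <= 1 / INR (S (2 * n))).
    { apply Rmult_le_compat_l; [lra |]; apply Rinv_le_contravar; [lra |]; nra. }
    assert (Hr : 0 < 1 / INR (S (2 * n)) ^ 2) by (apply Rdiv_lt_0_compat; [lra | nra]).
    replace (20 / INR (S (2 * n))) with (8 / INR (S (2 * n)) + 12 * (1 / INR (S (2 * n)))) by (field; lra).
    apply Rabs_le_between in Ev; apply Rabs_le; lra.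
Qed.

(** * The logarithmic derivative of the generating function *)

Lemma exp_pow (y : R) n : exp (INR n * y) = exp y ^ n.
Proof.
  induction n as [| n IH]; [simpl; now rewrite Rmult_0_l, exp_0 |].
  rewrite S_INR, Rmult_plus_distr_r, exp_plus, IH, Rmult_1_l; simpl; ring.
Qed.

Lemma exp_neg_le_pow4 y : 0 < y -> exp (- y) <= 256 / y ^ 4.
Proof.
  intros Hy; rewrite exp_Ropp.
  replace (256 / y ^ 4) with (/ (y / 4) ^ 4) by (field; lra).
  apply Rinv_le_contravar; [apply pow_lt; lra |].
  replace y with (INR 4 * (y / 4)) at 2 by (simpl; field); rewrite exp_pow.
  apply pow_incr; generalize (exp_ineq1_le (y / 4)); lra.
Qed.

(** Minus the logarithmic derivative in [t] of [prod (1 + exp (- k t))], at [t = x (1 + i u)]. *)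
Definition sigsum (x u : R) (N : nat) : C :=
  csum (fun k => RtoC (INR (S k)) * sg x u (INR (S k)))%C N.

Lemma sgderiv_at_N_bound x u J N j : 0 < x <= 4 / 9 -> -2 <= u <= 2 -> (j <= S J)%nat ->
  Cmod (sgderiv x u j (INR N))
    <= 2 ^ S (S J) * INR (fact (S (S J))) * ((INR N + 1) * (2 * exp (- (INR N * x)))).
Proof.
  intros Hx Hu Hj.
  assert (HN := pos_INR N); assert (He := exp_pos (- (INR N * x))).
  assert (Ht := slope_le x u ltac:(lra) Hu); assert (Ht0 := Cmod_ge_0 (slope x u)).
  assert (HM : forall i, (i <= S (S J))%nat -> 1 <= 2 ^ i * INR (fact i) <= 2 ^ S (S J) * INR (fact (S (S J)))).
  { intros i Hi; assert (1 <= 2 ^ i) by (apply pow_R1_Rle; lra).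
    assert (1 <= INR (fact i)) by (apply (le_INR 1), lt_O_fact).
    split; [nra |].
    apply Rmult_le_compat; try lra; [apply Rle_pow; [lra | auto] | apply le_INR, fact_le; auto]. }
  destruct j as [| j].
  - rewrite sgderiv_0, Cmod_mult, Cmod_R, Rabs_pos_eq by auto.
    assert (H2 := Cmod_sg_le_exp x u ltac:(lra) Hu (INR N) HN); assert (G := Cmod_ge_0 (sg x u (INR N))).
    destruct (HM 0%nat ltac:(lia)) as [_ M]; simpl (2 ^ 0 * _) in M.
    apply Rle_trans with (1 * ((INR N + 1) * (2 * exp (- (INR N * x))))).
    + rewrite Rmult_1_l; apply Rmult_le_compat; lra.
    + apply Rmult_le_compat_r; [| lra]; apply Rmult_le_pos; lra.
  - eapply Rle_trans; [apply Cmod_sgderiv; lra |].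
    destruct (HM (S j) ltac:(lia)) as [M0 M].
    apply Rmult_le_compat; [| | | apply Rmult_le_compat_r; [lra |]; apply Rplus_le_compat_r].
    + apply Rmult_le_pos; [lra | now apply pow_le].
    + apply Rmult_le_pos; [| lra]; nra.
    + assert (Cmod (slope x u) ^ j <= 1) by (rewrite <- (pow1 j); apply pow_incr; lra).
      assert (0 <= Cmod (slope x u) ^ j) by now apply pow_le.
      nra.
    + nra.
Qed.

Lemma Int_env rho x N : 0 < x -> 0 <= rho -> 0 <= N ->
  Int (fun s => (rho * s + 1) * (2 * exp (- (s * x)))) 0 N <= 2 * (rho / x ^ 2 + / x).
Proof.
  intros Hx Hr HN.
  rewrite (Int_of_derive (fun s => - (2 * ((rho * s + 1) / x + rho / x ^ 2)) * exp (- (s * x)))).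
  - replace (- (0 * x)) with 0 by ring; rewrite exp_0.
    assert (H := exp_pos (- (N * x))).
    assert (H1 : 0 <= (rho * N + 1) / x + rho / x ^ 2).
    { apply Rplus_le_le_0_compat; apply Rmult_le_pos; try (left; apply Rinv_0_lt_compat); auto; [nra | apply pow_lt; auto]. }
    replace (- (2 * ((rho * 0 + 1) / x + rho / x ^ 2)) * 1) with (- (2 * (rho / x ^ 2 + / x))) by (field; lra).
    nra.
  - intros s; auto_derive; [auto |]; field; lra.
  - intros s; apply (ex_derive_continuous (fun s => (rho * s + 1) * (2 * exp (- (s * x))))); auto_derive; auto.
Qed.

(** Euler-Maclaurin for [s / (1 + exp (s t))]: the integral gives [a / t^2], and the derivative
    [1/2] at 0 gives [- 1/24]. The first error term is uniform in [N]; [Cst] may depend on [x] and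
    [J] because [N] is chosen last. *)
Lemma sigsum_estimate x J : 0 < x <= 4 / 9 -> exists Cst, forall u N, -2 <= u <= 2 -> (0 < N)%nat ->
  Cmod (sigsum x u N - (RtoC (PI ^ 2 / 12) / (slope x u * slope x u) - RtoC (1 / 24)))%C
    <= 13 * INR (fact (S (S J))) * (9 / 4 * x) ^ S J / x + Cst / INR N.
Proof.
  intros Hx.
  set (K := S (S J)).
  set (M := 2 ^ K * INR (fact K)).
  (* [c1] and [c2] collect what [exp (- y) <= 256 / y^4], with [y = N x], yields for [sigint_err]
     and for the derivatives at [N]. *)
  set (c1 := 20 / x ^ 2 + 256 * (/ x + / x ^ 2) / x ^ 4 + / x ^ 2).
  set (c2 := M * (1024 / x ^ 4)).
  exists (2 * (INR K * c2 + c1)); intros u N Hu HN.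
  assert (HN1 : 1 <= INR N) by (apply (le_INR 1); auto).
  assert (HM : 0 <= M) by (apply Rmult_le_pos; [apply pow_le; lra | apply pos_INR]).
  assert (Hx4 : 0 < x ^ 4) by (apply pow_lt; lra).
  assert (Hx2 : 0 < x ^ 2) by (apply pow_lt; lra).
  assert (Hexp := exp_neg_le_pow4 (INR N * x) ltac:(nra)).
  assert (Hexp0 := exp_pos (- (INR N * x))).
  assert (Hn3 : / INR N ^ 3 <= / INR N).
  { apply Rinv_le_contravar; [lra |]; simpl; nra. }
  assert (Hn2 : / INR N ^ 2 <= / INR N).
  { apply Rinv_le_contravar; [lra |]; simpl; nra. }
  assert (Hrx : 0 < / x) by (apply Rinv_0_lt_compat; lra).
  assert (Hrx2 : 0 < / x ^ 2) by (apply Rinv_0_lt_compat; lra).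
  assert (Hrx4 : 0 < / x ^ 4) by (apply Rinv_0_lt_compat; lra).
  assert (Heta : M * ((INR N + 1) * (2 * exp (- (INR N * x)))) <= c2 / INR N).
  { unfold c2; replace (M * (1024 / x ^ 4) / INR N) with (M * (1024 * / x ^ 4 * / INR N)) by (field; lra).
    apply Rmult_le_compat_l; [auto |].
    apply Rle_trans with ((2 * INR N) * (2 * (256 / (INR N * x) ^ 4))).
    - apply Rmult_le_compat; lra.
    - replace (2 * INR N * (2 * (256 / (INR N * x) ^ 4))) with (1024 * / x ^ 4 * / INR N ^ 3) by (field; lra).
      apply Rmult_le_compat_l; [lra | auto]. }
  assert (Hsig : sigint_err x N <= c1 / INR N).
  { unfold sigint_err, c1.
    replace ((20 / x ^ 2 + 256 * (/ x + / x ^ 2) / x ^ 4 + / x ^ 2) / INR N)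
      with (20 / INR N / x ^ 2 + 256 * ((/ x + / x ^ 2) * / x ^ 4) * / INR N + / x ^ 2 * / INR N) by (field; lra).
    apply Rplus_le_compat; [apply Rplus_le_compat |].
    - apply Rmult_le_compat_r; [lra | now apply eta2_bound].
    - apply Rle_trans with (INR N * ((INR N * (/ x + / x ^ 2)) * (256 / (INR N * x) ^ 4))).
      + apply Rmult_le_compat_l; [lra |]; apply Rmult_le_compat; try lra.
        * apply Rplus_le_le_0_compat; [apply Rmult_le_pos; lra | lra].
        * unfold Rdiv; nra.
      + replace (INR N * (INR N * (/ x + / x ^ 2) * (256 / (INR N * x) ^ 4)))
          with (256 * ((/ x + / x ^ 2) * / x ^ 4) * / INR N ^ 2) by (field; lra).
        apply Rmult_le_compat_l; [| auto].
        assert (0 <= (/ x + / x ^ 2) * / x ^ 4) by (apply Rmult_le_pos; lra); lra.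
    - rewrite Rpow_mult_distr, Rinv_mult, Rmult_comm.
      apply Rmult_le_compat_l; lra. }
  set (rho := Cmod (slope x u)).
  assert (Hr := slope_le x u ltac:(lra) Hu); fold rho in Hr.
  assert (Hr0 : 0 <= rho) by apply Cmod_ge_0.
  set (Env := fun s => M * rho ^ S J * ((rho * s + 1) * (2 * exp (- (s * x))))).
  assert (CE : forall s, continuous Env s).
  { intros s; apply (ex_derive_continuous Env); unfold Env; auto_derive; auto. }
  assert (IE : (1 / 2) ^ K * Int Env 0 (INR N) <= 13 / 2 * INR (fact K) * (9 / 4 * x) ^ S J / x).
  { unfold Env; rewrite Int_scal.
    2:{ intros s; apply (ex_derive_continuous (fun s => (rho * s + 1) * (2 * exp (- (s * x))))); auto_derive; auto. }
    assert (H := Int_env rho x (INR N) ltac:(lra) Hr0 ltac:(lra)).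
    (* [13/2] is [2 (9/4 + 1)]; it becomes 13 when the real and imaginary parts are added. *)
    assert (H2 : 2 * (rho / x ^ 2 + / x) <= 13 / 2 / x).
    { apply Rle_trans with (2 * (9 / 4 * x / x ^ 2 + / x)).
      - apply Rmult_le_compat_l; [lra |]; apply Rplus_le_compat_r, Rmult_le_compat_r; lra.
      - right; field; lra. }
    assert (E : (1 / 2) ^ K * M = INR (fact K)).
    { unfold M; rewrite <- Rmult_assoc, <- Rpow_mult_distr; replace (1 / 2 * 2) with 1 by field.
      rewrite pow1; ring. }
    assert (P : rho ^ S J <= (9 / 4 * x) ^ S J) by (apply pow_incr; lra).
    assert (P0 : 0 <= rho ^ S J) by now apply pow_le.
    assert (F := pos_INR (fact K)).
    apply Rle_trans with (INR (fact K) * (9 / 4 * x) ^ S J * (13 / 2 / x)); [| right; field; lra].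
    replace ((1 / 2) ^ K * (M * rho ^ S J * Int (fun s => (rho * s + 1) * (2 * exp (- (s * x)))) 0 (INR N)))
      with (((1 / 2) ^ K * M) * rho ^ S J * Int (fun s => (rho * s + 1) * (2 * exp (- (s * x)))) 0 (INR N)) by ring.
    rewrite E; apply Rmult_le_compat; [nra | | apply Rmult_le_compat_l; auto | lra].
    apply Rle_trans with (Int (fun _ => 0) 0 (INR N)); [rewrite Int_const; lra |].
    apply Int_le; [lra | intros; apply continuous_const | |].
    - intros s; apply (ex_derive_continuous (fun s => (rho * s + 1) * (2 * exp (- (s * x))))); auto_derive; auto.
    - intros s Hs; assert (0 < exp (- (s * x))) by apply exp_pos; apply Rmult_le_pos; nra. }
  set (target := (RtoC (PI ^ 2 / 12) / (slope x u * slope x u))%C).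
  assert (Comp : forall pr : C -> R,
    (forall a b, pr (a + b)%C = pr a + pr b) -> (forall a, pr (- a)%C = - pr a) ->
    (forall z, Rabs (pr z) <= Cmod z) -> pr 0%C = 0 -> pr (RtoC (1 / 2)) / 12 = pr (RtoC (1 / 24)) ->
    (forall f s l, derivC f s l -> is_derive (fun s => pr (f s)) s (pr l)) ->
    Rabs (pr (sigsum x u N - (target - RtoC (1 / 24)))%C)
      <= 13 / 2 * INR (fact K) * (9 / 4 * x) ^ S J / x + (INR K * c2 + c1) / INR N).
  { intros pr Hp Ho Hm Hz H24 Hd.
    assert (EM := euler_maclaurin (fun j s => pr (sgderiv x u j s))
      (fun j s => Hd _ _ _ (derivC_sgderiv x u ltac:(lra) j s)) Env J N (c2 / INR N) CE).
    assert (SI := sigmoid_integral x u ltac:(lra) Hu pr N HN Hp Ho Hm Hd).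
    cbv beta in EM; fold target in SI.
    specialize (EM ltac:(intros s Hs; eapply Rle_trans; [apply Hm | apply Cmod_sgderiv; fold rho; lra])).
    specialize (EM ltac:(now rewrite sgderiv_0_0)).
    specialize (EM ltac:(intros i; now rewrite sgderiv_odd_0)).
    specialize (EM ltac:(intros j Hj; eapply Rle_trans; [apply Hm |];
      eapply Rle_trans; [apply (sgderiv_at_N_bound x u J N j); auto | exact Heta])).
    rewrite sgderiv_1_0, H24 in EM; fold K in EM.
    assert (ES : rsum (fun k => pr (sgderiv x u 0 (INR (S k)))) N = pr (sigsum x u N)).
    { unfold sigsum; clear - Hp Hz; induction N as [| N IH]; cbn [rsum csum]; [auto |].
      rewrite Hp, IH, sgderiv_0; reflexivity. }
    rewrite ES in EM.
    unfold Cminus; rewrite Hp, Ho, Hp, Ho.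
    replace ((INR K * c2 + c1) / INR N) with (INR K * (c2 / INR N) + c1 / INR N) by (field; lra).
    assert (Tot := Rplus_le_compat _ _ _ _ EM (Rle_trans _ _ _ SI Hsig)).
    eapply Rle_trans; [eapply Rle_trans; [| exact Tot] | lra].
    eapply Rle_trans; [| apply Rabs_triang]; right; f_equal; ring. }
  assert (Cre := Comp fst (fun _ _ => eq_refl) (fun _ => eq_refl) re_le_Cmod eq_refl).
  assert (Cim := Comp snd (fun _ _ => eq_refl) (fun _ => eq_refl) im_le_Cmod eq_refl).
  specialize (Cre ltac:(simpl; field) (fun f s l H => proj1 H)).
  specialize (Cim ltac:(simpl; field) (fun f s l H => proj2 H)).
  set (z := (sigsum x u N - (target - RtoC (1 / 24)))%C) in *.
  apply Rle_trans with (Rabs (fst z) + Rabs (snd z)); [| fold K].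
  - rewrite (surjective_pairing z) at 1.
    replace (fst z, snd z) with (RtoC (fst z) + Ci * RtoC (snd z))%C.
    + eapply Rle_trans; [apply Cmod_triangle |].
      rewrite Cmod_mult, !Cmod_R; replace (Cmod Ci) with 1; [lra |].
      unfold Cmod, Ci; simpl; replace (0 * (0 * 1) + 1 * (1 * 1)) with 1 by ring; now rewrite sqrt_1.
    + unfold Ci, Cplus, Cmult, RtoC; simpl; f_equal; ring.
  - apply Rle_trans with (2 * (13 / 2 * INR (fact K) * (9 / 4 * x) ^ S J / x + (INR K * c2 + c1) / INR N)); [lra |].
    right; field; lra.
Qed.

(** * The generating function on vertical lines *)

Fixpoint Fprod (N : nat) (t : C) : C :=
  match N with
  | O => 1%C
  | S n => (Fprod n t * (1 + Cexp (- (RtoC (INR (S n)) * t))))%C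
  end.

(* Coefficients of [prod_(1 <= k <= N) (1 + X^k)], extended by 0 to negative indices. *)
Fixpoint dcount (N : nat) (k : Z) : Z :=
  match N with
  | O => if Z.eqb k 0 then 1%Z else 0%Z
  | S n => (dcount n k + dcount n (k - Z.of_nat (S n)))%Z
  end.

Lemma derivC_vertical x y : derivC (fun y => (x, y) : C) y Ci.
Proof. split; simpl; [apply @is_derive_const | apply @is_derive_id]. Qed.

Lemma derivC_Fprod N (t : R -> C) s t' : derivC t s t' -> exists l, derivC (fun s => Fprod N (t s)) s l.
Proof.
  intros Ht; induction N as [| N [l IH]]; [exists 0%C; apply (derivC_const 1%C) |].
  eexists; cbn [Fprod]; apply derivC_mult; [exact IH |].
  apply derivC_plus; [apply derivC_const |].
  apply derivC_Cexp, (derivC_ext (fun s => (- RtoC (INR (S N))) * t s)%C); [intros; ring |].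
  apply derivC_mult; [apply derivC_const | exact Ht].
Qed.

Lemma Fprod_term_continuous N k x y :
  continuous (fun y => fst (Fprod N (x, y) * Cexp (RtoC (IZR k) * (x, y)))%C) y.
Proof.
  destruct (derivC_Fprod N (fun y => (x, y)) y Ci (derivC_vertical x y)) as [l Hl].
  assert (He : derivC (fun y => Cexp (RtoC (IZR k) * (x, y))%C) y
    ((0 * (x, y) + RtoC (IZR k) * Ci) * Cexp (RtoC (IZR k) * (x, y)))%C).
  { apply (derivC_Cexp (fun y => RtoC (IZR k) * (x, y))%C).
    exact (derivC_mult _ _ _ _ _ (derivC_const (RtoC (IZR k)) y) (derivC_vertical x y)). }
  exact (derive_continuous _ _ _ (proj1 (derivC_mult _ _ _ _ _ Hl He))).
Qed.

Lemma sin_IZR_PI k : sin (IZR k * PI) = 0.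
Proof. apply sin_eq_0_1; now exists k. Qed.

(** Only [N = 0] needs an integral, the orthogonality of the characters; each further factor shifts
    the frequency just as the recursion of [dcount] shifts [k]. *)
Lemma Fprod_coefficient N k x :
  Int (fun y => fst (Fprod N (x, y) * Cexp (RtoC (IZR k) * (x, y)))%C) (- PI) PI
    = 2 * PI * IZR (dcount N k).
Proof.
  revert k; induction N as [| N IH]; intros k.
  - rewrite (Int_ext _ (fun y => exp (IZR k * x) * cos (IZR k * y))).
    2:{ intros y; unfold Cexp; simpl; rewrite !Rmult_0_l, Rmult_1_l, !Rminus_0_r, Rplus_0_r; reflexivity. }
    simpl; destruct (Z.eqb_spec k 0) as [-> | Hk].
    + rewrite (Int_ext _ (fun _ => 1)); [rewrite Int_const; ring |].
      intros y; rewrite !Rmult_0_l, exp_0, cos_0; ring.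
    + assert (IZR k <> 0) by (apply not_0_IZR; auto).
      rewrite (Int_of_derive (fun y => exp (IZR k * x) * (sin (IZR k * y) / IZR k))).
      * rewrite Ropp_mult_distr_r_reverse, sin_neg, sin_IZR_PI; field; auto.
      * intros y; auto_derive; [auto |]; field; auto.
      * intros y; apply (ex_derive_continuous (fun y => exp (IZR k * x) * cos (IZR k * y))); auto_derive; auto.
  - cbn [dcount]; rewrite plus_IZR, Rmult_plus_distr_l, <- !IH, <- Int_add by (intros; apply Fprod_term_continuous).
    apply Int_ext; intros y.
    transitivity (fst (Fprod N (x, y) * Cexp (RtoC (IZR k) * (x, y))
       + Fprod N (x, y) * Cexp (RtoC (IZR (k - Z.of_nat (S N))) * (x, y)))%C); [| reflexivity].
    f_equal; cbn [Fprod]; rewrite minus_IZR, <- INR_IZR_INZ, RtoC_minus.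
    replace ((RtoC (IZR k) - RtoC (INR (S N))) * (x, y))%C
      with (- (RtoC (INR (S N)) * (x, y)) + RtoC (IZR k) * (x, y))%C by ring.
    rewrite Cexp_plus; ring.
Qed.

(** * Decay of the product away from the real axis *)

Definition sigma' (w : R) : R := w / (1 + w) ^ 2.

(** [|1 + w exp (i th)|^2 = (1 + w)^2 (1 - 2 sigma' w (1 - cos th))], and [1 - y <= exp (- y)]. *)
Lemma factor_bound w th : 0 < w ->
  Cmod (1 + ((w * cos th)%R, (w * sin th)%R))%C <= (1 + w) * exp (- (sigma' w * (1 - cos th))).
Proof.
  intros Hw; unfold Cmod; cbn [fst snd Cplus RtoC].
  assert (He := exp_pos (- (sigma' w * (1 - cos th)))).
  apply Rsqr_incr_0_var; [| apply Rmult_le_pos; lra].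
  rewrite Rsqr_sqrt by (apply Rplus_le_le_0_compat; apply pow2_ge_0).
  unfold Rsqr; replace ((1 + w) * exp (- (sigma' w * (1 - cos th))) * ((1 + w) * exp (- (sigma' w * (1 - cos th)))))
    with ((1 + w) ^ 2 * exp (- (2 * sigma' w * (1 - cos th)))).
  - assert (H := exp_ineq1_le (- (2 * sigma' w * (1 - cos th)))).
    apply Rle_trans with ((1 + w) ^ 2 * (1 + - (2 * sigma' w * (1 - cos th)))).
    + right; unfold sigma'; generalize (sin2_cos2 th); unfold Rsqr; intros Hs.
      transitivity (1 + 2 * w * cos th + w ^ 2 * (sin th * sin th + cos th * cos th)); [ring |].
      rewrite Hs; field; lra.
    + apply Rmult_le_compat_l; [apply pow2_ge_0 | lra].
  - replace (- (2 * sigma' w * (1 - cos th)))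
      with (- (sigma' w * (1 - cos th)) + - (sigma' w * (1 - cos th))) by ring.
    rewrite exp_plus; ring.
Qed.

Lemma Fprod_real_pos N x : exists r, 0 < r /\ Fprod N (x, 0) = RtoC r.
Proof.
  induction N as [| N [r [Hr E]]]; [exists 1; split; [lra | reflexivity] |].
  exists (r * (1 + exp (- (INR (S N) * x)))); split.
  - apply Rmult_lt_0_compat; [auto | generalize (exp_pos (- (INR (S N) * x))); lra].
  - cbn [Fprod]; rewrite E, RtoC_mult, RtoC_plus; f_equal; f_equal.
    unfold Cexp; cbn [fst snd Copp Cmult RtoC].
    replace (- (INR (S N) * 0 + 0 * x)) with 0 by ring.
    replace (- (INR (S N) * x - 0 * 0)) with (- (INR (S N) * x)) by ring.
    rewrite cos_0, sin_0; unfold RtoC; f_equal; ring.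
Qed.

Definition phase_sum (x y : R) (N : nat) : R :=
  rsum (fun k => sigma' (exp (- (INR (S k) * x))) * (1 - cos (INR (S k) * y))) N.

Lemma Fprod_phase_bound N x y :
  Cmod (Fprod N (x, y)) <= Cmod (Fprod N (x, 0)) * exp (- phase_sum x y N).
Proof.
  unfold phase_sum; induction N as [| N IH].
  - simpl; rewrite Ropp_0, exp_0; lra.
  - cbn [Fprod rsum]; rewrite !Cmod_mult, Ropp_plus_distr, exp_plus.
    replace (Cmod (1 + Cexp (- (RtoC (INR (S N)) * (x, 0))))%C) with (1 + exp (- (INR (S N) * x))).
    2:{ unfold Cexp; cbn [fst snd Copp Cmult RtoC].
        replace (- (INR (S N) * 0 + 0 * x)) with 0 by ring.
        replace (- (INR (S N) * x - 0 * 0)) with (- (INR (S N) * x)) by ring.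
        rewrite cos_0, sin_0, Rmult_0_r, Rmult_1_r.
        change (1 + exp (- (INR (S N) * x)) = Cmod (RtoC 1 + RtoC (exp (- (INR (S N) * x))))%C).
        rewrite <- RtoC_plus, Cmod_R, Rabs_pos_eq; [reflexivity |].
        generalize (exp_pos (- (INR (S N) * x))); lra. }
    assert (F := factor_bound (exp (- (INR (S N) * x))) (- (INR (S N) * y)) (exp_pos _)).
    rewrite cos_neg in F.
    replace (Cexp (- (RtoC (INR (S N)) * (x, y))))
      with ((exp (- (INR (S N) * x)) * cos (- (INR (S N) * y)))%R, (exp (- (INR (S N) * x)) * sin (- (INR (S N) * y)))%R).
    2:{ unfold Cexp; cbn [fst snd Copp Cmult RtoC]; f_equal; f_equal; f_equal; ring. }
    rewrite cos_neg.
    replace (_ * _ * (_ * _)) with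
      ((Cmod (Fprod N (x, 0)) * exp (- rsum (fun k => sigma' (exp (- (INR (S k) * x))) * (1 - cos (INR (S k) * y))) N))
       * ((1 + exp (- (INR (S N) * x))) * exp (- (sigma' (exp (- (INR (S N) * x))) * (1 - cos (INR (S N) * y)))))) by ring.
    apply Rmult_le_compat; auto using Cmod_ge_0.
Qed.

Lemma derive_logistic t : is_derive (fun t => / (1 + exp (- t))) t (sigma' (exp (- t))).
Proof.
  unfold sigma'; auto_derive; [generalize (exp_pos (- t)); lra |].
  field; generalize (exp_pos (- t)); lra.
Qed.

Lemma sigma'_incr v w : 0 < v <= w -> w <= 1 -> sigma' v <= sigma' w.
Proof.
  intros H1 H2; unfold sigma'.
  apply Rmult_le_reg_r with ((1 + v) ^ 2 * (1 + w) ^ 2).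
  - apply Rmult_lt_0_compat; apply pow_lt; lra.
  - replace (v / (1 + v) ^ 2 * ((1 + v) ^ 2 * (1 + w) ^ 2)) with (v * (1 + w) ^ 2) by (field; lra).
    replace (w / (1 + w) ^ 2 * ((1 + v) ^ 2 * (1 + w) ^ 2)) with (w * (1 + v) ^ 2) by (field; lra).
    assert (0 <= (w - v) * (1 - v * w)) by (apply Rmult_le_pos; nra).
    nra.
Qed.

Lemma sigma'_le_quarter w : 0 < w <= 1 -> sigma' w <= 1 / 4.
Proof.
  intros H; eapply Rle_trans; [apply (sigma'_incr w 1); lra |]; unfold sigma'; lra.
Qed.

Lemma exp_neg_le_1 t : 0 <= t -> 0 < exp (- t) <= 1.
Proof.
  intros Ht; split; [apply exp_pos |].
  rewrite <- exp_0; destruct (Req_dec t 0) as [-> | H]; [rewrite Ropp_0; lra |].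
  left; apply exp_increasing; lra.
Qed.

(** Comparison with an integral: [sigma' (exp (- t))] is the derivative of the logistic function and
    decreases for [t >= 0]. *)
Lemma sigma'_sum_lower x N : 0 < x ->
  (/ (1 + exp (- (INR (S N) * x))) - / (1 + exp (- x))) / x
    <= rsum (fun k => sigma' (exp (- (INR (S k) * x)))) N.
Proof.
  intros Hx; induction N as [| N IH].
  - simpl; rewrite Rmult_1_l; unfold Rdiv; lra.
  - cbn [rsum].
    set (t := INR (S N) * x) in *.
    assert (Ht : 0 < t) by (apply Rmult_lt_0_compat; [apply lt_0_INR; lia | auto]).
    assert (Et : INR (S (S N)) * x = t + x) by (rewrite (S_INR (S N)); unfold t; ring).
    rewrite Et.
    destruct (MVT_gen (fun t => / (1 + exp (- t))) t (t + x) (fun t => sigma' (exp (- t)))) as [c [Hc1 Hc2]].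
    + intros; apply derive_logistic.
    + intros; apply continuity_pt_filterlim; exact (derive_continuous _ _ _ (derive_logistic _)).
    + rewrite Rmin_left, Rmax_right in Hc1 by lra; cbv beta in Hc2.
      assert (Hs : sigma' (exp (- c)) <= sigma' (exp (- t))).
      { apply sigma'_incr; [split; [apply exp_pos |] | apply exp_neg_le_1; lra].
        destruct (Req_dec c t) as [-> | Hn]; [lra | left; apply exp_increasing; lra]. }
      apply Rle_trans with ((/ (1 + exp (- t)) - / (1 + exp (- x))) / x + sigma' (exp (- t))); [| lra].
      apply Rmult_le_reg_r with x; [auto |].
      replace ((/ (1 + exp (- (t + x))) - / (1 + exp (- x))) / x * x)
        with (/ (1 + exp (- (t + x))) - / (1 + exp (- x))) by (field; split; [generalize (exp_pos (- x)) | split; [generalize (exp_pos (- (t + x))) |]]; lra).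
      unfold Rdiv; rewrite Rmult_plus_distr_r, !Rmult_assoc, Rinv_l, !Rmult_1_r by lra.
      assert (sigma' (exp (- c)) * (t + x - t) <= sigma' (exp (- t)) * x).
      { replace (t + x - t) with x by ring; apply Rmult_le_compat_r; lra. }
      lra.
Qed.

(** The Dirichlet kernel, cleared of its denominator. *)
Lemma cos_sum y n :
  2 * sin (y / 2) * rsum (fun k => cos (INR (S k) * y)) n = sin ((INR n + 1 / 2) * y) - sin (y / 2).
Proof.
  induction n as [| n IH]; cbn [rsum].
  - simpl; replace ((0 + 1 / 2) * y) with (y / 2) by field; ring.
  - rewrite Rmult_plus_distr_l, IH, S_INR.
    replace ((INR n + 1 + 1 / 2) * y) with ((INR n + 1) * y + y / 2) by field.
    replace ((INR n + 1 / 2) * y) with ((INR n + 1) * y - y / 2) by field.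
    rewrite sin_plus, sin_minus; ring.
Qed.

(** Only an upper bound on the partial sums is assumed, so the induction carries the nonnegative
    slack [f n * (M - rsum c n)]. *)
Lemma abel_bound (f c : nat -> R) M n : 0 <= M ->
  (forall k, 0 <= f (S k) <= f k) -> (forall k, rsum c k <= M) ->
  rsum (fun k => f k * c k) n <= f O * M.
Proof.
  intros HM Hf Hc.
  assert (H0 : forall k, 0 <= f k) by (intros [| k]; [generalize (Hf O); lra | apply Hf]).
  assert (G : rsum (fun k => f k * c k) n <= f O * M - f n * (M - rsum c n)).
  { induction n as [| n IH]; cbn [rsum]; [lra |].
    assert (H1 := Hf n); assert (H2 := Hc (S n)); cbn [rsum] in H2.
    assert ((f n - f (S n)) * (M - (rsum c n + c n)) >= 0) by (apply Rle_ge, Rmult_le_pos; lra).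
    nra. }
  assert (0 <= f n * (M - rsum c n)) by (apply Rmult_le_pos; [auto | generalize (Hc n); lra]).
  lra.
Qed.

(** The weights sum to about [1 / (2 x)]. By Abel summation the oscillating part is at most
    [1/4 (1 / (2 sin (y / 2)) - 1/2)], which is about [1 / (8 x)] in the worst case [y = 2 x]; the
    difference is [3 / (8 x)]. The bounded terms amount to [1/8 + x / 40 <= 126/1000]. *)
Lemma phase_sum_lower x y N : 0 < x <= 1 / 100 -> 2 * x <= y <= PI ->
  3 / 8 / x - 126 / 1000 - exp (- (INR (S N) * x)) / x <= phase_sum x y N.
Proof.
  intros Hx Hy; assert (HP := PI_RGT_0); assert (HP4 := PI_4); assert (HP2 := PI2_3_2).
  unfold phase_sum.
  rewrite (rsum_ext _ (fun k => sigma' (exp (- (INR (S k) * x)))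
     + (-1) * (sigma' (exp (- (INR (S k) * x))) * cos (INR (S k) * y)))) by (intros; ring).
  rewrite rsum_add, rsum_scal.
  assert (A := sigma'_sum_lower x N ltac:(lra)).
  assert (Hs : x - x ^ 3 / 6 <= sin (y / 2)).
  { apply Rle_trans with (sin x).
    - destruct (pre_sin_bound x 0 ltac:(lra) ltac:(lra)) as [H _].
      unfold sin_approx, sin_term in H; simpl in H; lra.
    - destruct (Req_dec x (y / 2)) as [<- | Hn]; [lra |].
      left; apply sin_increasing_1; lra. }
  assert (Hs0 : 0 < sin (y / 2)).
  { assert (0 < x * (1 - x ^ 2 / 6)) by (apply Rmult_lt_0_compat; nra); nra. }
  set (M := / (2 * sin (y / 2)) - 1 / 2).
  assert (Hs1 := SIN_bound (y / 2)).
  assert (HM : 0 <= M).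
  { unfold M; assert (/ 2 <= / (2 * sin (y / 2))) by (apply Rinv_le_contravar; lra); lra. }
  assert (B : rsum (fun k => sigma' (exp (- (INR (S k) * x))) * cos (INR (S k) * y)) N <= sigma' (exp (- (INR 1 * x))) * M).
  { apply (abel_bound (fun k => sigma' (exp (- (INR (S k) * x)))) (fun k => cos (INR (S k) * y))); [auto | |].
    - intros k; assert (Hk := pos_INR (S k)).
      assert (Hk' : INR (S k) * x <= INR (S (S k)) * x) by (rewrite (S_INR (S k)); nra).
      assert (0 <= INR (S k) * x) by nra.
      split.
      + unfold sigma'; apply Rmult_le_pos; [left; apply exp_pos |].
        left; apply Rinv_0_lt_compat, pow_lt; generalize (exp_pos (- (INR (S (S k)) * x))); lra.
      + apply sigma'_incr; [split; [apply exp_pos |] | now apply exp_neg_le_1].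
        destruct Hk' as [H' | H']; [left; apply exp_increasing; lra | rewrite H'; lra].
    - intros n; apply Rmult_le_reg_l with (2 * sin (y / 2)); [lra |].
      rewrite cos_sum; unfold M.
      replace (2 * sin (y / 2) * (/ (2 * sin (y / 2)) - 1 / 2)) with (1 - sin (y / 2)) by (field; lra).
      generalize (SIN_bound ((INR n + 1 / 2) * y)); lra. }
  assert (Q : sigma' (exp (- (INR 1 * x))) <= 1 / 4).
  { apply sigma'_le_quarter, exp_neg_le_1; simpl; lra. }
  assert (B2 : sigma' (exp (- (INR 1 * x))) * M <= 1 / 4 * M) by (apply Rmult_le_compat_r; auto).
  assert (M2 : M <= / (2 * x) + x / 10 - 1 / 2).
  { unfold M; apply Rplus_le_compat_r.
    apply Rle_trans with (/ (2 * (x - x ^ 3 / 6))).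
    - apply Rinv_le_contravar; [| lra].
      assert (0 < x * (1 - x ^ 2 / 6)) by (apply Rmult_lt_0_compat; nra); nra.
    - apply Rmult_le_reg_r with (2 * (x - x ^ 3 / 6)).
      + assert (0 < x * (1 - x ^ 2 / 6)) by (apply Rmult_lt_0_compat; nra); nra.
      + rewrite Rinv_l.
        * replace ((/ (2 * x) + x / 10) * (2 * (x - x ^ 3 / 6))) with (1 + x ^ 2 * (1 / 5 - 1 / 6 - x ^ 2 / 30)) by (field; lra).
          assert (0 <= x ^ 2 * (1 / 5 - 1 / 6 - x ^ 2 / 30)) by (apply Rmult_le_pos; nra); lra.
        * assert (0 < x * (1 - x ^ 2 / 6)) by (apply Rmult_lt_0_compat; nra); nra. }
  assert (L1 : 1 - exp (- (INR (S N) * x)) <= / (1 + exp (- (INR (S N) * x)))).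
  { generalize (exp_pos (- (INR (S N) * x))); generalize (exp (- (INR (S N) * x))); intros e He.
    apply Rmult_le_reg_r with (1 + e); [lra |]; rewrite Rinv_l by lra; nra. }
  assert (L2 : / (1 + exp (- x)) <= 1 / 2 + x / 4).
  { destruct (MVT_gen (fun t => / (1 + exp (- t))) 0 x (fun t => sigma' (exp (- t)))) as [c [Hc1 Hc2]].
    - intros; apply derive_logistic.
    - intros; apply continuity_pt_filterlim; exact (derive_continuous _ _ _ (derive_logistic _)).
    - rewrite Rmin_left, Rmax_right in Hc1 by lra; cbv beta in Hc2.
      rewrite Ropp_0, exp_0 in Hc2.
      assert (sigma' (exp (- c)) <= 1 / 4) by (apply sigma'_le_quarter, exp_neg_le_1; lra).
      assert (sigma' (exp (- c)) * (x - 0) <= 1 / 4 * (x - 0)) by (apply Rmult_le_compat_r; lra).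
      lra. }
  assert (A2 : (1 / 2 - x / 4 - exp (- (INR (S N) * x))) / x <= (/ (1 + exp (- (INR (S N) * x))) - / (1 + exp (- x))) / x).
  { apply Rmult_le_compat_r; [left; apply Rinv_0_lt_compat |]; lra. }
  replace ((1 / 2 - x / 4 - exp (- (INR (S N) * x))) / x) with (1 / 2 / x - 1 / 4 - exp (- (INR (S N) * x)) / x) in A2 by (field; lra).
  replace (/ (2 * x)) with (1 / 2 / x) in M2 by (field; lra).
  replace (3 / 8 / x) with (1 / 2 / x - 1 / 4 * (1 / 2 / x)) by (field; lra).
  lra.
Qed.

(** * Near constancy of the normalised product close to the real axis *)

Lemma Cmod_le_abs z : Cmod z <= Rabs (fst z) + Rabs (snd z).
Proof.
  unfold Cmod; apply Rsqr_incr_0_var; [| apply Rplus_le_le_0_compat; apply Rabs_pos].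
  rewrite Rsqr_sqrt by (apply Rplus_le_le_0_compat; apply pow2_ge_0).
  rewrite <- (pow2_abs (fst z)), <- (pow2_abs (snd z)).
  generalize (Rabs_pos (fst z)) (Rabs_pos (snd z)); unfold Rsqr; nra.
Qed.

(** Gronwall's argument: [exp (- 2 kappa u) |Z u|^2] decreases. The mean value theorem then serves
    each component separately, hence the factor 2. *)
Lemma log_derivative_bound (Z w : R -> C) b kappa : 0 <= b -> 0 <= kappa ->
  (forall u, derivC Z u (Z u * w u)%C) -> (forall u, 0 <= u <= b -> Cmod (w u) <= kappa) ->
  forall u, 0 <= u <= b -> Cmod (Z u - Z 0)%C <= 2 * kappa * u * exp (kappa * u) * Cmod (Z 0).
Proof.
  intros Hb Hk HZ Hw.
  assert (Gr : forall u, 0 <= u <= b -> Cmod (Z u) <= exp (kappa * u) * Cmod (Z 0)).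
  { intros u Hu.
    set (g := fun t => exp (- (2 * kappa * t)) * (fst (Z t) ^ 2 + snd (Z t) ^ 2)).
    set (g' := fun t => exp (- (2 * kappa * t)) * (2 * (fst (Z t) ^ 2 + snd (Z t) ^ 2) * (fst (w t) - kappa))).
    assert (Hg : forall t, is_derive g t (g' t)).
    { intros t; destruct (HZ t) as [H1 H2]; unfold g, g'.
      evar_last.
      - apply (is_derive_mult (fun t => exp (- (2 * kappa * t))) (fun t => fst (Z t) ^ 2 + snd (Z t) ^ 2));
          [| | intros; apply Rmult_comm].
        + instantiate (1 := - (2 * kappa) * exp (- (2 * kappa * t))); auto_derive; auto; ring.
        + apply @is_derive_plus; apply is_derive_pow; [exact H1 | exact H2].
      - unfold plus, mult; simpl; ring. }
    destruct (Req_dec u 0) as [-> | Hu0]; [rewrite Rmult_0_r, exp_0; lra |].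
    destruct (MVT_gen g 0 u g') as [c [Hc1 Hc2]].
    - intros; apply Hg.
    - intros; apply continuity_pt_filterlim; exact (derive_continuous _ _ _ (Hg _)).
    - rewrite Rmin_left, Rmax_right in Hc1 by lra.
      assert (Hle : g' c <= 0).
      { unfold g'; assert (He := exp_pos (- (2 * kappa * c))).
        assert (Hc3 : fst (w c) <= kappa).
        { eapply Rle_trans; [apply Rle_abs |]; eapply Rle_trans; [apply re_le_Cmod | apply Hw; lra]. }
        assert (0 <= fst (Z c) ^ 2 + snd (Z c) ^ 2) by (apply Rplus_le_le_0_compat; apply pow2_ge_0).
        assert (0 <= (fst (Z c) ^ 2 + snd (Z c) ^ 2) * (kappa - fst (w c))) by (apply Rmult_le_pos; lra).
        nra. }
      assert (Hg0 : g u <= g 0) by nra.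
      unfold g in Hg0; rewrite Rmult_0_r, Ropp_0, exp_0, Rmult_1_l in Hg0.
      unfold Cmod; apply Rsqr_incr_0_var;
        [| apply Rmult_le_pos; [left; apply exp_pos | apply sqrt_pos]].
      rewrite Rsqr_mult, !Rsqr_sqrt by (apply Rplus_le_le_0_compat; apply pow2_ge_0).
      unfold Rsqr; rewrite <- exp_plus.
      assert (He := exp_pos (kappa * u + kappa * u)).
      apply Rle_trans with (exp (kappa * u + kappa * u) * (exp (- (2 * kappa * u)) * (fst (Z u) ^ 2 + snd (Z u) ^ 2))).
      + rewrite <- Rmult_assoc, <- exp_plus; right.
        replace (kappa * u + kappa * u + - (2 * kappa * u)) with 0 by ring; rewrite exp_0; ring.
      + apply Rmult_le_compat_l; lra. }
  intros u Hu.
  assert (Comp : forall pr : C -> R, (forall z, Rabs (pr z) <= Cmod z) ->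
    (forall f s l, derivC f s l -> is_derive (fun s => pr (f s)) s (pr l)) ->
    Rabs (pr (Z u) - pr (Z 0)) <= kappa * u * exp (kappa * u) * Cmod (Z 0)).
  { intros pr Hm Hd.
    destruct (MVT_gen (fun t => pr (Z t)) 0 u (fun t => pr (Z t * w t)%C)) as [c [Hc1 Hc2]].
    - intros; apply Hd, HZ.
    - intros; apply continuity_pt_filterlim; exact (derive_continuous _ _ _ (Hd _ _ _ (HZ _))).
    - rewrite Rmin_left, Rmax_right in Hc1 by lra; rewrite Hc2, Rabs_mult.
      rewrite (Rabs_pos_eq (u - 0)) by lra.
      replace (kappa * u * exp (kappa * u) * Cmod (Z 0)) with (exp (kappa * u) * Cmod (Z 0) * kappa * (u - 0)) by ring.
      apply Rmult_le_compat_r; [lra |].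
      eapply Rle_trans; [apply Hm |]; rewrite Cmod_mult.
      apply Rmult_le_compat; try apply Cmod_ge_0; [| apply Hw; lra].
      eapply Rle_trans; [apply Gr; lra |].
      apply Rmult_le_compat_r; [apply Cmod_ge_0 |].
      assert (Hcu : kappa * c <= kappa * u) by (apply Rmult_le_compat_l; lra).
      destruct Hcu as [H | H]; [left; now apply exp_increasing | rewrite H; lra]. }
  assert (C1 := Comp fst re_le_Cmod (fun f s l H => proj1 H)).
  assert (C2 := Comp snd im_le_Cmod (fun f s l H => proj2 H)).
  eapply Rle_trans; [apply Cmod_le_abs |].
  unfold Cminus, Cplus, Copp; cbn [fst snd]; unfold Rminus in *; lra.
Qed.

Section Major.

Variables x : R.
Variable N : nat.
Hypothesis Hx : 0 < x.

(** The product divided by its predicted size [exp (a / t + t / 24)]. Up to the factor [- i x], its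
    logarithmic derivative in [u] is the error estimated in [sigsum_estimate]. *)
Definition Psi (u : R) : C :=
  (Fprod N (slope x u) * Cexp (- (RtoC (PI ^ 2 / 12) / slope x u + RtoC (1 / 24) * slope x u)))%C.

Lemma derivC_slope u : derivC (slope x) u (Ci * RtoC x)%C.
Proof.
  unfold slope; split; cbn [fst snd Cmult Ci RtoC].
  - replace (0 * x - 1 * 0) with 0 by ring; apply @is_derive_const.
  - auto_derive; auto; ring.
Qed.

Lemma derivC_Fprod_slope u : derivC (fun u => Fprod N (slope x u)) u
  (Fprod N (slope x u) * (- (Ci * RtoC x * sigsum x u N)))%C.
Proof.
  induction N as [| n IH].
  - eapply derivC_eq; [exact (derivC_const 1%C u) |]; unfold sigsum; simpl; ring.
  - cbn [Fprod]; eapply derivC_eq.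
    + apply derivC_mult; [exact IH |].
      apply derivC_plus; [apply derivC_const |].
      apply derivC_Cexp, (derivC_ext (fun u => (- RtoC (INR (S n))) * slope x u)%C); [intros; ring |].
      apply derivC_mult; [apply derivC_const | apply derivC_slope].
    + cbv beta; unfold sigsum; cbn [csum]; fold (sigsum x u n).
      replace (- RtoC (INR (S n)) * slope x u)%C with (- (RtoC (INR (S n)) * slope x u))%C by ring.
      unfold sg; assert (Hd := sg_denom x u Hx (INR (S n))).
      assert (HE := Cexp_opp (RtoC (INR (S n)) * slope x u)%C).
      set (e := Cexp (RtoC (INR (S n)) * slope x u)%C) in *.
      set (z := Cexp (- (RtoC (INR (S n)) * slope x u))%C) in *.
      (* This exhibits the derivative of the new factor [1 + z] as a multiple of that factor. *)
      assert (Hz : (z = (1 + z) * / (1 + e))%C).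
      { transitivity ((z + z * e) * / (1 + e))%C; [field; exact Hd | rewrite HE; field; exact Hd]. }
      transitivity (Fprod n (slope x u) * (- (Ci * RtoC x * sigsum x u n)) * (1 + z)
        + Fprod n (slope x u) * (- RtoC (INR (S n)) * (Ci * RtoC x)) * z)%C; [ring |].
      transitivity (Fprod n (slope x u) * (- (Ci * RtoC x * sigsum x u n)) * (1 + z)
        + Fprod n (slope x u) * (- RtoC (INR (S n)) * (Ci * RtoC x)) * ((1 + z) * / (1 + e)))%C; [now rewrite <- Hz |].
      ring.
Qed.

Lemma derivC_Psi u : derivC Psi u
  (Psi u * (- (Ci * RtoC x) * (sigsum x u N - (RtoC (PI ^ 2 / 12) / (slope x u * slope x u) - RtoC (1 / 24)))))%C.
Proof.
  unfold Psi; eapply derivC_eq.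
  - apply derivC_mult; [apply derivC_Fprod_slope |].
    apply derivC_Cexp, (derivC_ext (fun u => (- RtoC (PI ^ 2 / 12)) * / slope x u + (- RtoC (1 / 24)) * slope x u)%C);
      [intros; unfold Cdiv; ring |].
    apply derivC_plus; (apply derivC_mult; [apply derivC_const |]); [| apply derivC_slope].
    apply derivC_inv; [apply derivC_slope | apply slope_neq_0; auto].
  - cbv beta.
    replace (- RtoC (PI ^ 2 / 12) * / slope x u + - RtoC (1 / 24) * slope x u)%C
      with (- (RtoC (PI ^ 2 / 12) / slope x u + RtoC (1 / 24) * slope x u))%C by (unfold Cdiv; ring).
    field; apply slope_neq_0; auto.
Qed.

End Major.

(** The 8 is [2 * 2 * 2]: two components, [|u| <= 2], and an exponential bounded by 2 thanks to the
    smallness of [x * delta]. *)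
Lemma Psi_estimate x N delta : 0 < x -> 0 <= delta -> 4 * x * delta <= 1 / 2 ->
  (forall u, -2 <= u <= 2 ->
    Cmod (sigsum x u N - (RtoC (PI ^ 2 / 12) / (slope x u * slope x u) - RtoC (1 / 24)))%C <= delta) ->
  forall u, -2 <= u <= 2 -> Cmod (Psi x N u - Psi x N 0)%C <= 8 * x * delta * Cmod (Psi x N 0).
Proof.
  intros Hx Hd Hsm HB u Hu.
  assert (He : exp (x * delta * 2) <= 2).
  { apply Rle_trans with (exp (1 / 2)).
    - destruct (Req_dec (x * delta * 2) (1 / 2)) as [-> | H]; [lra | left; apply exp_increasing; lra].
    - assert (H := exp_le_3); replace 1 with (1 / 2 + 1 / 2) in H at 1 by field; rewrite exp_plus in H.
      generalize (exp_pos (1 / 2)); nra. }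
  set (w := fun u => (- (Ci * RtoC x) * (sigsum x u N - (RtoC (PI ^ 2 / 12) / (slope x u * slope x u) - RtoC (1 / 24))))%C).
  assert (Hw : forall u, -2 <= u <= 2 -> Cmod (w u) <= x * delta).
  { intros v Hv; unfold w; rewrite Cmod_mult, Cmod_opp, Cmod_mult, Cmod_R, (Rabs_pos_eq x) by lra.
    replace (Cmod Ci) with 1.
    - rewrite Rmult_1_l; apply Rmult_le_compat_l; [lra | auto].
    - unfold Cmod, Ci; simpl; replace (0 * (0 * 1) + 1 * (1 * 1)) with 1 by ring; now rewrite sqrt_1. }
  assert (Hk : 0 <= x * delta) by (apply Rmult_le_pos; lra).
  assert (Fin : forall v, 0 <= v <= 2 -> 2 * (x * delta) * v * exp (x * delta * v) <= 8 * x * delta).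
  { intros v Hv.
    assert (exp (x * delta * v) <= 2).
    { eapply Rle_trans; [| exact He].
      assert (Hm : x * delta * v <= x * delta * 2) by (apply Rmult_le_compat_l; lra).
      destruct Hm as [H | H]; [left; now apply exp_increasing | rewrite H; lra]. }
    assert (0 < exp (x * delta * v)) by apply exp_pos.
    assert (v * exp (x * delta * v) <= 2 * 2) by (apply Rmult_le_compat; lra).
    replace (2 * (x * delta) * v * exp (x * delta * v)) with (2 * (x * delta) * (v * exp (x * delta * v))) by ring.
    replace (8 * x * delta) with (2 * (x * delta) * (2 * 2)) by ring.
    apply Rmult_le_compat_l; lra. }
  destruct (Rle_lt_dec 0 u) as [Hu0 | Hu0].
  - eapply Rle_trans; [apply (log_derivative_bound (Psi x N) w 2 (x * delta)); try lra |].
    + intros v; apply derivC_Psi; auto.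
    + intros v Hv; apply Hw; lra.
    + apply Rmult_le_compat_r; [apply Cmod_ge_0 | apply Fin; lra].
  (* Negative [u] is reduced to positive [u] by reflection. *)
  - assert (L := log_derivative_bound (fun v => Psi x N (- v)) (fun v => Copp (w (- v))) 2 (x * delta)
      ltac:(lra) Hk).
    assert (L1 : forall v, derivC (fun v => Psi x N (- v)) v (Cmult (Psi x N (- v)) (Copp (w (- v))))).
    { intros v; destruct (derivC_Psi x N Hx (- v)) as [D1 D2]; fold (w (- v)) in D1, D2.
      assert (Hopp : is_derive (fun v : R => - v) v (-1)) by (auto_derive; auto; ring).
      split.
      - evar_last; [apply (is_derive_comp (fun s => fst (Psi x N s)) (fun v => - v)); [exact D1 | exact Hopp] |].
        unfold scal; simpl; unfold mult; simpl; ring.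
      - evar_last; [apply (is_derive_comp (fun s => snd (Psi x N s)) (fun v => - v)); [exact D2 | exact Hopp] |].
        unfold scal; simpl; unfold mult; simpl; ring. }
    specialize (L L1 ltac:(intros v Hv; cbv beta; rewrite Cmod_opp; apply Hw; lra) (- u) ltac:(lra)).
    cbv beta in L; rewrite Ropp_involutive, Ropp_0 in L.
    eapply Rle_trans; [exact L |].
    apply Rmult_le_compat_r; [apply Cmod_ge_0 | apply Fin; lra].
Qed.

(** * Moments of the saddle point kernel *)

Lemma continuous_add (f g : R -> R) x : continuous f x -> continuous g x ->
  continuous (fun x => f x + g x) x.
Proof. apply (continuous_plus (V := R_NormedModule)). Qed.

Definition ivar (u : R) : C := (Ci * RtoC u)%C.

Definition ker (L u : R) : C := Cexp (RtoC L * (ivar u * ivar u / (1 + ivar u)))%C.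

(** For [v = i u], [v^2 / (1 + v) = (- u^2 + i u^3) / (1 + u^2)]; so [kabs] is the modulus of [ker]
    and [kphase] its argument. *)
Definition kabs (L u : R) : R := exp (- (L * (u ^ 2 / (1 + u ^ 2)))).
Definition kphase (L u : R) : R := L * (u ^ 3 / (1 + u ^ 2)).

Lemma one_plus_ivar u : (1 + ivar u)%C <> 0%C.
Proof. unfold ivar, Ci, RtoC, Cmult, Cplus; simpl; intros H; injection H; lra. Qed.

Lemma ker_polar L u : ker L u = ((kabs L u * cos (kphase L u))%R, (kabs L u * sin (kphase L u))%R).
Proof.
  assert (Hu : 1 + u ^ 2 <> 0) by nra.
  assert (E : (RtoC L * (ivar u * ivar u / (1 + ivar u)))%C = ((- (L * (u ^ 2 / (1 + u ^ 2))))%R, kphase L u)).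
  { unfold ivar, kphase, Cdiv, Cinv, Ci, RtoC, Cmult, Cplus; cbn [fst snd]; f_equal; field; repeat split; nra. }
  unfold ker; rewrite E; reflexivity.
Qed.

Lemma derivC_ivar u : derivC ivar u Ci.
Proof.
  unfold ivar; eapply derivC_eq; [apply derivC_mult; [apply derivC_const | apply derivC_id] |]; cbv beta; ring.
Qed.

Lemma derivC_ker L u : derivC (ker L) u
  (Ci * RtoC L * ((RtoC 2 * ivar u + ivar u * ivar u) / ((1 + ivar u) * (1 + ivar u))) * ker L u)%C.
Proof.
  unfold ker; eapply derivC_eq.
  - apply derivC_Cexp, derivC_mult; [apply derivC_const |].
    apply derivC_mult; [apply derivC_mult; apply derivC_ivar |].
    apply derivC_inv; [apply derivC_plus; [apply derivC_const | apply derivC_ivar] | apply one_plus_ivar].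
  - cbv beta; unfold Cdiv.
    replace (RtoC 2) with (1 + 1)%C by (rewrite <- RtoC_plus; f_equal; ring).
    field; apply one_plus_ivar.
Qed.

Definition mom (L : R) (p : nat) : R := Int (fun u => fst (Cpow (ivar u) p * ker L u)%C) (-2) 2.

Lemma derivC_pow p u : derivC (fun u => Cpow (ivar u) (S p)) u (Ci * RtoC (INR (S p)) * Cpow (ivar u) p)%C.
Proof.
  induction p as [| p IH].
  - cbn [Cpow]; eapply derivC_eq; [apply derivC_mult; [apply derivC_ivar | exact (derivC_const 1%C u)] |].
    simpl INR; cbv beta; ring.
  - cbn [Cpow]; eapply derivC_eq; [apply derivC_mult; [apply derivC_ivar | exact IH] |].
    rewrite (S_INR (S p)), RtoC_plus; cbn [Cpow]; ring.
Qed.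

Lemma derivC_powker L p u : exists l, derivC (fun u => Cpow (ivar u) p * ker L u)%C u l.
Proof.
  destruct p as [| p]; eexists.
  - exact (derivC_mult _ _ _ _ _ (derivC_const 1%C u) (derivC_ker L u)).
  - exact (derivC_mult _ _ _ _ _ (derivC_pow p u) (derivC_ker L u)).
Qed.

Lemma powker_continuous L p u : continuous (fun u => fst (Cpow (ivar u) p * ker L u)%C) u.
Proof. destruct (derivC_powker L p u) as [l [H _]]; exact (derive_continuous _ _ _ H). Qed.

(** The derivative in [u] of [v^k (1 + v)^2 exp (L v^2 / (1 + v))], divided by [i]; the factor
    [(1 + v)^2] clears the denominator of the derivative of [v^2 / (1 + v)]. At [k = 0] the
    truncated exponent [k - 1] has coefficient 0. *)
Definition momder (k : nat) (L u : R) : C :=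
  (RtoC (INR k) * (Cpow (ivar u) (k - 1) * ker L u) + RtoC (2 * (INR k + 1)) * (Cpow (ivar u) k * ker L u)
   + RtoC (INR k + 2 + 2 * L) * (Cpow (ivar u) (S k) * ker L u) + RtoC L * (Cpow (ivar u) (S (S k)) * ker L u))%C.

Lemma derivC_momprim k L u :
  derivC (fun u => Cpow (ivar u) k * ((1 + ivar u) * (1 + ivar u)) * ker L u)%C u (Ci * momder k L u)%C.
Proof.
  assert (H1 : derivC (fun u => (1 + ivar u) * (1 + ivar u))%C u (RtoC 2 * Ci * (1 + ivar u))%C).
  { assert (H : derivC (fun u => 1 + ivar u)%C u Ci).
    { eapply derivC_eq; [apply derivC_plus; [apply derivC_const | apply derivC_ivar] | ring]. }
    eapply derivC_eq; [exact (derivC_mult _ _ _ _ _ H H) |].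
    replace (RtoC 2) with (1 + 1)%C by (rewrite <- RtoC_plus; f_equal; ring); ring. }
  assert (E2 : RtoC 2 = (1 + 1)%C) by (rewrite <- RtoC_plus; f_equal; ring).
  unfold momder; rewrite !RtoC_plus, !RtoC_mult, RtoC_plus.
  destruct k as [| k].
  - eapply derivC_eq.
    + apply derivC_mult; [apply derivC_mult; [exact (derivC_const 1%C u) | exact H1] | apply derivC_ker].
    + cbn [Cpow]; simpl INR; rewrite E2; field; apply one_plus_ivar.
  - eapply derivC_eq.
    + apply derivC_mult; [apply derivC_mult; [apply derivC_pow | exact H1] | apply derivC_ker].
    + replace (S k - 1)%nat with k by lia; cbn [Cpow]; rewrite E2; field; apply one_plus_ivar.
Qed.

Lemma ker_boundary L k u : (u = 2 \/ u = -2) ->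
  Cmod (Cpow (ivar u) k * ((1 + ivar u) * (1 + ivar u)) * ker L u)%C = 5 * 2 ^ k * exp (- (4 / 5 * L)).
Proof.
  intros Hu.
  assert (H2 : Rabs u = 2) by (destruct Hu; subst; [apply Rabs_pos_eq | rewrite Rabs_left]; lra).
  assert (Hsq : u ^ 2 = 4) by (destruct Hu; subst; ring).
  assert (HI : Cmod (ivar u) = 2).
  { unfold ivar; rewrite Cmod_mult, Cmod_R, H2; replace (Cmod Ci) with 1; [ring |].
    unfold Cmod, Ci; simpl; replace (0 * (0 * 1) + 1 * (1 * 1)) with 1 by ring; now rewrite sqrt_1. }
  assert (H1 : Cmod (1 + ivar u) * Cmod (1 + ivar u) = 5).
  { unfold Cmod; rewrite sqrt_sqrt by (apply Rplus_le_le_0_compat; apply pow2_ge_0).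
    unfold ivar, Ci, RtoC; simpl; nra. }
  rewrite !Cmod_mult, Cmod_pow, HI, H1, ker_polar.
  assert (Hk : Cmod ((kabs L u * cos (kphase L u))%R, (kabs L u * sin (kphase L u))%R) = kabs L u).
  { change (Cmod ((kabs L u * cos (kphase L u))%R, (kabs L u * sin (kphase L u))%R))
      with (Cmod (Cexp ((- (L * (u ^ 2 / (1 + u ^ 2))))%R, kphase L u))); apply Cmod_Cexp. }
  rewrite Hk; unfold kabs; rewrite Hsq; replace (- (L * (4 / (1 + 4)))) with (- (4 / 5 * L)) by field; ring.
Qed.

(* Integration by parts for [u^k (1 + i u)^2 exp (L v^2 / (1 + v))], [v = i u]. *)
Lemma mom_rec L k : Rabs (INR k * mom L (k - 1) + 2 * (INR k + 1) * mom L k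
    + (INR k + 2 + 2 * L) * mom L (S k) + L * mom L (S (S k))) <= 10 * 2 ^ k * exp (- (4 / 5 * L)).
Proof.
  unfold mom; rewrite <- !Int_scal by apply powker_continuous.
  rewrite <- !Int_add;
    try (intros; apply continuous_smul, powker_continuous);
    try (intros; apply continuous_add; apply continuous_smul, powker_continuous);
    try (intros; apply continuous_add; [apply continuous_add |]; apply continuous_smul, powker_continuous).
  rewrite (Int_ext _ (fun u => snd (Ci * momder k L u)%C)).
  2:{ intros u; unfold momder, Ci; idtac.
      generalize (Cpow (ivar u) (k - 1) * ker L u)%C (Cpow (ivar u) k * ker L u)%C
        (Cpow (ivar u) (S k) * ker L u)%C (Cpow (ivar u) (S (S k)) * ker L u)%C.
      intros a b c d; unfold Cplus, Cmult, RtoC; cbn [fst snd]; ring. }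
  rewrite (Int_of_derive (fun u => snd (Cpow (ivar u) k * ((1 + ivar u) * (1 + ivar u)) * ker L u)%C)).
  - eapply Rle_trans; [apply Rabs_triang |]; rewrite Rabs_Ropp.
    assert (B1 := ker_boundary L k 2 (or_introl eq_refl)); assert (B2 := ker_boundary L k (-2) (or_intror eq_refl)).
    assert (S1 := im_le_Cmod (Cpow (ivar 2) k * ((1 + ivar 2) * (1 + ivar 2)) * ker L 2)%C).
    assert (S2 := im_le_Cmod (Cpow (ivar (-2)) k * ((1 + ivar (-2)) * (1 + ivar (-2))) * ker L (-2))%C).
    rewrite B1 in S1; rewrite B2 in S2; lra.
  - intros u; exact (proj2 (derivC_momprim k L u)).
  - intros u.
    apply (continuous_ext (fun u => INR k * fst (Cpow (ivar u) (k - 1) * ker L u)%C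
      + 2 * (INR k + 1) * fst (Cpow (ivar u) k * ker L u)%C
      + (INR k + 2 + 2 * L) * fst (Cpow (ivar u) (S k) * ker L u)%C
      + L * fst (Cpow (ivar u) (S (S k)) * ker L u)%C)).
    + intros t; unfold momder, Ci.
      generalize (Cpow (ivar t) (k - 1) * ker L t)%C (Cpow (ivar t) k * ker L t)%C
        (Cpow (ivar t) (S k) * ker L t)%C (Cpow (ivar t) (S (S k)) * ker L t)%C.
      intros a b c d; unfold Cplus, Cmult, RtoC; cbn [fst snd].
      match goal with |- ?l = ?r => change (@eq R l r) end; ring.
    + apply continuous_add; [apply continuous_add; [apply continuous_add |] |]; apply continuous_smul, powker_continuous.
Qed.

Definition amom (L : R) (p : nat) : R := Int (fun u => u ^ (2 * p) * kabs L u) (-2) 2.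

Lemma derive_kabs L u : is_derive (kabs L) u (kabs L u * - (2 * L * u / (1 + u ^ 2) ^ 2)).
Proof.
  evar_last; [apply (is_derive_comp exp (fun u => - (L * (u ^ 2 / (1 + u ^ 2))))); [apply is_derive_exp |] |].
  - instantiate (1 := - (2 * L * u / (1 + u ^ 2) ^ 2)); auto_derive; [nra |]; field; nra.
  - unfold scal; simpl; unfold mult, kabs; simpl; ring.
Qed.

Lemma kabs_pos L u : 0 < kabs L u.
Proof. apply exp_pos. Qed.

Lemma kabs_continuous L u : continuous (kabs L) u.
Proof. exact (derive_continuous _ _ _ (derive_kabs L u)). Qed.

Lemma pow_continuous n u : continuous (fun u => u ^ n) u.
Proof. apply (ex_derive_continuous (fun u => u ^ n)); auto_derive; auto. Qed.

Lemma amom_continuous L p u : continuous (fun u => u ^ p * kabs L u) u.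
Proof. apply continuous_mul; [apply pow_continuous | apply kabs_continuous]. Qed.

Lemma amom_nonneg L p : 0 <= amom L p.
Proof.
  unfold amom; apply Rle_trans with (Int (fun _ => 0) (-2) 2); [rewrite Int_const; lra |].
  apply Int_le; [lra | intros; apply continuous_const | intros; apply amom_continuous |].
  intros u _; apply Rmult_le_pos; [rewrite pow_mult; apply pow_le, pow2_ge_0 | left; apply kabs_pos].
Qed.

(** Integration by parts with [u^(2p+1) (1 + u^2)^2], which clears the denominator in the derivative
    of the exponent. The boundary term has the favourable sign, and [u^4 <= 4 u^2] on [|u| <= 2]
    leaves only two moments. *)
Lemma amom_rec L p : (2 * L - 12 * INR (S p) - 14) * amom L (S p) <= (2 * INR p + 1) * amom L p.
Proof.
  set (F := fun u => u ^ (2 * p + 1) * ((1 + u ^ 2) ^ 2 * kabs L u)).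
  set (f := fun u => (2 * INR p + 1) * (u ^ (2 * p) * ((1 + u ^ 2) ^ 2 * kabs L u))
     + 4 * (u ^ (2 * p + 2) * ((1 + u ^ 2) * kabs L u)) - 2 * L * (u ^ (2 * p + 2) * kabs L u)).
  assert (HF : forall u, is_derive F u (f u)).
  { intros u; unfold F; evar_last.
    - apply (is_derive_mult (fun u => u ^ (2 * p + 1)) (fun u => (1 + u ^ 2) ^ 2 * kabs L u));
        [| | intros; apply Rmult_comm].
      + instantiate (1 := (2 * INR p + 1) * u ^ (2 * p)).
        auto_derive; [auto |]; change (p + (p + 0))%nat with (2 * p)%nat.
        replace (Init.Nat.pred (2 * p + 1)) with (2 * p)%nat by lia.
        rewrite plus_INR, INR_double, INR_1; ring.
      + apply (is_derive_mult (fun u => (1 + u ^ 2) ^ 2) (kabs L)); [| apply derive_kabs | intros; apply Rmult_comm].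
        instantiate (1 := 4 * u * (1 + u ^ 2)); auto_derive; auto; ring.
    - unfold f, plus, mult; simpl; rewrite !pow_add; field; nra. }
  assert (C1 : forall c (g : R -> R) n u, (forall v, continuous g v) -> continuous (fun u => c * (u ^ n * (g u * kabs L u))) u).
  { intros c g n u Hg; apply continuous_smul, continuous_mul; [apply pow_continuous |].
    apply continuous_mul; [auto | apply kabs_continuous]. }
  assert (Cf : forall u, continuous f u).
  { intros u; unfold f; apply continuous_sub.
    - apply continuous_add; apply C1; intros v;
        [apply (ex_derive_continuous (fun u => (1 + u ^ 2) ^ 2)) | apply (ex_derive_continuous (fun u => 1 + u ^ 2))];
        auto_derive; auto.
    - apply continuous_smul, amom_continuous. }
  assert (H := Int_of_derive F f (-2) 2 HF Cf).
  assert (HB : 0 <= F 2 - F (-2)).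
  { unfold F.
    replace ((-2) ^ (2 * p + 1)) with (- 2 ^ (2 * p + 1)).
    - assert (0 < 2 ^ (2 * p + 1)) by (apply pow_lt; lra).
      assert (0 <= (1 + 2 ^ 2) ^ 2 * kabs L 2) by (apply Rmult_le_pos; [lra | left; apply kabs_pos]).
      assert (0 <= (1 + (-2) ^ 2) ^ 2 * kabs L (-2)) by (apply Rmult_le_pos; [lra | left; apply kabs_pos]).
      nra.
    - rewrite !pow_add, !pow_mult; replace ((-2) ^ 2) with (2 ^ 2) by ring; ring. }
  rewrite <- H in HB.
  assert (HL : Int f (-2) 2 <= Int (fun u => (2 * INR p + 1) * (u ^ (2 * p) * kabs L u)
     + (12 * INR (S p) + 14 - 2 * L) * (u ^ (2 * S p) * kabs L u)) (-2) 2).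
  { apply Int_le; [lra | auto | |].
    - intros u; apply continuous_add; apply continuous_smul, amom_continuous.
    - intros u Hu; unfold f; rewrite S_INR.
      replace (2 * S p)%nat with (2 * p + 2)%nat by lia; rewrite pow_add.
      assert (Hk := kabs_pos L u); assert (Hp : 0 <= u ^ (2 * p)) by (rewrite pow_mult; apply pow_le, pow2_ge_0).
      assert (Hu2 : 0 <= u ^ 2 <= 4) by nra.
      set (m := u ^ (2 * p) * kabs L u).
      assert (Hm : 0 <= m) by (apply Rmult_le_pos; lra).
      assert (Hn := pos_INR p).
      assert (K : 0 <= (2 * INR p + 5) * (m * u ^ 2 * (4 - u ^ 2))).
      { apply Rmult_le_pos; [lra | apply Rmult_le_pos; [apply Rmult_le_pos; [exact Hm | apply pow2_ge_0] | lra]]. }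
      unfold m in *; lra. }
  rewrite Int_add, !Int_scal in HL; try (intros; apply amom_continuous);
    try (intros; apply continuous_smul, amom_continuous).
  fold (amom L p) in HL; fold (amom L (S p)) in HL; lra.
Qed.

(** For [|u| <= 1 / sqrt L] the exponent is at least -1, and [exp (-1) >= 1/3]. *)
Lemma amom_0_lower L : 1 <= L -> 2 / 3 / sqrt L <= amom L 0.
Proof.
  intros HL.
  assert (Hs : 1 <= sqrt L) by (rewrite <- sqrt_1; now apply sqrt_le_1_alt).
  assert (Hss := sqrt_sqrt L ltac:(lra)).
  set (s := / sqrt L).
  assert (Hs0 : 0 < s) by (apply Rinv_0_lt_compat; lra).
  assert (Hs1 : s <= 1) by (unfold s; rewrite <- Rinv_1; apply Rinv_le_contravar; lra).
  assert (HsL : L * s ^ 2 = 1) by (rewrite <- Hss at 1; unfold s; field; lra).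
  assert (Ck : forall u, continuous (fun u => u ^ (2 * 0) * kabs L u) u) by (intros; apply amom_continuous).
  unfold amom; rewrite (Int_split _ (-2) (- s)), (Int_split _ (- s) s 2) by auto.
  assert (P : forall a b, a <= b -> 0 <= Int (fun u => u ^ (2 * 0) * kabs L u) a b).
  { intros a b Hab; apply Rle_trans with (Int (fun _ => 0) a b); [rewrite Int_const; lra |].
    apply Int_le; [auto | intros; apply continuous_const | auto |].
    intros u _; simpl; generalize (kabs_pos L u); lra. }
  assert (P1 := P (-2) (- s) ltac:(lra)); assert (P2 := P s 2 ltac:(lra)).
  assert (M : Int (fun _ => / 3) (- s) s <= Int (fun u => u ^ (2 * 0) * kabs L u) (- s) s).
  { apply Int_le; [lra | intros; apply continuous_const | auto |].
    intros u Hu; simpl; rewrite Rmult_1_l.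
    apply Rle_trans with (exp (- (1))).
    - rewrite exp_Ropp; apply Rinv_le_contravar; [apply exp_pos | apply exp_le_3].
    - unfold kabs.
      assert (Hu2 : u ^ 2 <= s ^ 2) by nra.
      assert (Hq : u ^ 2 / (1 + u ^ 2) <= u ^ 2).
      { apply Rmult_le_reg_r with (1 + u ^ 2); [nra |]; unfold Rdiv; rewrite Rmult_assoc, Rinv_l by nra; nra. }
      assert (Hle : L * (u ^ 2 / (1 + u ^ 2)) <= 1).
      { apply Rle_trans with (L * s ^ 2); [apply Rmult_le_compat_l; lra | lra]. }
      revert Hle; generalize (L * (u ^ 2 / (1 + u ^ 2))); intros y Hle.
      destruct Hle as [H | H]; [left; apply exp_increasing; lra | rewrite H; lra]. }
  rewrite Int_const in M.
  unfold Rdiv at 1; fold s.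
  replace (2 / 3 * s) with (/ 3 * (s - - s)) by field; lra.
Qed.

Lemma mom_even L p : mom L (2 * p) = (-1) ^ p * Int (fun u => u ^ (2 * p) * (kabs L u * cos (kphase L u))) (-2) 2.
Proof.
  unfold mom; rewrite <- Int_scal.
  - apply Int_ext; intros u; rewrite ker_polar.
    replace (Cpow (ivar u) (2 * p)) with (RtoC ((-1) ^ p * u ^ (2 * p))).
    + unfold Cmult, RtoC; cbn [fst snd]; ring.
    +
      induction p as [| p IH]; [simpl; f_equal; ring |].
      replace (2 * S p)%nat with (S (S (2 * p))) by lia; cbn [Cpow]; rewrite <- IH.
      unfold ivar; replace (Ci * RtoC u * (Ci * RtoC u * RtoC ((-1) ^ p * u ^ (2 * p))))%C
        with ((Ci * Ci) * RtoC (u * u * ((-1) ^ p * u ^ (2 * p))))%C by (rewrite !RtoC_mult; ring).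
      replace (Ci * Ci)%C with (RtoC (-1)) by (unfold Ci, Cmult, RtoC; simpl; f_equal; ring).
      rewrite <- RtoC_mult; f_equal; cbn [pow]; ring.
  - intros u; apply continuous_mul; [apply pow_continuous |].
    apply (ex_derive_continuous (fun u => kabs L u * cos (kphase L u))); unfold kabs, kphase; auto_derive; nra.
Qed.

Lemma mom_odd L p : mom L (2 * p + 1) = (-1) ^ S p * Int (fun u => u ^ (2 * p + 1) * (kabs L u * sin (kphase L u))) (-2) 2.
Proof.
  unfold mom; rewrite <- Int_scal.
  - apply Int_ext; intros u; rewrite ker_polar.
    replace (Cpow (ivar u) (2 * p + 1)) with (Ci * RtoC ((-1) ^ p * u ^ (2 * p + 1)))%C.
    + unfold Cmult, RtoC, Ci; cbn [fst snd]; cbn [pow]; ring.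
    + induction p as [| p IH]; [simpl; unfold ivar; rewrite !Rmult_1_l, Rmult_1_r; ring |].
      replace (2 * S p + 1)%nat with (S (S (2 * p + 1))) by lia; cbn [Cpow]; rewrite <- IH.
      unfold ivar; replace (Ci * RtoC u * (Ci * RtoC u * (Ci * RtoC ((-1) ^ p * u ^ (2 * p + 1)))))%C
        with (Ci * ((Ci * Ci) * RtoC (u * u * ((-1) ^ p * u ^ (2 * p + 1)))))%C by (rewrite !RtoC_mult; ring).
      replace (Ci * Ci)%C with (RtoC (-1)) by (unfold Ci, Cmult, RtoC; simpl; f_equal; ring).
      rewrite <- RtoC_mult; f_equal; f_equal; cbn [pow]; ring.
  - intros u; apply continuous_mul; [apply pow_continuous |].
    apply (ex_derive_continuous (fun u => kabs L u * sin (kphase L u))); unfold kabs, kphase; auto_derive; nra.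
Qed.

Section MomentSystem.

(* Normalised moments [e_k] of [exp (L v^2/(1+v))], [v = iu], with [ep = 1/L]: they solve a
   three-step recursion up to negligible errors [b_k].  As [e_8] is [O(ep^4)], they are close to
   the exact solution [n_k] of the recursion with [n_0 = 1], [n_8 = 0]. *)
Variables ep e1 e2 e3 e4 e5 e6 e7 e8 b0 b1 b2 b3 b4 b5 b6 : R.
Hypothesis Hep : 0 < ep <= 1 / 140.
Hypothesis E0 : e2 = - (2 * ep + (2 * ep + 2) * e1) + b0.
Hypothesis E1 : e3 = - (ep + 4 * ep * e1 + (3 * ep + 2) * e2) + b1.
Hypothesis E2 : e4 = - (2 * ep * e1 + 6 * ep * e2 + (4 * ep + 2) * e3) + b2.
Hypothesis E3 : e5 = - (3 * ep * e2 + 8 * ep * e3 + (5 * ep + 2) * e4) + b3.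
Hypothesis E4 : e6 = - (4 * ep * e3 + 10 * ep * e4 + (6 * ep + 2) * e5) + b4.
Hypothesis E5 : e7 = - (5 * ep * e4 + 12 * ep * e5 + (7 * ep + 2) * e6) + b5.
Hypothesis E6 : e8 = - (6 * ep * e5 + 14 * ep * e6 + (8 * ep + 2) * e7) + b6.
Hypothesis B0 : Rabs b0 <= ep ^ 8.
Hypothesis B1 : Rabs b1 <= ep ^ 8.
Hypothesis B2 : Rabs b2 <= ep ^ 8.
Hypothesis B3 : Rabs b3 <= ep ^ 8.
Hypothesis B4 : Rabs b4 <= ep ^ 8.
Hypothesis B5 : Rabs b5 <= ep ^ 8.
Hypothesis B6 : Rabs b6 <= ep ^ 8.
Hypothesis B8 : Rabs e8 <= 14 * ep ^ 4.

Let Q := 128 + 832 * ep + 3312 * ep ^ 2 + 9600 * ep ^ 3 + 21120 * ep ^ 4 + 35280 * ep ^ 5 + 40320 * ep ^ 6 + 40320 * ep ^ 7.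
Let n1 := (- 96 * ep - 612 * ep ^ 2 - 2400 * ep ^ 3 - 6840 * ep ^ 4 - 15120 * ep ^ 5 - 20160 * ep ^ 6 - 40320 * ep ^ 7) / Q.
Let n2 := (- 64 * ep - 248 * ep ^ 2 - 600 * ep ^ 3 - 720 * ep ^ 4 + 1680 * ep ^ 5 + 40320 * ep ^ 7) / Q.
Let n3 := (240 * ep ^ 2 + 1080 * ep ^ 3 + 3240 * ep ^ 4 + 5040 * ep ^ 5 + 20160 * ep ^ 6 - 40320 * ep ^ 7) / Q.
Let n4 := (96 * ep ^ 2 - 408 * ep ^ 3 - 2400 * ep ^ 4 - 5040 * ep ^ 5 - 40320 * ep ^ 6 + 40320 * ep ^ 7) / Q.
Let n5 := (- 840 * ep ^ 3 - 1680 * ep ^ 5 + 60480 * ep ^ 6 - 40320 * ep ^ 7) / Q.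
Let n6 := (- 240 * ep ^ 3 + 4800 * ep ^ 4 + 14400 * ep ^ 5 - 80640 * ep ^ 6 + 40320 * ep ^ 7) / Q.
Let n7 := (4200 * ep ^ 4 - 50400 * ep ^ 5 + 105840 * ep ^ 6 - 40320 * ep ^ 7) / Q.

(** Run forwards, the recursion multiplies an error in [e1] by about -2 at each step, so [e1] is
    pinned down from the far end. [r_k] is [e_k - n_k] minus [dl] times the homogeneous solution
    with values 0 and 1 at the indices 0 and 1; only the [b_k] feed it. At index 8 that solution is
    [- Q], so a small [e8] forces a small [dl]. *)
Let dl := e1 - n1.
Let r2 := (e2 - n2) + (2 + 2 * ep) * dl.
Let r3 := (e3 - n3) - (4 + 6 * ep + 6 * ep ^ 2) * dl.
Let r4 := (e4 - n4) + (8 + 18 * ep + 24 * ep ^ 2 + 24 * ep ^ 3) * dl.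
Let r5 := (e5 - n5) - (16 + 50 * ep + 96 * ep ^ 2 + 120 * ep ^ 3 + 120 * ep ^ 4) * dl.
Let r6 := (e6 - n6) + (32 + 132 * ep + 336 * ep ^ 2 + 600 * ep ^ 3 + 720 * ep ^ 4 + 720 * ep ^ 5) * dl.
Let r7 := (e7 - n7) - (64 + 336 * ep + 1086 * ep ^ 2 + 2520 * ep ^ 3 + 4320 * ep ^ 4 + 5040 * ep ^ 5 + 5040 * ep ^ 6) * dl.
Let r8 := e8 + Q * dl.

Lemma ep_pow n : 0 < ep ^ S n <= ep ^ n / 140.
Proof.
  assert (H : 0 < ep ^ n) by (apply pow_lt; lra).
  split; [apply pow_lt; lra | simpl; nra].
Qed.

Ltac powers :=
  generalize (ep_pow 0) (ep_pow 1) (ep_pow 2) (ep_pow 3) (ep_pow 4) (ep_pow 5) (ep_pow 6) (ep_pow 7)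
    (ep_pow 8) (ep_pow 9) (ep_pow 10) (ep_pow 11) (ep_pow 12) (ep_pow 13); rewrite pow_O, pow_1; intros.

Lemma Q_pos : 128 <= Q.
Proof. unfold Q; powers; lra. Qed.

Lemma Rabs_ep_mul a A : Rabs a <= A -> - (A / 140) <= ep * a <= A / 140.
Proof.
  intros H; apply Rabs_le_between; rewrite Rabs_mult, (Rabs_pos_eq ep) by lra.
  generalize (Rabs_pos a); nra.
Qed.

Lemma r_rec (a b c d k A B C D : R) : 0 <= k ->
  Rabs a <= A -> Rabs b <= B -> Rabs c <= C -> Rabs d <= D ->
  Rabs (- (k * (ep * a) + 2 * (k + 1) * (ep * b) + (k + 2) * (ep * c) + 2 * c) + d)
    <= k * (A / 140) + 2 * (k + 1) * (B / 140) + (k + 2) * (C / 140) + 2 * C + D.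
Proof.
  intros Hk Ha Hb Hc Hd.
  assert (Ha' := Rabs_ep_mul a A Ha); assert (Hb' := Rabs_ep_mul b B Hb); assert (Hc' := Rabs_ep_mul c C Hc).
  apply Rabs_le_between in Hc; apply Rabs_le_between in Hd.
  apply Rabs_le; split; nra.
Qed.

Lemma Rabs_0_le (a : R) : 0 <= a -> Rabs 0 <= a.
Proof. rewrite Rabs_R0; auto. Qed.

(** Each [r_k] obeys the recursion with source [b_(k-2)]. As [ep <= 1/140], the constants are
    governed by the coefficient 2 and the unit source. *)
Lemma r_bounds : Rabs r2 <= ep ^ 8 /\ Rabs r3 <= 4 * ep ^ 8 /\ Rabs r4 <= 10 * ep ^ 8 /\
  Rabs r5 <= 22 * ep ^ 8 /\ Rabs r6 <= 47 * ep ^ 8 /\ Rabs r7 <= 100 * ep ^ 8 /\ Rabs r8 <= 215 * ep ^ 8.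
Proof.
  assert (HQ := Q_pos); assert (He : 0 < ep ^ 8) by (apply pow_lt; lra).
  assert (F2 : r2 = b0).
  { unfold r2, dl, n1, n2; rewrite E0; field_simplify; [| lra]; unfold Q; field; fold Q; lra. }
  assert (F3 : r3 = - (1 * (ep * 0) + 2 * (1 + 1) * (ep * 0) + (1 + 2) * (ep * r2) + 2 * r2) + b1).
  { unfold r3, r2, dl, n1, n2, n3; rewrite E1; unfold Q; field; fold Q; lra. }
  assert (F4 : r4 = - (2 * (ep * 0) + 2 * (2 + 1) * (ep * r2) + (2 + 2) * (ep * r3) + 2 * r3) + b2).
  { unfold r4, r3, r2, dl, n1, n2, n3, n4; rewrite E2; unfold Q; field; fold Q; lra. }
  assert (F5 : r5 = - (3 * (ep * r2) + 2 * (3 + 1) * (ep * r3) + (3 + 2) * (ep * r4) + 2 * r4) + b3).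
  { unfold r5, r4, r3, r2, dl, n1, n2, n3, n4, n5; rewrite E3; unfold Q; field; fold Q; lra. }
  assert (F6 : r6 = - (4 * (ep * r3) + 2 * (4 + 1) * (ep * r4) + (4 + 2) * (ep * r5) + 2 * r5) + b4).
  { unfold r6, r5, r4, r3, dl, n1, n3, n4, n5, n6; rewrite E4; unfold Q; field; fold Q; lra. }
  assert (F7 : r7 = - (5 * (ep * r4) + 2 * (5 + 1) * (ep * r5) + (5 + 2) * (ep * r6) + 2 * r6) + b5).
  { unfold r7, r6, r5, r4, dl, n1, n4, n5, n6, n7; rewrite E5; unfold Q; field; fold Q; lra. }
  assert (F8 : r8 = - (6 * (ep * r5) + 2 * (6 + 1) * (ep * r6) + (6 + 2) * (ep * r7) + 2 * r7) + b6).
  { unfold r8, r7, r6, r5, dl, n1, n5, n6, n7; rewrite E6; unfold Q; field; fold Q; lra. }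
  assert (Z := Rabs_0_le 0 ltac:(lra)).
  assert (H2 : Rabs r2 <= ep ^ 8) by (rewrite F2; exact B0).
  assert (H3 : Rabs r3 <= 4 * ep ^ 8).
  { rewrite F3; eapply Rle_trans; [apply (r_rec _ _ _ _ 1 _ _ _ _ ltac:(lra) Z Z H2 B1) | lra]. }
  assert (H4 : Rabs r4 <= 10 * ep ^ 8).
  { rewrite F4; eapply Rle_trans; [apply (r_rec _ _ _ _ 2 _ _ _ _ ltac:(lra) Z H2 H3 B2) | lra]. }
  assert (H5 : Rabs r5 <= 22 * ep ^ 8).
  { rewrite F5; eapply Rle_trans; [apply (r_rec _ _ _ _ 3 _ _ _ _ ltac:(lra) H2 H3 H4 B3) | lra]. }
  assert (H6 : Rabs r6 <= 47 * ep ^ 8).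
  { rewrite F6; eapply Rle_trans; [apply (r_rec _ _ _ _ 4 _ _ _ _ ltac:(lra) H3 H4 H5 B4) | lra]. }
  assert (H7 : Rabs r7 <= 100 * ep ^ 8).
  { rewrite F7; eapply Rle_trans; [apply (r_rec _ _ _ _ 5 _ _ _ _ ltac:(lra) H4 H5 H6 B5) | lra]. }
  assert (H8 : Rabs r8 <= 215 * ep ^ 8).
  { rewrite F8; eapply Rle_trans; [apply (r_rec _ _ _ _ 6 _ _ _ _ ltac:(lra) H5 H6 H7 B6) | lra]. }
  tauto.
Qed.

(** [14 / 128] is just below [110/1000]; the other contribution is of order [ep^8]. *)
Lemma dl_bound : Rabs dl <= 110 / 1000 * ep ^ 4.
Proof.
  assert (HQ := Q_pos); destruct r_bounds as (_ & _ & _ & _ & _ & _ & H8).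
  assert (E : Q * dl = r8 - e8) by (unfold r8; ring).
  assert (H : Rabs (Q * dl) <= 215 * ep ^ 8 + 14 * ep ^ 4).
  { rewrite E; eapply Rle_trans; [apply Rabs_triang |]; rewrite Rabs_Ropp; lra. }
  rewrite Rabs_mult, (Rabs_pos_eq Q) in H by lra.
  assert (0 <= Rabs dl) by apply Rabs_pos; powers; nra.
Qed.

Lemma div_Q_le (p A : R) : p <= 128 * A -> 0 <= A -> p / Q <= A.
Proof.
  intros H HA; assert (HQ := Q_pos).
  apply Rmult_le_reg_r with Q; [lra |]; unfold Rdiv; rewrite Rmult_assoc, Rinv_l by lra; nra.
Qed.

Lemma div_Q_bound (p A : R) : - (128 * A) <= p <= 128 * A -> 0 <= A -> - A <= p / Q <= A.
Proof.
  intros H HA; split; [| apply div_Q_le; lra].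
  cut (- p / Q <= A); [unfold Rdiv; lra | apply div_Q_le; lra].
Qed.

(** Over the denominator [Q^2] the terms below [ep^4] cancel, and [102144 ep^4] outweighs the
    negative terms when [ep <= 1/140]. *)
Lemma n_invariant :
  n6 - 6 * n5 * n1 + 15 * n4 * n2 - 10 * n3 ^ 2 >= - (15 / 2) * ep ^ 3 + 54 * ep ^ 4.
Proof.
  assert (HQ := Q_pos).
  assert (E : n6 - 6 * n5 * n1 + 15 * n4 * n2 - 10 * n3 ^ 2 - (- (15 / 2) * ep ^ 3 + 54 * ep ^ 4)
     = (102144 * ep ^ 4 - 219648 * ep ^ 5 - 32025024 * ep ^ 6 - 175012992 * ep ^ 7 - 980931456 * ep ^ 8 - 3489315840 * ep ^ 9 - 10953031680 * ep ^ 10 - 27677998080 * ep ^ 11 - 59753687040 * ep ^ 12 - 108783803520 * ep ^ 13 - 166873996800 * ep ^ 14 - 212067072000 * ep ^ 15 - 217031270400 * ep ^ 16 - 163383091200 * ep ^ 17 - 87787929600 * ep ^ 18) / Q ^ 2).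
  (* Clearing [Q] for arbitrary numerators first keeps the rational expressions small. *)
  { assert (F : forall a1 a2 a3 a4 a5 a6 t, a6 / Q - 6 * (a5 / Q) * (a1 / Q) + 15 * (a4 / Q) * (a2 / Q)
        - 10 * (a3 / Q) ^ 2 - t = (a6 * Q - 6 * a5 * a1 + 15 * a4 * a2 - 10 * a3 ^ 2 - t * Q ^ 2) / Q ^ 2)
      by (intros; field; lra).
    unfold n6, n5, n4, n3, n2, n1; rewrite F; f_equal; unfold Q; field. }
  apply Rle_ge, Rminus_le_0; rewrite E.
  apply Rmult_le_pos; [| left; apply Rinv_0_lt_compat, pow_lt; lra].
  generalize (ep_pow 14) (ep_pow 15) (ep_pow 16) (ep_pow 17); powers; lra.
Qed.

(** Replacing [n_k] by [e_k] costs at most [4 ep^4]: [e6] moves by at most [33 * 0.11 + 0.001] times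
    [ep^4], and every product containing a shift has at least one more factor [ep]. *)
Lemma moment_invariant :
  e6 - 6 * e5 * e1 + 15 * e4 * e2 - 10 * e3 ^ 2 >= - (15 / 2) * ep ^ 3 + 50 * ep ^ 4.
Proof.
  assert (HN := n_invariant); destruct r_bounds as (H2 & H3 & H4 & H5 & H6 & _).
  assert (Hd := dl_bound); rewrite <- (Rmult_1_l (ep ^ 8)) in H2.
  assert (M1 : - (8 / 10 * ep) <= n1 <= 8 / 10 * ep) by (apply div_Q_bound; powers; lra).
  assert (M2 : - (6 / 10 * ep) <= n2 <= 6 / 10 * ep) by (apply div_Q_bound; powers; lra).
  assert (M3 : - (2 * ep ^ 2) <= n3 <= 2 * ep ^ 2) by (apply div_Q_bound; powers; lra).
  assert (M4 : - (8 / 10 * ep ^ 2) <= n4 <= 8 / 10 * ep ^ 2) by (apply div_Q_bound; powers; lra).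
  assert (M5 : - (7 * ep ^ 3) <= n5 <= 7 * ep ^ 3) by (apply div_Q_bound; powers; lra).
  assert (G : forall c r K R0, Rabs r <= R0 * ep ^ 8 -> 0 <= c <= K -> 0 <= R0 <= 100 ->
     forall y, (y = r - c * dl \/ y = r + c * dl) -> Rabs y <= (K * (110 / 1000) + 1 / 1000) * ep ^ 4).
  { intros c r K R0 Hr Hc HR y Hy.
    assert (Hcd : Rabs (c * dl) <= K * (110 / 1000 * ep ^ 4)).
    { rewrite Rabs_mult, Rabs_pos_eq by lra; apply Rmult_le_compat; try lra; apply Rabs_pos. }
    assert (Hs : R0 * ep ^ 8 <= 1 / 1000 * ep ^ 4) by (powers; nra).
    apply Rabs_le_between in Hcd; apply Rabs_le_between in Hr; apply Rabs_le; destruct Hy; subst y; lra. }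
  assert (Y2 : e2 - n2 = r2 - (2 + 2 * ep) * dl) by (unfold r2; ring).
  assert (D2 := G (2 + 2 * ep) r2 (21 / 10) 1 H2 ltac:(powers; lra) ltac:(lra) _ (or_introl Y2)).
  assert (Y3 : e3 - n3 = r3 + (4 + 6 * ep + 6 * ep ^ 2) * dl) by (unfold r3; ring).
  assert (D3 := G (4 + 6 * ep + 6 * ep ^ 2) r3 (41 / 10) 4 H3 ltac:(powers; lra) ltac:(lra) _ (or_intror Y3)).
  assert (Y4 : e4 - n4 = r4 - (8 + 18 * ep + 24 * ep ^ 2 + 24 * ep ^ 3) * dl) by (unfold r4; ring).
  assert (D4 := G (8 + 18 * ep + 24 * ep ^ 2 + 24 * ep ^ 3) r4 (82 / 10) 10 H4 ltac:(powers; lra) ltac:(lra) _ (or_introl Y4)).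
  assert (Y5 : e5 - n5 = r5 + (16 + 50 * ep + 96 * ep ^ 2 + 120 * ep ^ 3 + 120 * ep ^ 4) * dl) by (unfold r5; ring).
  assert (D5 := G (16 + 50 * ep + 96 * ep ^ 2 + 120 * ep ^ 3 + 120 * ep ^ 4) r5 (165 / 10) 22 H5 ltac:(powers; lra) ltac:(lra) _ (or_intror Y5)).
  assert (Y6 : e6 - n6 = r6 - (32 + 132 * ep + 336 * ep ^ 2 + 600 * ep ^ 3 + 720 * ep ^ 4 + 720 * ep ^ 5) * dl) by (unfold r6; ring).
  assert (D6 := G (32 + 132 * ep + 336 * ep ^ 2 + 600 * ep ^ 3 + 720 * ep ^ 4 + 720 * ep ^ 5) r6 (33) 47 H6 ltac:(powers; lra) ltac:(lra) _ (or_introl Y6)).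
  set (d2 := e2 - n2) in *; set (d3 := e3 - n3) in *; set (d4 := e4 - n4) in *;
    set (d5 := e5 - n5) in *; set (d6 := e6 - n6) in *.
  replace e1 with (n1 + dl) by (unfold dl; ring).
  replace e2 with (n2 + d2) by (unfold d2; ring).
  replace e3 with (n3 + d3) by (unfold d3; ring).
  replace e4 with (n4 + d4) by (unfold d4; ring).
  replace e5 with (n5 + d5) by (unfold d5; ring).
  replace e6 with (n6 + d6) by (unfold d6; ring).
  assert (P : forall a b A B, Rabs a <= A -> Rabs b <= B -> - (A * B) <= a * b <= A * B).
  { intros a b A B Ha Hb; apply Rabs_le_between; rewrite Rabs_mult.
    apply Rmult_le_compat; auto using Rabs_pos. }
  apply Rabs_le in M1; apply Rabs_le in M2; apply Rabs_le in M3; apply Rabs_le in M4; apply Rabs_le in M5.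
  assert (P51 := P n5 dl _ _ M5 Hd); assert (P15 := P d5 n1 _ _ D5 M1); assert (P55 := P d5 dl _ _ D5 Hd).
  assert (P42 := P n4 d2 _ _ M4 D2); assert (P24 := P d4 n2 _ _ D4 M2); assert (P44 := P d4 d2 _ _ D4 D2).
  assert (P33 := P n3 d3 _ _ M3 D3); assert (P3 := P d3 d3 _ _ D3 D3).
  apply Rabs_le_between in D6.
  powers; lra.
Qed.

End MomentSystem.

(** * Size of the normalised moments *)

Lemma abs_sin_le t : Rabs (sin t) <= Rabs t.
Proof.
  assert (H : forall t, 0 <= t -> Rabs (sin t) <= t).
  { intros s Hs; destruct (Req_dec s 0) as [-> | H0]; [rewrite sin_0, Rabs_R0; lra |].
    destruct (MVT_cor2 sin cos 0 s) as [c [Hc _]]; [lra | intros; apply derivable_pt_lim_sin |].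
    rewrite sin_0, !Rminus_0_r in Hc; rewrite Hc, Rabs_mult, (Rabs_pos_eq s) by lra.
    assert (Rabs (cos c) <= 1) by (apply Rabs_le, COS_bound); nra. }
  destruct (Rle_lt_dec 0 t) as [Ht | Ht]; [rewrite (Rabs_pos_eq t) by auto; auto |].
  rewrite <- (Ropp_involutive t) at 1; rewrite sin_neg, Rabs_Ropp, (Rabs_left t) by auto; apply H; lra.
Qed.

Lemma cos_ge_parabola t : 1 - t ^ 2 / 2 <= cos t.
Proof.
  assert (H := cos_2a_sin (t / 2)); replace (2 * (t / 2)) with t in H by field.
  assert (S := abs_sin_le (t / 2)); apply Rsqr_le_abs_1 in S; unfold Rsqr in S; rewrite H; nra.
Qed.

Lemma kphase_bound L u : 0 <= L -> Rabs (kphase L u) <= L * Rabs u ^ 3.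
Proof.
  intros HL; unfold kphase; rewrite Rabs_mult, (Rabs_pos_eq L) by auto.
  apply Rmult_le_compat_l; [auto |]; unfold Rdiv; rewrite Rabs_mult, RPow_abs.
  rewrite <- (Rmult_1_r (Rabs (u ^ 3))) at 2.
  apply Rmult_le_compat_l; [apply Rabs_pos |].
  rewrite Rabs_pos_eq; [rewrite <- Rinv_1; apply Rinv_le_contravar; nra | left; apply Rinv_0_lt_compat; nra].
Qed.

Lemma kcos_continuous L u : continuous (fun u => kabs L u * cos (kphase L u)) u.
Proof. apply (ex_derive_continuous (fun u => kabs L u * cos (kphase L u))); unfold kabs, kphase; auto_derive; nra. Qed.

Lemma ksin_continuous L u : continuous (fun u => kabs L u * sin (kphase L u)) u.
Proof. apply (ex_derive_continuous (fun u => kabs L u * sin (kphase L u))); unfold kabs, kphase; auto_derive; nra. Qed.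

Lemma even_pow_abs u p : u ^ (2 * p) = Rabs u ^ (2 * p).
Proof. rewrite !pow_mult, <- (pow2_abs u); reflexivity. Qed.

Lemma Int_cos_bound L (g : R -> R) c p : (forall u, continuous g u) ->
  (forall u, -2 <= u <= 2 -> Rabs (g u) <= c * u ^ (2 * p)) ->
  Rabs (Int (fun u => g u * (kabs L u * cos (kphase L u))) (-2) 2) <= c * amom L p.
Proof.
  intros Hg HB; unfold amom; rewrite <- Int_scal by (intros; apply amom_continuous).
  apply Int_abs_le; [lra | intros; apply continuous_mul; [auto | apply kcos_continuous] |
    intros; apply continuous_smul, amom_continuous |].
  intros u Hu; rewrite !Rabs_mult, (Rabs_pos_eq (kabs L u)) by (left; apply kabs_pos).
  assert (Rabs (cos (kphase L u)) <= 1) by (apply Rabs_le, COS_bound).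
  assert (K := kabs_pos L u).
  replace (c * (u ^ (2 * p) * kabs L u)) with ((c * u ^ (2 * p)) * (kabs L u * 1)) by ring.
  apply Rmult_le_compat; [apply Rabs_pos | apply Rmult_le_pos; [lra | apply Rabs_pos] | auto |].
  apply Rmult_le_compat_l; lra.
Qed.

Lemma Int_sin_bound L (g : R -> R) c p : 0 <= L -> (forall u, continuous g u) ->
  (forall u, -2 <= u <= 2 -> Rabs (g u) <= c * Rabs u ^ (2 * p + 1)) ->
  Rabs (Int (fun u => g u * (kabs L u * sin (kphase L u))) (-2) 2) <= c * (L * amom L (p + 2)).
Proof.
  intros HL Hg HB; unfold amom; rewrite <- Rmult_assoc, <- Int_scal by (intros; apply amom_continuous).
  apply Int_abs_le; [lra | intros; apply continuous_mul; [auto | apply ksin_continuous] |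
    intros; apply continuous_smul, amom_continuous |].
  intros u Hu; rewrite !Rabs_mult, (Rabs_pos_eq (kabs L u)) by (left; apply kabs_pos).
  assert (S : Rabs (sin (kphase L u)) <= L * Rabs u ^ 3).
  { eapply Rle_trans; [apply abs_sin_le | now apply kphase_bound]. }
  assert (K := kabs_pos L u).
  apply Rle_trans with ((c * Rabs u ^ (2 * p + 1)) * (kabs L u * (L * Rabs u ^ 3))).
  - apply Rmult_le_compat; [apply Rabs_pos | apply Rmult_le_pos; [lra | apply Rabs_pos] | auto |].
    apply Rmult_le_compat_l; lra.
  - right; rewrite even_pow_abs; replace (2 * (p + 2))%nat with ((2 * p + 1) + 3)%nat by lia.
    rewrite (pow_add _ (2 * p + 1)); ring.
Qed.

Section NormalisedMoments.

Variable L : R.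
Hypothesis HL : 140 <= L.

Let ep := / L.

Lemma ep_range : 0 < ep <= 1 / 140.
Proof.
  unfold ep; split; [apply Rinv_0_lt_compat; lra |].
  replace (1 / 140) with (/ 140) by field; apply Rinv_le_contravar; lra.
Qed.

Lemma L_ep : L * ep = 1.
Proof. unfold ep; field; lra. Qed.

Lemma amom_step p c : 0 < c -> (2 * INR p + 1) <= c * (2 - (12 * INR (S p) + 14) / 140) ->
  0 < 2 - (12 * INR (S p) + 14) / 140 ->
  amom L (S p) <= c * ep * amom L p.
Proof.
  intros Hc H1 H2; assert (R := amom_rec L p); assert (A := amom_nonneg L (S p)); assert (A' := amom_nonneg L p).
  assert (Hp := pos_INR (S p)).
  set (k := 2 - (12 * INR (S p) + 14) / 140) in *.
  assert (Hk : L * k <= 2 * L - 12 * INR (S p) - 14).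
  { unfold k; nra. }
  assert (L * k * amom L (S p) <= c * k * amom L p) by nra.
  apply Rmult_le_reg_l with (L * k); [nra |].
  replace (L * k * (c * ep * amom L p)) with ((L * ep) * (c * k * amom L p)) by ring; rewrite L_ep; lra.
Qed.

(** The step factors are [(2 p + 1) / (2 - (12 (p + 1) + 14) / 140)] rounded up, from [amom_rec] and
    [L >= 140]; a Gaussian weight would give [(2 p + 1) / 2]. *)
Lemma amom_ratios : let A := amom L in
  A 1%nat <= 552 / 1000 * ep ^ 1 * A 0%nat /\ A 2%nat <= 9583 / 10000 * ep ^ 2 * A 0%nat /\
  A 3%nat <= 29171 / 10000 * ep ^ 3 * A 0%nat /\ A 4%nat <= 13116 / 1000 * ep ^ 4 * A 0%nat /\
  A 5%nat <= 8024 / 100 * ep ^ 5 * A 0%nat.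
Proof.
  intros A; assert (E := ep_range).
  assert (S0 : A 1%nat <= 552 / 1000 * ep * A 0%nat) by (apply amom_step; simpl; lra).
  assert (S1 : A 2%nat <= 1736 / 1000 * ep * A 1%nat) by (apply amom_step; simpl; lra).
  assert (S2 : A 3%nat <= 3044 / 1000 * ep * A 2%nat) by (apply amom_step; simpl; lra).
  assert (S3 : A 4%nat <= 4496 / 1000 * ep * A 3%nat) by (apply amom_step; simpl; lra).
  assert (S4 : A 5%nat <= 6117 / 1000 * ep * A 4%nat) by (apply amom_step; simpl; lra).
  assert (P0 := amom_nonneg L 0); fold A in P0.
  assert (M : forall p c d k Y Z, 0 <= c -> c * d <= k -> Y <= d * ep ^ p * A 0%nat -> Z <= c * ep * Y ->
     Z <= k * ep ^ S p * A 0%nat).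
  { intros p c d k Y Z Hc Hk HY HZ; eapply Rle_trans; [exact HZ |].
    apply Rle_trans with (c * ep * (d * ep ^ p * A 0%nat)).
    - apply Rmult_le_compat_l; [apply Rmult_le_pos; lra | auto].
    - replace (c * ep * (d * ep ^ p * A 0%nat)) with ((c * d) * (ep * ep ^ p * A 0%nat)) by ring.
      replace (k * ep ^ S p * A 0%nat) with (k * (ep * ep ^ p * A 0%nat)) by (simpl; ring).
      apply Rmult_le_compat_r; [| auto].
      apply Rmult_le_pos; [apply Rmult_le_pos; [lra | apply pow_le; lra] | auto]. }
  assert (T1 : A 1%nat <= 552 / 1000 * ep ^ 1 * A 0%nat) by (rewrite pow_1; auto).
  assert (T2 := M 1%nat (1736 / 1000) (552 / 1000) (9583 / 10000) _ _ ltac:(lra) ltac:(lra) T1 S1).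
  assert (T3 := M 2%nat (3044 / 1000) (9583 / 10000) (29171 / 10000) _ _ ltac:(lra) ltac:(lra) T2 S2).
  assert (T4 := M 3%nat (4496 / 1000) (29171 / 10000) (13116 / 1000) _ _ ltac:(lra) ltac:(lra) T3 S3).
  assert (T5 := M 4%nat (6117 / 1000) (13116 / 1000) (8024 / 100) _ _ ltac:(lra) ltac:(lra) T4 S4).
  repeat split; assumption.
Qed.

Lemma mom_0 : mom L 0 = Int (fun u => kabs L u * cos (kphase L u)) (-2) 2.
Proof.
  change (mom L 0) with (mom L (2 * 0)); rewrite mom_even, pow_O, Rmult_1_l; apply Int_ext; intros; simpl; ring.
Qed.

Lemma mom_0_lower : amom L 0 - L ^ 2 / 2 * amom L 3 <= mom L 0.
Proof.
  rewrite mom_0; unfold amom.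
  rewrite <- Int_scal, <- Int_sub by (intros; first [apply amom_continuous | apply continuous_smul, amom_continuous]).
  apply Int_le; [lra | | apply kcos_continuous |].
  - intros u; apply continuous_sub; [apply amom_continuous | apply continuous_smul, amom_continuous].
  - intros u _; assert (K := kabs_pos L u); assert (C := cos_ge_parabola (kphase L u)).
    assert (P := kphase_bound L u ltac:(lra)).
    assert (H : kphase L u ^ 2 <= L ^ 2 * u ^ (2 * 3)).
    { rewrite <- (pow2_abs (kphase L u)), (even_pow_abs u 3).
      replace (L ^ 2 * Rabs u ^ (2 * 3)) with ((L * Rabs u ^ 3) ^ 2) by (change (2 * 3)%nat with 6%nat; ring).
      apply pow_incr; split; [apply Rabs_pos | auto]. }
    change (u ^ (2 * 0)) with 1.
    replace (1 * kabs L u - L ^ 2 / 2 * (u ^ (2 * 3) * kabs L u)) with (kabs L u * (1 - (L ^ 2 * u ^ (2 * 3)) / 2)) by field.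
    apply Rmult_le_compat_l; lra.
Qed.

(** The phase costs at most [L^2 / 2 * amom L 3], a fraction [1.46 / L] of [amom L 0], about one
    percent at [L = 140]. *)
Lemma amom_0_le : amom L 0 <= 1011 / 1000 * mom L 0.
Proof.
  assert (E := ep_range); destruct amom_ratios as (_ & _ & A3 & _); assert (M := mom_0_lower).
  assert (P := amom_nonneg L 0).
  assert (H : L ^ 2 / 2 * amom L 3 <= 29171 / 20000 * ep * amom L 0).
  { apply Rle_trans with (L ^ 2 / 2 * (29171 / 10000 * ep ^ 3 * amom L 0)).
    - apply Rmult_le_compat_l; [generalize (pow2_ge_0 L); lra | auto].
    - replace (L ^ 2 / 2 * (29171 / 10000 * ep ^ 3 * amom L 0)) with ((L * ep) ^ 2 * (29171 / 20000 * ep * amom L 0)) by field.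
      rewrite L_ep; lra. }
  nra.
Qed.

Lemma mom_0_pos : 65 / 100 / sqrt L <= mom L 0.
Proof.
  assert (A := amom_0_lower L ltac:(lra)); assert (B := amom_0_le).
  assert (0 < / sqrt L) by (apply Rinv_0_lt_compat, sqrt_lt_R0; lra); unfold Rdiv in *; lra.
Qed.

Lemma mom_0_gt_0 : 0 < mom L 0.
Proof.
  eapply Rlt_le_trans; [| apply mom_0_pos].
  apply Rdiv_lt_0_compat; [lra | apply sqrt_lt_R0; lra].
Qed.

Definition nmom (k : nat) : R := mom L k / mom L 0.

Lemma amom_le_norm p c : amom L p <= c * ep ^ p * amom L 0 -> 0 <= c ->
  amom L p <= 1011 / 1000 * c * ep ^ p * mom L 0.
Proof.
  intros H Hc; assert (E := ep_range); eapply Rle_trans; [exact H |].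
  replace (1011 / 1000 * c * ep ^ p * mom L 0) with (c * ep ^ p * (1011 / 1000 * mom L 0)) by ring.
  apply Rmult_le_compat_l; [apply Rmult_le_pos; [auto | apply pow_le; lra] | apply amom_0_le].
Qed.

Lemma amom_norm_bounds :
  amom L 1 <= 56 / 100 * ep * mom L 0 /\ amom L 2 <= 97 / 100 * ep ^ 2 * mom L 0 /\
  amom L 3 <= 295 / 100 * ep ^ 3 * mom L 0 /\ amom L 4 <= 133 / 10 * ep ^ 4 * mom L 0 /\
  amom L 5 <= 82 * ep ^ 5 * mom L 0.
Proof.
  destruct amom_ratios as (A1 & A2 & A3 & A4 & A5); assert (E := ep_range); assert (P := mom_0_gt_0).
  assert (G : forall p c k, amom L p <= c * ep ^ p * amom L 0 -> 0 <= c -> 1011 / 1000 * c <= k ->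
    amom L p <= k * ep ^ p * mom L 0).
  { intros p c k H Hc Hk; eapply Rle_trans; [exact (amom_le_norm p c H Hc) |].
    rewrite !(Rmult_assoc _ (ep ^ p)); apply Rmult_le_compat_r; [apply Rmult_le_pos; [apply pow_le |]; lra | auto]. }
  rewrite <- (pow_1 ep) at 1.
  split; [apply (G 1%nat (552 / 1000)); [exact A1 | lra | lra] |].
  split; [apply (G 2%nat (9583 / 10000)); [exact A2 | lra | lra] |].
  split; [apply (G 3%nat (29171 / 10000)); [exact A3 | lra | lra] |].
  split; [apply (G 4%nat (13116 / 1000)); [exact A4 | lra | lra] |].
  apply (G 5%nat (8024 / 100)); [exact A5 | lra | lra].
Qed.

Lemma nmom_even_bound p c : amom L p <= c * mom L 0 -> Rabs (nmom (2 * p)) <= c.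
Proof.
  intros H; assert (P := mom_0_gt_0); unfold nmom, Rdiv.
  rewrite Rabs_mult, Rabs_inv, (Rabs_pos_eq (mom L 0)) by lra.
  apply Rmult_le_reg_r with (mom L 0); [auto |]; rewrite Rmult_assoc, Rinv_l, Rmult_1_r by lra.
  eapply Rle_trans; [| exact H].
  rewrite mom_even, Rabs_mult, <- RPow_abs.
  replace (Rabs (-1)) with 1 by (rewrite Rabs_left; lra); rewrite pow1, Rmult_1_l.
  rewrite <- (Rmult_1_l (amom L p)); apply Int_cos_bound; [intros; apply pow_continuous |].
  intros u _; rewrite Rabs_pos_eq; [lra | rewrite pow_mult; apply pow_le, pow2_ge_0].
Qed.

(** An odd moment contains [sin (kphase L u)], of size at most [L |u|^3]; this makes it comparable
    to [L] times the even moment of order [2 p + 4]. *)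
Lemma nmom_odd_bound p c : L * amom L (p + 2) <= c * mom L 0 -> Rabs (nmom (2 * p + 1)) <= c.
Proof.
  intros H; assert (P := mom_0_gt_0); unfold nmom, Rdiv.
  rewrite Rabs_mult, Rabs_inv, (Rabs_pos_eq (mom L 0)) by lra.
  apply Rmult_le_reg_r with (mom L 0); [auto |]; rewrite Rmult_assoc, Rinv_l, Rmult_1_r by lra.
  eapply Rle_trans; [| exact H].
  rewrite mom_odd, Rabs_mult, <- RPow_abs.
  replace (Rabs (-1)) with 1 by (rewrite Rabs_left; lra); rewrite pow1, Rmult_1_l.
  rewrite <- (Rmult_1_l (L * amom L (p + 2))); apply Int_sin_bound; [lra | intros; apply pow_continuous |].
  intros u _; rewrite <- RPow_abs; lra.
Qed.

Lemma nmom_bounds :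
  Rabs (nmom 1) <= 97 / 100 * ep /\ Rabs (nmom 2) <= 56 / 100 * ep /\ Rabs (nmom 3) <= 295 / 100 * ep ^ 2 /\
  Rabs (nmom 4) <= 97 / 100 * ep ^ 2 /\ Rabs (nmom 5) <= 133 / 10 * ep ^ 3 /\ Rabs (nmom 6) <= 295 / 100 * ep ^ 3 /\
  Rabs (nmom 8) <= 14 * ep ^ 4.
Proof.
  destruct amom_norm_bounds as (A1 & A2 & A3 & A4 & A5); assert (P := mom_0_gt_0); assert (E := ep_range).
  assert (Odd : forall p k n, amom L (p + 2) <= k * ep ^ S n * mom L 0 -> Rabs (nmom (2 * p + 1)) <= k * ep ^ n).
  { intros p k n H; apply nmom_odd_bound.
    apply Rle_trans with (L * (k * ep ^ S n * mom L 0)); [apply Rmult_le_compat_l; lra |].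
    replace (L * (k * ep ^ S n * mom L 0)) with ((L * ep) * (k * ep ^ n * mom L 0)) by (simpl; ring).
    rewrite L_ep; lra. }
  rewrite <- (pow_1 ep) at 1.
  split; [exact (Odd 0%nat _ 1%nat A2) |].
  split; [exact (nmom_even_bound 1 _ A1) |].
  split; [exact (Odd 1%nat _ 2%nat A3) |].
  split; [exact (nmom_even_bound 2 _ A2) |].
  split; [exact (Odd 2%nat _ 3%nat A4) |].
  split; [exact (nmom_even_bound 3 _ A3) |].
  apply (nmom_even_bound 4); eapply Rle_trans; [exact A4 |].
  apply Rmult_le_compat_r; [lra |]; apply Rmult_le_compat_r; [apply pow_le |]; lra.
Qed.

End NormalisedMoments.

Lemma exp_le_mono a b : a <= b -> exp a <= exp b.
Proof. intros [H | ->]; [left; now apply exp_increasing | lra]. Qed.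

(** From [y <= exp (y - 1)] at [y = L / 140]. Comparisons of powers of [L] with exponentials thus
    reduce to the value 140. *)
Lemma pow_le_exp_140 L c n : 140 <= L -> INR n <= 140 * c -> L ^ n <= 140 ^ n * exp (c * (L - 140)).
Proof.
  intros HL Hn.
  assert (H : L / 140 <= exp (L / 140 - 1)) by (generalize (exp_ineq1_le (L / 140 - 1)); lra).
  replace (L ^ n) with (140 ^ n * (L / 140) ^ n) by (rewrite <- Rpow_mult_distr; f_equal; field).
  apply Rmult_le_compat_l; [apply pow_le; lra |].
  apply Rle_trans with (exp (L / 140 - 1) ^ n); [apply pow_incr; split; [lra | auto] |].
  rewrite <- exp_pow; apply exp_le_mono.
  replace (c * (L - 140)) with ((140 * c) * (L / 140 - 1)) by field.
  apply Rmult_le_compat_r; lra.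
Qed.

(** A factorial in binary, so that values such as that of 44 can be computed. *)
Fixpoint zfact (n : nat) : Z := match n with O => 1%Z | S m => (Z.of_nat (S m) * zfact m)%Z end.

Lemma INR_fact n : INR (fact n) = IZR (zfact n).
Proof.
  induction n as [| n IH]; [reflexivity |].
  rewrite fact_simpl, mult_INR, IH, INR_IZR_INZ, <- mult_IZR; reflexivity.
Qed.

Lemma cos_taylor a : -2 <= a <= 2 ->
  Rabs (cos a - (1 - a ^ 2 / 2 + a ^ 4 / 24 - a ^ 6 / 720)) <= / 40320 * a ^ (2 * 4).
Proof.
  intros Ha; destruct (pre_cos_bound a 1 ltac:(lra) ltac:(lra)) as [H1 H2].
  unfold cos_approx, cos_term in H1, H2; cbn [sum_f_R0 Nat.mul Nat.add] in H1, H2.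
  rewrite !INR_fact in H1, H2.
  change (zfact 0) with 1%Z in *; change (zfact 2) with 2%Z in *; change (zfact 4) with 24%Z in *;
    change (zfact 6) with 720%Z in *.
  assert (H : 0 <= a ^ 8) by (replace (a ^ 8) with ((a ^ 4) ^ 2) by ring; apply pow2_ge_0).
  replace (INR (fact 8)) with 40320 in H2 by (rewrite INR_fact; reflexivity).
  apply Rabs_le; change (2 * 4)%nat with 8%nat; lra.
Qed.

Lemma sin_taylor a : -2 <= a <= 2 ->
  Rabs (sin a - (a - a ^ 3 / 6 + a ^ 5 / 120)) <= / 5040 * Rabs a ^ 7.
Proof.
  assert (P : forall a, 0 <= a <= 2 -> Rabs (sin a - (a - a ^ 3 / 6 + a ^ 5 / 120)) <= / 5040 * a ^ 7).
  { intros b Hb; assert (HP := PI2_3_2).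
    destruct (pre_sin_bound b 0 ltac:(lra) ltac:(lra)) as [_ H2].
    destruct (pre_sin_bound b 1 ltac:(lra) ltac:(lra)) as [H1 _].
    unfold sin_approx, sin_term in H1, H2; cbn [sum_f_R0 Nat.mul Nat.add] in H1, H2.
    rewrite ?(INR_fact 1), ?(INR_fact 3), ?(INR_fact 5), ?(INR_fact 7) in H1, H2.
    change (zfact 1) with 1%Z in *; change (zfact 3) with 6%Z in *; change (zfact 5) with 120%Z in *.
    assert (H : 0 <= b ^ 7) by (apply pow_le; lra).
    replace (INR (fact 7)) with 5040 in H1 by (rewrite INR_fact; reflexivity).
    apply Rabs_le; lra. }
  intros Ha; destruct (Rle_lt_dec 0 a) as [H | H]; [rewrite (Rabs_pos_eq a H); apply P; lra |].
  rewrite (Rabs_left a H), <- Rabs_Ropp.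
  replace (- (sin a - (a - a ^ 3 / 6 + a ^ 5 / 120)))
    with (sin (- a) - ((- a) - (- a) ^ 3 / 6 + (- a) ^ 5 / 120)) by (rewrite sin_neg; field).
  apply P; lra.
Qed.

Section NormalisedSystem.

Variable L : R.
Hypothesis HL : 140 <= L.

Lemma mom_rec_error k : (k <= 6)%nat ->
  Rabs (/ L * ((INR k * mom L (k - 1) + 2 * (INR k + 1) * mom L k
    + (INR k + 2 + 2 * L) * mom L (S k) + L * mom L (S (S k))) / mom L 0)) <= (/ L) ^ 8.
Proof.
  intros Hk.
  assert (P := mom_0_pos L HL); assert (P0 := mom_0_gt_0 L HL).
  assert (R := mom_rec L k).
  set (X := INR k * mom L (k - 1) + 2 * (INR k + 1) * mom L k
    + (INR k + 2 + 2 * L) * mom L (S k) + L * mom L (S (S k))) in *.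
  assert (H2 : 2 ^ k <= 64) by (replace 64 with (2 ^ 6) by ring; apply Rle_pow; [lra | auto]).
  assert (He := exp_pos (- (4 / 5 * L))).
  assert (RX : Rabs X <= 640 * exp (- (4 / 5 * L))) by nra.
  assert (HsL : sqrt L <= L).
  { rewrite <- (sqrt_pow2 L) at 2 by lra; apply sqrt_le_1_alt; nra. }
  assert (Hs0 : 0 < sqrt L) by (apply sqrt_lt_R0; lra).
  assert (Q : / mom L 0 <= 2 * L).
  { apply Rle_trans with (/ (65 / 100 / sqrt L)).
    - apply Rinv_le_contravar; [apply Rdiv_lt_0_compat; lra | auto].
    - replace (/ (65 / 100 / sqrt L)) with (100 / 65 * sqrt L) by (field; lra); lra. }
  assert (G : 1280 * exp (- (4 / 5 * L)) <= (/ L) ^ 8).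
  { rewrite exp_Ropp, pow_inv.
    apply Rmult_le_reg_l with (L ^ 8); [apply pow_lt; lra |].
    rewrite Rinv_r by (apply pow_nonzero; lra).
    assert (B := pow_le_exp_140 L (4 / 5) 8 HL ltac:(simpl; lra)).
    assert (E : exp (4 / 5 * L) = exp (4 / 5 * (L - 140)) * exp 1 ^ 112).
    { rewrite <- exp_pow, <- exp_plus; f_equal; simpl; field. }
    assert (E1 : 2 ^ 112 <= exp 1 ^ 112) by (apply pow_incr; generalize (exp_ineq1_le 1); lra).
    assert (E2 : 0 < exp (4 / 5 * (L - 140))) by apply exp_pos.
    rewrite E; apply Rmult_le_reg_r with (exp (4 / 5 * (L - 140)) * exp 1 ^ 112).
    { apply Rmult_lt_0_compat; [auto | apply pow_lt, exp_pos]. }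
    replace (L ^ 8 * (1280 * / (exp (4 / 5 * (L - 140)) * exp 1 ^ 112)) * (exp (4 / 5 * (L - 140)) * exp 1 ^ 112))
      with (1280 * L ^ 8) by (field; split; apply Rgt_not_eq; [apply exp_pos | exact E2]).
    rewrite Rmult_1_l.
    apply Rle_trans with (1280 * (140 ^ 8 * exp (4 / 5 * (L - 140)))); [lra |].
    apply Rle_trans with (exp (4 / 5 * (L - 140)) * 2 ^ 112); [| apply Rmult_le_compat_l; lra].
    replace (1280 * (140 ^ 8 * exp (4 / 5 * (L - 140)))) with (exp (4 / 5 * (L - 140)) * (1280 * 140 ^ 8)) by ring.
    apply Rmult_le_compat_l; lra. }
  unfold Rdiv; rewrite !Rabs_mult, (Rabs_pos_eq (/ L)), (Rabs_pos_eq (/ mom L 0))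
    by (left; apply Rinv_0_lt_compat; lra).
  apply Rle_trans with (/ L * ((640 * exp (- (4 / 5 * L))) * (2 * L))).
  - apply Rmult_le_compat_l; [left; apply Rinv_0_lt_compat; lra |].
    apply Rmult_le_compat; auto; [apply Rabs_pos | left; apply Rinv_0_lt_compat; lra].
  - eapply Rle_trans; [| exact G]; right; field; lra.
Qed.

Lemma nmom_invariant : let e := nmom L in
  e 6%nat - 6 * e 5%nat * e 1%nat + 15 * e 4%nat * e 2%nat - 10 * e 3%nat ^ 2
    >= - (15 / 2) * (/ L) ^ 3 + 50 * (/ L) ^ 4.
Proof.
  intros e; assert (P0 := mom_0_gt_0 L HL); assert (E := ep_range L HL).
  set (b := fun k => / L * ((INR k * mom L (k - 1) + 2 * (INR k + 1) * mom L k
    + (INR k + 2 + 2 * L) * mom L (S k) + L * mom L (S (S k))) / mom L 0)).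
  assert (Hb : forall k, (k <= 6)%nat -> Rabs (b k) <= (/ L) ^ 8) by (intros; now apply mom_rec_error).
  assert (He : e 0%nat = 1) by (unfold e, nmom; field; lra).
  assert (Hr : forall k, e (S (S k)) = - (INR k * / L * e (k - 1)%nat + 2 * (INR k + 1) * / L * e k
     + ((INR k + 2) * / L + 2) * e (S k)) + b k).
  { intros k; unfold e, b, nmom; field; lra. }
  destruct (nmom_bounds L HL) as (_ & _ & _ & _ & _ & _ & B8).
  apply (moment_invariant (/ L) (e 1%nat) (e 2%nat) (e 3%nat) (e 4%nat) (e 5%nat) (e 6%nat) (e 7%nat) (e 8%nat)
    (b 0%nat) (b 1%nat) (b 2%nat) (b 3%nat) (b 4%nat) (b 5%nat) (b 6%nat)); try assumption; try (apply Hb; lia).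
  - rewrite (Hr 0%nat), He; simpl; ring.
  - rewrite (Hr 1%nat); simpl Nat.sub; rewrite He; simpl; ring.
  - rewrite (Hr 2%nat); simpl; ring.
  - rewrite (Hr 3%nat); simpl; ring.
  - rewrite (Hr 4%nat); simpl; ring.
  - rewrite (Hr 5%nat); simpl; ring.
  - rewrite (Hr 6%nat); simpl; ring.
Qed.

(** * Taylor expansion of the saddle point integral *)

Definition kint (t : R) : R := Int (fun u => fst (ker L u * Cexp (RtoC t * ivar u))%C) (-2) 2.
Definition kint_even (t : R) : R := Int (fun u => cos (t * u) * (kabs L u * cos (kphase L u))) (-2) 2.
Definition kint_odd (t : R) : R := Int (fun u => sin (t * u) * (kabs L u * sin (kphase L u))) (-2) 2.

Lemma cos_lin_continuous t u : continuous (fun u => cos (t * u)) u.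
Proof. apply (ex_derive_continuous (fun u => cos (t * u))); auto_derive; auto. Qed.

Lemma sin_lin_continuous t u : continuous (fun u => sin (t * u)) u.
Proof. apply (ex_derive_continuous (fun u => sin (t * u))); auto_derive; auto. Qed.

Lemma kint_split t : kint t = kint_even t - kint_odd t.
Proof.
  unfold kint, kint_even, kint_odd; rewrite <- Int_sub.
  - apply Int_ext; intros u; rewrite ker_polar; unfold Cexp, ivar, Ci, RtoC, Cmult; cbn [fst snd].
    replace (t * (0 * u - 1 * 0) - 0 * (0 * 0 + 1 * u)) with 0 by ring.
    replace (t * (0 * 0 + 1 * u) + 0 * (0 * u - 1 * 0)) with (t * u) by ring.
    rewrite exp_0; ring.
  - intros; apply continuous_mul; [apply cos_lin_continuous | apply kcos_continuous].
  - intros; apply continuous_mul; [apply sin_lin_continuous | apply ksin_continuous].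
Qed.

(** The cosine is expanded to order 6, since the remainder then meets the absolute moment of order
    8, which is [O (L^-4)]. The odd part can stop at order 5, its remainder meeting [L] times the
    moment of order 10. *)
Lemma kint_even_expansion t : -1 <= t <= 1 ->
  Rabs (kint_even t / mom L 0 - (1 + t ^ 2 / 2 * nmom L 2 + t ^ 4 / 24 * nmom L 4 + t ^ 6 / 720 * nmom L 6))
    <= 133 / 10 / 40320 * t ^ 8 * (/ L) ^ 4.
Proof.
  intros Ht; assert (P0 := mom_0_gt_0 L HL).
  destruct (amom_norm_bounds L HL) as (_ & _ & _ & A4 & _).
  assert (E := ep_range L HL).
  set (g := fun u => cos (t * u) - (1 - (t * u) ^ 2 / 2 + (t * u) ^ 4 / 24 - (t * u) ^ 6 / 720)).
  assert (Cg : forall u, continuous g u).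
  { intros u; apply (ex_derive_continuous g); unfold g; auto_derive; auto. }
  assert (EI : kint_even t - (mom L 0 + t ^ 2 / 2 * mom L 2 + t ^ 4 / 24 * mom L 4 + t ^ 6 / 720 * mom L 6)
     = Int (fun u => g u * (kabs L u * cos (kphase L u))) (-2) 2).
  { assert (CP : forall p u, continuous (fun u => u ^ p * (kabs L u * cos (kphase L u))) u).
    { intros; apply continuous_mul; [apply pow_continuous | apply kcos_continuous]. }
    change (mom L 0) with (mom L (2 * 0)); change (mom L 2) with (mom L (2 * 1));
      change (mom L 4) with (mom L (2 * 2)); change (mom L 6) with (mom L (2 * 3)).
    rewrite !mom_even; unfold kint_even.
    set (I := fun p => Int (fun u => u ^ p * (kabs L u * cos (kphase L u))) (-2) 2).
    fold (I (2 * 0)%nat) (I (2 * 1)%nat) (I (2 * 2)%nat) (I (2 * 3)%nat).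
    rewrite (Int_ext (fun u => g u * (kabs L u * cos (kphase L u)))
      (fun u => (((cos (t * u) * (kabs L u * cos (kphase L u)) - u ^ (2 * 0) * (kabs L u * cos (kphase L u)))
        + t ^ 2 / 2 * (u ^ (2 * 1) * (kabs L u * cos (kphase L u))))
        - t ^ 4 / 24 * (u ^ (2 * 2) * (kabs L u * cos (kphase L u))))
        + t ^ 6 / 720 * (u ^ (2 * 3) * (kabs L u * cos (kphase L u)))))
      by (intros u; unfold g; simpl; field).
    assert (C0 : forall u, continuous (fun u => cos (t * u) * (kabs L u * cos (kphase L u))) u).
    { intros; apply continuous_mul; [apply cos_lin_continuous | apply kcos_continuous]. }
    assert (CS : forall c p u, continuous (fun u => c * (u ^ p * (kabs L u * cos (kphase L u)))) u).
    { intros; apply continuous_smul, CP. }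
    rewrite Int_add, Int_sub, Int_add, Int_sub, !Int_scal; auto.
    - unfold I; simpl; field.
    - intros; apply continuous_sub; auto.
    - intros; apply continuous_add; [apply continuous_sub; auto | auto].
    - intros; apply continuous_sub; [apply continuous_add; [apply continuous_sub; auto | auto] | auto]. }
  assert (B := Int_cos_bound L g (/ 40320 * t ^ 8) 4 Cg).
  rewrite <- EI in B.
  replace (kint_even t / mom L 0 - (1 + t ^ 2 / 2 * nmom L 2 + t ^ 4 / 24 * nmom L 4 + t ^ 6 / 720 * nmom L 6))
    with ((kint_even t - (mom L 0 + t ^ 2 / 2 * mom L 2 + t ^ 4 / 24 * mom L 4 + t ^ 6 / 720 * mom L 6)) * / mom L 0)
    by (unfold nmom; field; lra).
  rewrite Rabs_mult, (Rabs_pos_eq (/ mom L 0)) by (left; apply Rinv_0_lt_compat; auto).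
  apply Rmult_le_reg_r with (mom L 0); [auto |]; rewrite Rmult_assoc, Rinv_l, Rmult_1_r by lra.
  assert (T8 : 0 <= t ^ 8) by (replace (t ^ 8) with ((t ^ 4) ^ 2) by ring; apply pow2_ge_0).
  eapply Rle_trans; [apply B |].
  - intros u Hu; unfold g; eapply Rle_trans; [apply cos_taylor; nra |].
    rewrite Rpow_mult_distr; right; change (2 * 4)%nat with 8%nat; ring.
  - apply Rle_trans with (/ 40320 * t ^ 8 * (133 / 10 * (/ L) ^ 4 * mom L 0)); [| right; field; lra].
    apply Rmult_le_compat_l; [lra | auto].
Qed.

Lemma kint_odd_expansion t : -1 <= t <= 1 ->
  Rabs (kint_odd t / mom L 0 + (t * nmom L 1 + t ^ 3 / 6 * nmom L 3 + t ^ 5 / 120 * nmom L 5))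
    <= 82 / 5040 * Rabs t ^ 7 * (/ L) ^ 4.
Proof.
  intros Ht; assert (P0 := mom_0_gt_0 L HL).
  destruct (amom_norm_bounds L HL) as (_ & _ & _ & _ & A5).
  assert (E := ep_range L HL).
  set (g := fun u => sin (t * u) - (t * u - (t * u) ^ 3 / 6 + (t * u) ^ 5 / 120)).
  assert (Cg : forall u, continuous g u).
  { intros u; apply (ex_derive_continuous g); unfold g; auto_derive; auto. }
  assert (EI : kint_odd t + (t * mom L 1 + t ^ 3 / 6 * mom L 3 + t ^ 5 / 120 * mom L 5)
     = Int (fun u => g u * (kabs L u * sin (kphase L u))) (-2) 2).
  { assert (CP : forall p u, continuous (fun u => u ^ p * (kabs L u * sin (kphase L u))) u).
    { intros; apply continuous_mul; [apply pow_continuous | apply ksin_continuous]. }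
    change (mom L 1) with (mom L (2 * 0 + 1)); change (mom L 3) with (mom L (2 * 1 + 1));
      change (mom L 5) with (mom L (2 * 2 + 1)).
    rewrite !mom_odd; unfold kint_odd.
    set (I := fun p => Int (fun u => u ^ p * (kabs L u * sin (kphase L u))) (-2) 2).
    fold (I (2 * 0 + 1)%nat) (I (2 * 1 + 1)%nat) (I (2 * 2 + 1)%nat).
    rewrite (Int_ext (fun u => g u * (kabs L u * sin (kphase L u)))
      (fun u => ((sin (t * u) * (kabs L u * sin (kphase L u)) - t * (u ^ (2 * 0 + 1) * (kabs L u * sin (kphase L u))))
        + t ^ 3 / 6 * (u ^ (2 * 1 + 1) * (kabs L u * sin (kphase L u))))
        - t ^ 5 / 120 * (u ^ (2 * 2 + 1) * (kabs L u * sin (kphase L u)))))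
      by (intros u; unfold g; simpl; field).
    assert (C0 : forall u, continuous (fun u => sin (t * u) * (kabs L u * sin (kphase L u))) u).
    { intros; apply continuous_mul; [apply sin_lin_continuous | apply ksin_continuous]. }
    assert (CS : forall c p u, continuous (fun u => c * (u ^ p * (kabs L u * sin (kphase L u)))) u).
    { intros; apply continuous_smul, CP. }
    rewrite Int_sub, Int_add, Int_sub, !Int_scal; auto.
    - unfold I; simpl; field.
    - intros; apply continuous_sub; auto.
    - intros; apply continuous_add; [apply continuous_sub; auto | auto]. }
  assert (B := Int_sin_bound L g (/ 5040 * Rabs t ^ 7) 3 ltac:(lra) Cg).
  rewrite <- EI in B.
  replace (kint_odd t / mom L 0 + (t * nmom L 1 + t ^ 3 / 6 * nmom L 3 + t ^ 5 / 120 * nmom L 5))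
    with ((kint_odd t + (t * mom L 1 + t ^ 3 / 6 * mom L 3 + t ^ 5 / 120 * mom L 5)) * / mom L 0)
    by (unfold nmom; field; lra).
  rewrite Rabs_mult, (Rabs_pos_eq (/ mom L 0)) by (left; apply Rinv_0_lt_compat; auto).
  apply Rmult_le_reg_r with (mom L 0); [auto |]; rewrite Rmult_assoc, Rinv_l, Rmult_1_r by lra.
  assert (T7 : 0 <= Rabs t ^ 7) by (apply pow_le, Rabs_pos).
  eapply Rle_trans; [apply B |].
  - intros u Hu; unfold g; eapply Rle_trans; [apply sin_taylor; nra |].
    rewrite Rabs_mult, Rpow_mult_distr; right; change (2 * 3 + 1)%nat with 7%nat; ring.
  - apply Rle_trans with (/ 5040 * Rabs t ^ 7 * (L * (82 * (/ L) ^ 5 * mom L 0))); [| right; field; lra].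
    apply Rmult_le_compat_l; [lra |]; apply Rmult_le_compat_l; [lra | exact A5].
Qed.

End NormalisedSystem.

(** * From coefficients to the inequality *)

Lemma Rabs_mul_le a b A B : Rabs a <= A -> Rabs b <= B -> Rabs (a * b) <= A * B.
Proof. intros; rewrite Rabs_mult; apply Rmult_le_compat; auto using Rabs_pos. Qed.

Lemma Rabs_add_le a b A B : Rabs a <= A -> Rabs b <= B -> Rabs (a + b) <= A + B.
Proof. intros; eapply Rle_trans; [apply Rabs_triang | lra]. Qed.

(** [P] and [Q] are the even and odd parts in the shift, so the product of two coefficients
    symmetric about the centre is close to [P^2 - Q^2]. The odd error [zeta] may be much larger than
    [eta], because to first order it is multiplied by the small [Q]. *)
Lemma conjugate_product P Q eta zeta r s T :
  0 <= T <= 1 / 1000 -> Rabs (P - 1) <= 1 / 1000 -> Rabs Q <= 1 / 1000 ->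
  Rabs eta <= 1 / 1000 * T -> Rabs zeta <= 26 / 100 * T -> Rabs r <= 1 / 5 * T -> Rabs s <= 1 / 5 * T ->
  Rabs ((P + eta - (Q + zeta) + r) * (P + eta + (Q + zeta) + s) - (P ^ 2 - Q ^ 2)) <= 42 / 100 * T.
Proof.
  intros HT HP HQ He Hz Hr Hs.
  apply Rabs_le_between in HP; apply Rabs_le_between in He; apply Rabs_le_between in Hz;
    apply Rabs_le_between in Hr; apply Rabs_le_between in Hs.
  assert (HP2 : Rabs P <= 1001 / 1000) by (apply Rabs_le; lra).
  assert (Hu : Rabs (eta - zeta + r) <= 47 / 100 * T) by (apply Rabs_le; lra).
  assert (Hv : Rabs (eta + zeta + s) <= 47 / 100 * T) by (apply Rabs_le; lra).
  assert (Hp : Rabs (2 * eta + r + s) <= 402 / 1000 * T) by (apply Rabs_le; lra).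
  assert (Hq : Rabs (r - s - 2 * zeta) <= 92 / 100 * T) by (apply Rabs_le; lra).
  replace ((P + eta - (Q + zeta) + r) * (P + eta + (Q + zeta) + s) - (P ^ 2 - Q ^ 2))
    with (P * (2 * eta + r + s) + Q * (r - s - 2 * zeta) + (eta - zeta + r) * (eta + zeta + s)) by ring.
  eapply Rle_trans.
  - apply Rabs_add_le; [apply Rabs_add_le; apply Rabs_mul_le; eassumption | apply Rabs_mul_le; eassumption].
  - nra.
Qed.

Section Sextic.

Variables x ep e1 e2 e3 e4 e5 e6 : R.
Hypothesis Hep : 0 < ep <= 1 / 140.
Hypothesis Hx : 0 < x <= ep.
Hypothesis B1 : Rabs e1 <= 97 / 100 * ep.
Hypothesis B2 : Rabs e2 <= 56 / 100 * ep.
Hypothesis B3 : Rabs e3 <= 295 / 100 * ep ^ 2.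
Hypothesis B4 : Rabs e4 <= 97 / 100 * ep ^ 2.
Hypothesis B5 : Rabs e5 <= 133 / 10 * ep ^ 3.
Hypothesis B6 : Rabs e6 <= 295 / 100 * ep ^ 3.
Hypothesis Inv : e6 - 6 * e5 * e1 + 15 * e4 * e2 - 10 * e3 ^ 2 >= - (15 / 2) * ep ^ 3 + 50 * ep ^ 4.

(** The unit in which all errors are counted; [main_part_lower] leaves a margin of [49 T]. *)
Let T := x ^ 6 * ep ^ 4.
Let P t := 1 + (t * x) ^ 2 / 2 * e2 + (t * x) ^ 4 / 24 * e4 + (t * x) ^ 6 / 720 * e6.
Let Q t := - (t * x * e1 + (t * x) ^ 3 / 6 * e3 + (t * x) ^ 5 / 120 * e5).

Lemma T_pos : 0 < T <= 1 / 1000.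
Proof.
  unfold T; assert (0 < x ^ 6) by (apply pow_lt; lra); assert (0 < ep ^ 4) by (apply pow_lt; lra).
  assert (x ^ 6 <= 1) by (rewrite <- (pow1 6); apply pow_incr; lra).
  assert (ep ^ 4 <= (1 / 140) ^ 4) by (apply pow_incr; lra).
  split; [nra |]; apply Rle_trans with (1 * (1 / 140) ^ 4); [apply Rmult_le_compat; lra | lra].
Qed.

Let X2 := x ^ 2 / 2 * e2.
Let X4 := x ^ 4 / 24 * e4.
Let X6 := x ^ 6 / 720 * e6.
Let Y1 := x * e1.
Let Y3 := x ^ 3 / 6 * e3.
Let Y5 := x ^ 5 / 120 * e5.

Lemma P_coeffs t : P t = 1 + t ^ 2 * X2 + t ^ 4 * X4 + t ^ 6 * X6.
Proof. unfold P, X2, X4, X6; field. Qed.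

Lemma Q_coeffs t : Q t = - (t * Y1 + t ^ 3 * Y3 + t ^ 5 * Y5).
Proof. unfold Q, Y1, Y3, Y5; field. Qed.

Lemma coeff_bounds :
  Rabs X2 <= 28 / 100 * x ^ 2 * ep /\ Rabs X4 <= 41 / 1000 * x ^ 4 * ep ^ 2 /\ Rabs X6 <= 41 / 10000 * x ^ 6 * ep ^ 3 /\
  Rabs Y1 <= 97 / 100 * x * ep /\ Rabs Y3 <= 50 / 100 * x ^ 3 * ep ^ 2 /\ Rabs Y5 <= 111 / 1000 * x ^ 5 * ep ^ 3.
Proof.
  assert (G : forall n c e k d, 0 <= c -> 0 <= d -> Rabs e <= d -> c * d <= k -> Rabs (x ^ n * c * e) <= k * x ^ n).
  { intros n c e k d Hc Hd He Hk; assert (0 < x ^ n) by (apply pow_lt; lra).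
    rewrite !Rabs_mult, (Rabs_pos_eq (x ^ n)), (Rabs_pos_eq c) by lra.
    assert (c * Rabs e <= c * d) by (apply Rmult_le_compat_l; auto); nra. }
  assert (0 < ep ^ 2) by (apply pow_lt; lra); assert (0 < ep ^ 3) by (apply pow_lt; lra).
  unfold X2, X4, X6, Y1, Y3, Y5.
  repeat split.
  - eapply Rle_trans; [apply (G 2%nat (/ 2) e2 (28 / 100 * ep) (56 / 100 * ep)); auto; lra | right; ring].
  - eapply Rle_trans; [apply (G 4%nat (/ 24) e4 (41 / 1000 * ep ^ 2) (97 / 100 * ep ^ 2)); auto; lra | right; ring].
  - eapply Rle_trans; [apply (G 6%nat (/ 720) e6 (41 / 10000 * ep ^ 3) (295 / 100 * ep ^ 3)); auto; lra | right; ring].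
  - replace (x * e1) with (x ^ 1 * 1 * e1) by ring.
    eapply Rle_trans; [apply (G 1%nat 1 e1 (97 / 100 * ep) (97 / 100 * ep)); auto; lra | right; ring].
  - eapply Rle_trans; [apply (G 3%nat (/ 6) e3 (50 / 100 * ep ^ 2) (295 / 100 * ep ^ 2)); auto; lra | right; ring].
  - eapply Rle_trans; [apply (G 5%nat (/ 120) e5 (111 / 1000 * ep ^ 3) (133 / 10 * ep ^ 3)); auto; lra | right; ring].
Qed.

Lemma small_coeffs :
  Rabs X2 <= 2 / 100000 * ep /\ Rabs X4 <= 1 / 1000000 * ep /\ Rabs X6 <= 1 / 1000000 * ep /\
  Rabs Y1 <= 1 / 100 * ep /\ Rabs Y3 <= 1 / 1000000 * ep /\ Rabs Y5 <= 1 / 1000000 * ep.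
Proof.
  destruct coeff_bounds as (C2 & C4 & C6 & D1 & D3 & D5).
  assert (G : forall c n m k, 0 <= c -> c * (1 / 140) ^ n * (1 / 140) ^ m <= k -> c * x ^ n * ep ^ S m <= k * ep).
  { intros c n m k Hc Hk.
    replace (c * x ^ n * ep ^ S m) with ((c * x ^ n * ep ^ m) * ep) by (simpl; ring).
    apply Rmult_le_compat_r; [lra |]; eapply Rle_trans; [| exact Hk].
    assert (0 < x ^ n) by (apply pow_lt; lra); assert (0 < ep ^ m) by (apply pow_lt; lra).
    assert (x ^ n <= (1 / 140) ^ n) by (apply pow_incr; lra).
    assert (ep ^ m <= (1 / 140) ^ m) by (apply pow_incr; lra).
    rewrite !Rmult_assoc; apply Rmult_le_compat_l; [auto |]; apply Rmult_le_compat; lra. }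
  assert (G1 := G (28 / 100) 2%nat 0%nat (2 / 100000) ltac:(lra) ltac:(lra)); rewrite pow_1 in G1.
  assert (G2 := G (41 / 1000) 4%nat 1%nat (1 / 1000000) ltac:(lra) ltac:(lra)).
  assert (G3 := G (41 / 10000) 6%nat 2%nat (1 / 1000000) ltac:(lra) ltac:(lra)).
  assert (G4 := G (97 / 100) 1%nat 0%nat (1 / 100) ltac:(lra) ltac:(lra)); rewrite !pow_1 in G4.
  assert (G5 := G (50 / 100) 3%nat 1%nat (1 / 1000000) ltac:(lra) ltac:(lra)).
  assert (G6 := G (111 / 1000) 5%nat 2%nat (1 / 1000000) ltac:(lra) ltac:(lra)).
  repeat split; lra.
Qed.

Lemma PQ_small t : 0 <= t <= 3 -> Rabs (P t - 1) <= 1 / 100 * ep /\ Rabs (Q t) <= 1 / 10 * ep.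
Proof.
  intros Ht; destruct small_coeffs as (C2 & C4 & C6 & D1 & D3 & D5).
  assert (Hp : forall n, 0 <= t ^ n <= 3 ^ n) by (intros n; split; [apply pow_le; lra | apply pow_incr; lra]).
  assert (M : forall n c k, Rabs c <= k -> Rabs (t ^ n * c) <= 3 ^ n * k).
  { intros n c k H; apply Rabs_mul_le; [rewrite Rabs_pos_eq; apply Hp | auto]. }
  rewrite P_coeffs, Q_coeffs, Rabs_Ropp; split.
  - replace (1 + t ^ 2 * X2 + t ^ 4 * X4 + t ^ 6 * X6 - 1) with (t ^ 2 * X2 + t ^ 4 * X4 + t ^ 6 * X6) by ring.
    eapply Rle_trans; [apply Rabs_add_le; [apply Rabs_add_le |]; apply M; eassumption | lra].
  - rewrite <- (pow_1 t) at 1.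
    eapply Rle_trans; [apply Rabs_add_le; [apply Rabs_add_le |]; apply M; eassumption | lra].
Qed.

(** [15 + 3^k - 6 * 2^k] is 10 for [k = 0], vanishes for [k = 2, 4], and is 360, 5040, 52920, 506880
    for [k = 6, 8, 10, 12]. The terms of degree 6 form the invariant; those of higher degree
    together stay below [T]. *)
Lemma main_part_lower :
  15 * (P 1 ^ 2 - Q 1 ^ 2) + (P 3 ^ 2 - Q 3 ^ 2) - 10 - 6 * (P 2 ^ 2 - Q 2 ^ 2)
    >= - (15 / 2) * x ^ 6 * ep ^ 3 + 49 * T.
Proof.
  destruct coeff_bounds as (C2 & C4 & C6 & D1 & D3 & D5).
  rewrite !P_coeffs, !Q_coeffs.
  assert (E : 15 * ((1 + 1 ^ 2 * X2 + 1 ^ 4 * X4 + 1 ^ 6 * X6) ^ 2 - (- (1 * Y1 + 1 ^ 3 * Y3 + 1 ^ 5 * Y5)) ^ 2)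
    + ((1 + 3 ^ 2 * X2 + 3 ^ 4 * X4 + 3 ^ 6 * X6) ^ 2 - (- (3 * Y1 + 3 ^ 3 * Y3 + 3 ^ 5 * Y5)) ^ 2) - 10
    - 6 * ((1 + 2 ^ 2 * X2 + 2 ^ 4 * X4 + 2 ^ 6 * X6) ^ 2 - (- (2 * Y1 + 2 ^ 3 * Y3 + 2 ^ 5 * Y5)) ^ 2)
    = 360 * (2 * X6 + 2 * X2 * X4 - Y3 ^ 2 - 2 * Y1 * Y5)
      + (5040 * (X4 * X4 + 2 * (X2 * X6) - 2 * (Y3 * Y5)) + 52920 * (2 * (X4 * X6) - Y5 * Y5) + 506880 * (X6 * X6))) by ring.
  rewrite E.
  assert (F : 360 * (2 * X6 + 2 * X2 * X4 - Y3 ^ 2 - 2 * Y1 * Y5)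
     = x ^ 6 * (e6 - 6 * e5 * e1 + 15 * e4 * e2 - 10 * e3 ^ 2)).
  { unfold X2, X4, X6, Y1, Y3, Y5; field. }
  rewrite F.
  assert (H6 : 0 < x ^ 6) by (apply pow_lt; lra).
  assert (M : x ^ 6 * (e6 - 6 * e5 * e1 + 15 * e4 * e2 - 10 * e3 ^ 2) >= x ^ 6 * (- (15 / 2) * ep ^ 3 + 50 * ep ^ 4)).
  { apply Rmult_ge_compat_l; lra. }
  assert (Err : Rabs (5040 * (X4 * X4 + 2 * (X2 * X6) - 2 * (Y3 * Y5)) + 52920 * (2 * (X4 * X6) - Y5 * Y5) + 506880 * (X6 * X6))
    <= T).
  { assert (K44 := Rabs_mul_le _ _ _ _ C4 C4); assert (K26 := Rabs_mul_le _ _ _ _ C2 C6).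
    assert (K35 := Rabs_mul_le _ _ _ _ D3 D5); assert (K46 := Rabs_mul_le _ _ _ _ C4 C6).
    assert (K55 := Rabs_mul_le _ _ _ _ D5 D5); assert (K66 := Rabs_mul_le _ _ _ _ C6 C6).
    assert (W : forall c n m, 0 <= c -> c * x ^ (2 + n) * ep ^ m * T <= c * (1 / 140) ^ (2 + n) * (1 / 140) ^ m * T).
    { intros c n m Hc; apply Rmult_le_compat_r; [generalize T_pos; lra |].
      assert (0 < x ^ (2 + n)) by (apply pow_lt; lra); assert (0 < ep ^ m) by (apply pow_lt; lra).
      assert (x ^ (2 + n) <= (1 / 140) ^ (2 + n)) by (apply pow_incr; lra).
      assert (ep ^ m <= (1 / 140) ^ m) by (apply pow_incr; lra).
      rewrite !Rmult_assoc; apply Rmult_le_compat_l; [auto |]; apply Rmult_le_compat; lra. }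
    replace (41 / 1000 * x ^ 4 * ep ^ 2 * (41 / 1000 * x ^ 4 * ep ^ 2)) with (1681 / 1000000 * x ^ (2 + 0) * ep ^ 0 * T) in K44 by (unfold T; simpl; field).
    replace (28 / 100 * x ^ 2 * ep * (41 / 10000 * x ^ 6 * ep ^ 3)) with (1148 / 1000000 * x ^ (2 + 0) * ep ^ 0 * T) in K26 by (unfold T; simpl; field).
    replace (50 / 100 * x ^ 3 * ep ^ 2 * (111 / 1000 * x ^ 5 * ep ^ 3)) with (555 / 10000 * x ^ (2 + 0) * ep ^ 1 * T) in K35 by (unfold T; simpl; field).
    replace (41 / 1000 * x ^ 4 * ep ^ 2 * (41 / 10000 * x ^ 6 * ep ^ 3)) with (1681 / 10000000 * x ^ (2 + 2) * ep ^ 1 * T) in K46 by (unfold T; simpl; field).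
    replace (111 / 1000 * x ^ 5 * ep ^ 3 * (111 / 1000 * x ^ 5 * ep ^ 3)) with (12321 / 1000000 * x ^ (2 + 2) * ep ^ 2 * T) in K55 by (unfold T; simpl; field).
    replace (41 / 10000 * x ^ 6 * ep ^ 3 * (41 / 10000 * x ^ 6 * ep ^ 3)) with (1681 / 100000000 * x ^ (2 + 4) * ep ^ 2 * T) in K66 by (unfold T; simpl; field).
    assert (L44 := Rle_trans _ _ _ K44 (W (1681 / 1000000) 0%nat 0%nat ltac:(lra))).
    assert (L26 := Rle_trans _ _ _ K26 (W (1148 / 1000000) 0%nat 0%nat ltac:(lra))).
    assert (L35 := Rle_trans _ _ _ K35 (W (555 / 10000) 0%nat 1%nat ltac:(lra))).
    assert (L46 := Rle_trans _ _ _ K46 (W (1681 / 10000000) 2%nat 1%nat ltac:(lra))).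
    assert (L55 := Rle_trans _ _ _ K55 (W (12321 / 1000000) 2%nat 2%nat ltac:(lra))).
    assert (L66 := Rle_trans _ _ _ K66 (W (1681 / 100000000) 4%nat 2%nat ltac:(lra))).
    simpl in L44, L26, L35, L46, L55, L66.
    apply Rabs_le_between in L44; apply Rabs_le_between in L26; apply Rabs_le_between in L35;
      apply Rabs_le_between in L46; apply Rabs_le_between in L55; apply Rabs_le_between in L66.
    assert (HT := T_pos); apply Rabs_le; lra. }
  apply Rabs_le_between in Err; unfold T in *; lra.
Qed.

Lemma main_sum_lower : 15 * (P 1 ^ 2 - Q 1 ^ 2) + (P 3 ^ 2 - Q 3 ^ 2) >= 16 - ep.
Proof.
  destruct (PQ_small 1 ltac:(lra)) as [P1 Q1]; destruct (PQ_small 3 ltac:(lra)) as [P3 Q3].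
  apply Rabs_le_between in P1; apply Rabs_le_between in P3.
  assert (S1 := Rabs_mul_le _ _ _ _ Q1 Q1); assert (S3 := Rabs_mul_le _ _ _ _ Q3 Q3).
  apply Rabs_le_between in S1; apply Rabs_le_between in S3.
  nra.
Qed.

(** Against [49 T] stand the product errors [(15 + 1 + 6) * 0.42 T], the error [10 * 0.41 T] of the
    square, and [15/32 * 8 T] for replacing [15 C1 + C3] by 16 in the correction. The term
    [- 15/2 x^6 ep^3] cancels against [15/32 * 16 x^6 ep^3]. *)
Theorem sextic_inequality (eta1 eta2 eta3 zeta1 zeta2 zeta3 r0 r1 r2 r3 s1 s2 s3 : R) :
  Rabs eta1 <= 133 / 10 / 40320 * (1 * x) ^ 8 * ep ^ 4 ->
  Rabs eta2 <= 133 / 10 / 40320 * (2 * x) ^ 8 * ep ^ 4 ->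
  Rabs eta3 <= 133 / 10 / 40320 * (3 * x) ^ 8 * ep ^ 4 ->
  Rabs zeta1 <= 82 / 5040 * (1 * x) ^ 7 * ep ^ 4 ->
  Rabs zeta2 <= 82 / 5040 * (2 * x) ^ 7 * ep ^ 4 ->
  Rabs zeta3 <= 82 / 5040 * (3 * x) ^ 7 * ep ^ 4 ->
  Rabs r0 <= 1 / 5 * T -> Rabs r1 <= 1 / 5 * T -> Rabs r2 <= 1 / 5 * T -> Rabs r3 <= 1 / 5 * T ->
  Rabs s1 <= 1 / 5 * T -> Rabs s2 <= 1 / 5 * T -> Rabs s3 <= 1 / 5 * T ->
  let c0 := 1 + r0 in
  let C1 := (P 1 + eta1 - (Q 1 + zeta1) + r1) * (P 1 + eta1 + (Q 1 + zeta1) + s1) in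
  let C2 := (P 2 + eta2 - (Q 2 + zeta2) + r2) * (P 2 + eta2 + (Q 2 + zeta2) + s2) in
  let C3 := (P 3 + eta3 - (Q 3 + zeta3) + r3) * (P 3 + eta3 + (Q 3 + zeta3) + s3) in
  0 < 15 * C1 + C3 /\
  10 * c0 ^ 2 + 6 * C2 < (15 * C1 + C3) * (1 + 15 / 32 * x ^ 6 * ep ^ 3).
Proof.
  intros E1 E2 E3 Z1 Z2 Z3 R0 R1 R2 R3 S1 S2 S3 c0 C1 C2 C3.
  assert (HT := T_pos).
  assert (Hx2 : x ^ 2 <= 1 / 19600) by (replace (1 / 19600) with ((1 / 140) ^ 2) by field; apply pow_incr; lra).
  assert (Eta : forall t e, 0 <= t <= 3 -> Rabs e <= 133 / 10 / 40320 * (t * x) ^ 8 * ep ^ 4 -> Rabs e <= 1 / 1000 * T).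
  { intros t e Ht He; eapply Rle_trans; [exact He |].
    replace (133 / 10 / 40320 * (t * x) ^ 8 * ep ^ 4) with (133 / 10 / 40320 * t ^ 8 * x ^ 2 * T) by (unfold T; field).
    apply Rmult_le_compat_r; [lra |].
    assert (0 <= t ^ 8 <= 3 ^ 8) by (split; [apply pow_le; lra | apply pow_incr; lra]).
    assert (0 < x ^ 2) by (apply pow_lt; lra).
    apply Rle_trans with (133 / 10 / 40320 * 3 ^ 8 * (1 / 19600)); [| lra].
    apply Rmult_le_compat; lra. }
  assert (Zeta : forall t e, 0 <= t <= 3 -> Rabs e <= 82 / 5040 * (t * x) ^ 7 * ep ^ 4 -> Rabs e <= 26 / 100 * T).
  { intros t e Ht He; eapply Rle_trans; [exact He |].
    replace (82 / 5040 * (t * x) ^ 7 * ep ^ 4) with (82 / 5040 * t ^ 7 * x * T) by (unfold T; field).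
    apply Rmult_le_compat_r; [lra |].
    assert (0 <= t ^ 7 <= 3 ^ 7) by (split; [apply pow_le; lra | apply pow_incr; lra]).
    apply Rle_trans with (82 / 5040 * 3 ^ 7 * (1 / 140)); [| lra].
    apply Rmult_le_compat; lra. }
  destruct (PQ_small 1 ltac:(lra)) as [HP1 HQ1]; destruct (PQ_small 2 ltac:(lra)) as [HP2 HQ2];
    destruct (PQ_small 3 ltac:(lra)) as [HP3 HQ3].
  assert (K1 := conjugate_product (P 1) (Q 1) eta1 zeta1 r1 s1 T ltac:(lra) ltac:(lra) ltac:(lra)
    (Eta 1 _ ltac:(lra) E1) (Zeta 1 _ ltac:(lra) Z1) R1 S1).
  assert (K2 := conjugate_product (P 2) (Q 2) eta2 zeta2 r2 s2 T ltac:(lra) ltac:(lra) ltac:(lra)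
    (Eta 2 _ ltac:(lra) E2) (Zeta 2 _ ltac:(lra) Z2) R2 S2).
  assert (K3 := conjugate_product (P 3) (Q 3) eta3 zeta3 r3 s3 T ltac:(lra) ltac:(lra) ltac:(lra)
    (Eta 3 _ ltac:(lra) E3) (Zeta 3 _ ltac:(lra) Z3) R3 S3).
  fold C1 in K1; fold C2 in K2; fold C3 in K3.
  assert (M := main_part_lower); assert (N := main_sum_lower).
  apply Rabs_le_between in K1; apply Rabs_le_between in K2; apply Rabs_le_between in K3.
  apply Rabs_le_between in R0.
  assert (K0 : c0 ^ 2 <= 1 + 41 / 100 * T) by (unfold c0; nra).
  assert (U : x ^ 6 * ep ^ 3 * ep = T) by (unfold T; ring).
  assert (V : 0 < x ^ 6 * ep ^ 3) by (apply Rmult_lt_0_compat; apply pow_lt; lra).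
  assert (V1 : x ^ 6 * ep ^ 3 <= 1).
  { assert (x ^ 6 <= 1) by (rewrite <- (pow1 6); apply pow_incr; lra).
    assert (ep ^ 3 <= 1) by (rewrite <- (pow1 3); apply pow_incr; lra).
    assert (0 < x ^ 6) by (apply pow_lt; lra); assert (0 < ep ^ 3) by (apply pow_lt; lra); nra. }
  set (W := x ^ 6 * ep ^ 3) in *.
  assert (HS : 15 * C1 + C3 >= 16 - ep - 7 * T) by lra.
  split; [lra |].
  replace (1 + 15 / 32 * x ^ 6 * ep ^ 3) with (1 + 15 / 32 * W) by (unfold W; ring).
  assert (HW : W * (15 * C1 + C3) >= W * (16 - ep - 7 * T)) by (apply Rmult_ge_compat_l; lra).
  assert (HWT : W * T <= T) by nra.
  assert (M' : - (15 / 2) * x ^ 6 * ep ^ 3 = - (15 / 2) * W) by (unfold W; ring).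
  assert (HWS : W * (15 * C1 + C3) >= 16 * W - 8 * T).
  { replace (W * (16 - ep - 7 * T)) with (16 * W - W * ep - 7 * (W * T)) in HW by ring; lra. }
  replace ((15 * C1 + C3) * (1 + 15 / 32 * W)) with (15 * C1 + C3 + 15 / 32 * (W * (15 * C1 + C3))) by ring.
  clearbody C1 C2 C3 c0 W T; lra.
Qed.

End Sextic.

(** * The coefficients as saddle point integrals *)

Lemma phase_sum_even x y N : phase_sum x (- y) N = phase_sum x y N.
Proof.
  unfold phase_sum; induction N as [|N IH]; simpl; [auto |].
  simpl in IH; rewrite IH; f_equal; f_equal.
  rewrite Ropp_mult_distr_r_reverse, cos_neg; auto.
Qed.

Lemma Psi_0_real x N : 0 < x ->
  exists P0, 0 < P0 /\ Psi x N 0 = RtoC P0 /\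
    Fprod N (x, 0) = RtoC (P0 * exp (PI ^ 2 / 12 / x + 1 / 24 * x)).
Proof.
  intros Hx; destruct (Fprod_real_pos N x) as (r & Hr & E).
  set (w := PI ^ 2 / 12 / x + 1 / 24 * x).
  exists (r * exp (- w)); split; [apply Rmult_lt_0_compat; auto using exp_pos |]; split.
  - unfold Psi; replace (slope x 0) with (x, 0) by (unfold slope; rewrite Rmult_0_r; auto).
    change (@pair R R x 0) with (RtoC x) in *; rewrite E.
    rewrite <- RtoC_div, <- RtoC_mult, <- RtoC_plus, <- RtoC_opp by lra.
    fold w; unfold Cexp; simpl; rewrite cos_0, sin_0, !Rmult_1_r, Rmult_0_r.
    change (@pair R R (exp (- w)) 0) with (RtoC (exp (- w))); rewrite RtoC_mult; auto.
  - rewrite E; f_equal; rewrite Rmult_assoc, <- exp_plus, Rplus_opp_l, exp_0; ring.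
Qed.

Section Coefficient.

Variables (x L j delta : R) (N : nat) (k : Z) (P0 : R).
Hypothesis Hx : 0 < x <= 1 / 100.
Hypothesis HL : L * x = PI ^ 2 / 12.
Hypothesis Hk : IZR k + 1 / 24 = L / x + j.
Hypothesis HPsi : forall u, -2 <= u <= 2 -> Cmod (Psi x N u - Psi x N 0)%C <= 8 * x * delta * Cmod (Psi x N 0).
Hypothesis HP0 : 0 < P0.
Hypothesis HPsi0 : Psi x N 0 = RtoC P0.
Hypothesis HF0 : Fprod N (x, 0) = RtoC (P0 * exp (PI ^ 2 / 12 / x + 1 / 24 * x)).

Let E := exp (2 * L + j * x).
Let f (y : R) : R := fst (Fprod N (x, y) * Cexp (RtoC (IZR k) * (x, y)))%C.

Let h (u : R) : C := (ker L u * Cexp (RtoC (j * x) * ivar u))%C.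

Lemma Cmod_h u : Cmod (h u) = kabs L u.
Proof.
  unfold h; rewrite Cmod_mult, Cmod_Cexp.
  replace (fst (RtoC (j * x) * ivar u)%C) with 0 by (unfold ivar; simpl; ring).
  rewrite exp_0, Rmult_1_r, ker_polar.
  unfold Cmod; simpl.
  replace (_ + _) with (Rsqr (kabs L u) * (Rsqr (sin (kphase L u)) + Rsqr (cos (kphase L u)))) by (unfold Rsqr; ring).
  rewrite sin2_cos2, Rmult_1_r; apply sqrt_Rsqr, Rlt_le, kabs_pos.
Qed.

Lemma h_continuous u : continuous (fun u => fst (h u)) u.
Proof.
  destruct (derivC_mult (ker L) (fun u => Cexp (RtoC (j * x) * ivar u)) u _ _
    (derivC_ker L u) (derivC_Cexp _ u _ (derivC_mult (fun _ => RtoC (j * x)) ivar u _ _ (derivC_const _ u) (derivC_ivar u)))) as [D _].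
  eapply derive_continuous, D.
Qed.

(* The exponent [a/t + t/24 + k t] of [t = slope x u] splits as [2 L + j x + j x v + L v^2 / (1 + v)], [v = i u]. *)
Lemma integrand_scaled u : f (x * u + 0) = E * fst (Psi x N u * h u)%C.
Proof.
  assert (Hs := slope_neq_0 x u (proj1 Hx)).
  assert (S : slope x u = (RtoC x * (1 + ivar u))%C).
  { unfold slope, ivar; apply injective_projections; simpl; ring. }
  assert (H1 := one_plus_ivar u).
  assert (Hx' : RtoC x <> 0%C) by (intros H; apply RtoC_inj in H; lra).
  unfold f; rewrite Rplus_0_r; change (x, x * u) with (slope x u).
  transitivity (fst (RtoC E * (Psi x N u * h u))%C); [| simpl; ring].
  f_equal; unfold Psi, h, ker, E.
  replace (RtoC (exp (2 * L + j * x))) with (Cexp (RtoC (2 * L + j * x))).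
  2: { unfold Cexp; simpl; rewrite cos_0, sin_0; apply injective_projections; simpl; ring. }
  rewrite <- !Cmult_assoc, !(Cmult_comm (Fprod _ _)), <- !Cexp_plus, !Cmult_assoc, <- !Cexp_plus.
  rewrite <- HL.
  replace (IZR k) with (L / x + j - 1 / 24) by lra.
  f_equal; f_equal.
  rewrite S; repeat first [rewrite RtoC_plus | rewrite RtoC_minus | rewrite RtoC_mult | rewrite RtoC_div by lra].
  field; repeat split; auto.
Qed.

Lemma middle_integral :
  Rabs (Int f (- 2 * x) (2 * x) - x * P0 * E * kint L (j * x)) <= x * P0 * E * (8 * x * delta * amom L 0).
Proof.
  assert (Cf : forall y, continuous f y) by (intros; apply Fprod_term_continuous).
  assert (HE : 0 < E) by apply exp_pos.
  assert (Cs : forall u, continuous (fun u => f (x * u + 0)) u).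
  { intros u; apply (continuous_comp (fun s => x * s + 0) f); auto.
    apply (ex_derive_continuous (fun s => x * s + 0)); auto_derive; auto. }
  replace (Int f (- 2 * x) (2 * x)) with (Int (fun y => x * f (x * y + 0)) (-2) 2).
  2: { rewrite Int_affine by auto; f_equal; ring. }
  rewrite Int_scal by auto; unfold kint; fold h.
  change (fun u : R => fst (ker L u * Cexp ((j * x)%R * ivar u))%C) with (fun u => fst (h u)).
  rewrite !Rmult_assoc, <- Rmult_minus_distr_l, Rabs_mult, (Rabs_pos_eq x) by lra.
  apply Rmult_le_compat_l; [lra |].
  rewrite <- !(Rmult_assoc P0 E), <- Int_scal, <- Int_sub by (intros; try apply continuous_smul; auto using h_continuous).
  unfold amom; rewrite <- !Rmult_assoc, <- Int_scal by (intros; apply amom_continuous).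
  apply Int_abs_le; [lra | | |].
  - intros u; apply continuous_sub; auto; apply continuous_smul, h_continuous.
  - intros u; apply continuous_smul, amom_continuous.
  - intros u Hu; rewrite integrand_scaled.
    replace (E * fst (Psi x N u * h u)%C - P0 * E * fst (h u)) with (E * fst ((Psi x N u - Psi x N 0) * h u)%C)
      by (rewrite HPsi0; simpl; ring).
    rewrite Rabs_mult, Rabs_pos_eq by lra.
    replace (P0 * E * 8 * x * delta * (u ^ (2 * 0) * kabs L u)) with (E * (8 * x * delta * P0 * kabs L u)) by (simpl; ring).
    apply Rmult_le_compat_l; [lra |].
    eapply Rle_trans; [apply re_le_Cmod |].
    rewrite Cmod_mult, Cmod_h; apply Rmult_le_compat_r; [apply Rlt_le, kabs_pos |].
    eapply Rle_trans; [apply HPsi; auto |].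
    rewrite HPsi0, Cmod_R, Rabs_pos_eq by lra; apply Rle_refl.
Qed.

Let S0 := 3 / 8 / x - 126 / 1000 - exp (- (INR (S N) * x)) / x.

(** At the real point the integrand is [P0 * E], because [a / x = L] and
    [(k + 1/24) x = L + j x]. *)
Lemma minor_bound y : 2 * x <= Rabs y <= PI -> Rabs (f y) <= P0 * E * exp (- S0).
Proof.
  intros Hy.
  assert (HS : S0 <= phase_sum x y N).
  { unfold S0; revert Hy; unfold Rabs; destruct (Rcase_abs y) as [Hn | Hn]; intros Hy.
    - rewrite <- phase_sum_even; apply phase_sum_lower; lra.
    - apply phase_sum_lower; lra. }
  unfold f; eapply Rle_trans; [apply re_le_Cmod |].
  rewrite Cmod_mult, Cmod_Cexp.
  eapply Rle_trans; [apply Rmult_le_compat_r; [apply Rlt_le, exp_pos | apply Fprod_phase_bound] |].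
  rewrite HF0, Cmod_R, Rabs_pos_eq.
  2: { apply Rmult_le_pos; [lra | apply Rlt_le, exp_pos]. }
  replace (fst (RtoC (IZR k) * (x, y))%C) with (IZR k * x) by (simpl; ring).
  rewrite <- HL; replace (L * x / x) with L by (field; lra).
  unfold E; rewrite !Rmult_assoc, <- !exp_plus.
  apply Rmult_le_compat_l; [lra |]; apply exp_le_mono.
  replace (IZR k) with (L / x + j - 1 / 24) by lra.
  replace ((L / x + j - 1 / 24) * x) with (L + j * x - 1 / 24 * x) by (field; lra).
  lra.
Qed.

Lemma minor_integral u v : u <= v -> v - u <= PI -> (forall y, u <= y <= v -> 2 * x <= Rabs y <= PI) ->
  Rabs (Int f u v) <= PI * (P0 * E * exp (- S0)).
Proof.
  intros Huv Hl Hy.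
  assert (HB : 0 < P0 * E * exp (- S0)).
  { apply Rmult_lt_0_compat; [apply Rmult_lt_0_compat; [lra | apply exp_pos] | apply exp_pos]. }
  eapply Rle_trans; [apply (Int_abs_le f (fun _ => P0 * E * exp (- S0))); auto |].
  - intros; apply Fprod_term_continuous.
  - intros; apply continuous_const.
  - intros y Hy'; apply minor_bound; auto.
  - rewrite Int_const, Rmult_comm; apply Rmult_le_compat_r; lra.
Qed.

Lemma coefficient_estimate :
  Rabs (2 * PI * IZR (dcount N k) - x * P0 * E * kint L (j * x)) <=
    x * P0 * E * (8 * x * delta * amom L 0 + 2 * PI / x * exp (- S0)).
Proof.
  assert (Cf : forall y, continuous f y) by (intros; apply Fprod_term_continuous).
  assert (HPI := PI2_3_2).
  rewrite <- (Fprod_coefficient N k x); fold f.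
  rewrite (Int_split f _ (- 2 * x)) by auto; rewrite (Int_split f (- 2 * x) (2 * x)) by auto.
  assert (M := middle_integral).
  assert (A : Rabs (Int f (- PI) (- 2 * x)) <= PI * (P0 * E * exp (- S0))).
  { apply minor_integral; try lra; intros y Hy; rewrite Rabs_left; lra. }
  assert (B : Rabs (Int f (2 * x) PI) <= PI * (P0 * E * exp (- S0))).
  { apply minor_integral; try lra; intros y Hy; rewrite Rabs_right; lra. }
  replace (x * P0 * E * (8 * x * delta * amom L 0 + 2 * PI / x * exp (- S0))) with
    (x * P0 * E * (8 * x * delta * amom L 0) + 2 * (PI * (P0 * E * exp (- S0)))) by (field; lra).
  apply Rabs_le_between in M; apply Rabs_le_between in A; apply Rabs_le_between in B.
  apply Rabs_le; lra.
Qed.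

End Coefficient.

(** [cos] changes sign at [pi / 2]; its Taylor sections at 1.5707 and 1.5708 show on which side
    these points lie. *)
Lemma PI_bounds : 31414 / 10000 < PI < 31416 / 10000.
Proof.
  assert (C : forall t, 0 <= t <= 2 ->
    1 - t ^ 2 / 2 + t ^ 4 / 24 - t ^ 6 / 720 + t ^ 8 / 40320 - t ^ 10 / 3628800 <= cos t <=
    1 - t ^ 2 / 2 + t ^ 4 / 24 - t ^ 6 / 720 + t ^ 8 / 40320 - t ^ 10 / 3628800 + t ^ 12 / 479001600).
  { intros t Ht; destruct (pre_cos_bound t 2 ltac:(lra) ltac:(lra)) as [H1 H2].
    unfold cos_approx, cos_term in H1, H2; cbn [sum_f_R0 Nat.mul Nat.add] in H1, H2.
    assert (E : forall k, / INR (fact k) = / IZR (zfact k)) by (intros; rewrite INR_fact; auto).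
    unfold Rdiv in *; rewrite !E in H1; rewrite !E in H2.
    change (zfact 0) with 1%Z in *; change (zfact 2) with 2%Z in *; change (zfact 4) with 24%Z in *;
    change (zfact 6) with 720%Z in *; change (zfact 8) with 40320%Z in *; change (zfact 10) with 3628800%Z in *;
    change (zfact 12) with 479001600%Z in *.
    lra. }
  assert (HPI := PI2_3_2); assert (HPI4 := PI_4).
  split.
  - apply Rnot_le_lt; intros H.
    assert (N : cos (15707 / 10000) <= 0) by (apply cos_le_0; lra).
    destruct (C (15707 / 10000) ltac:(lra)) as [H1 _]; lra.
  - apply Rnot_le_lt; intros H.
    assert (N : 0 <= cos (15708 / 10000)) by (apply cos_ge_0; lra).
    destruct (C (15708 / 10000) ltac:(lra)) as [_ H1]; lra.
Qed.

(** Eight squarings from [exp (1/256) >= 257/256], rounded down each time. *)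
Lemma exp_1_lower : 271 / 100 <= exp 1.
Proof.
  assert (H : forall t v u, v <= exp t -> 0 <= u <= v -> u * u <= exp (2 * t)).
  { intros t v u Ht Hu; replace (2 * t) with (t + t) by ring; rewrite exp_plus; apply Rmult_le_compat; lra. }
  assert (H0 : 257 / 256 <= exp (/ 256)) by (generalize (exp_ineq1_le (/ 256)); lra).
  assert (H1 := H _ _ (257 / 256) H0 ltac:(lra)).
  assert (H2 := H _ _ (10078277 / 10000000) H1 ltac:(lra)).
  assert (H3 := H _ _ (10157166 / 10000000) H2 ltac:(lra)).
  assert (H4 := H _ _ (10316802 / 10000000) H3 ltac:(lra)).
  assert (H5 := H _ _ (10643640 / 10000000) H4 ltac:(lra)).
  assert (H6 := H _ _ (11328707 / 10000000) H5 ltac:(lra)).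
  assert (H7 := H _ _ (12833960 / 10000000) H6 ltac:(lra)).
  assert (H8 := H _ _ (16471052 / 10000000) H7 ltac:(lra)).
  match type of H8 with _ <= exp ?t => replace t with 1 in H8 by field end.
  lra.
Qed.

(** * Numerical error bounds for [L >= 140] *)

Section Normalisation.

Variables x L : R.
Hypothesis HL : 140 <= L.
Hypothesis HxL : L * x = PI ^ 2 / 12.

Lemma a_bounds : 8223 / 10000 <= PI ^ 2 / 12 <= 82248 / 100000.
Proof. assert (H := PI_bounds); nra. Qed.

Lemma x_bounds : 0 < x <= 5875 / 1000000 /\ x <= / L.
Proof.
  assert (H := a_bounds).
  assert (Hx : x = PI ^ 2 / 12 * / L) by (rewrite <- HxL; field; lra).
  assert (HiL : 0 < / L <= 1 / 140).
  { split; [apply Rinv_0_lt_compat; lra |]; replace (1 / 140) with (/ 140) by field; apply Rinv_le_contravar; lra. }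
  rewrite Hx; split; [split |]; nra.
Qed.

Lemma target_lower : x ^ 10 <= x ^ 6 * (/ L) ^ 4.
Proof.
  destruct x_bounds as [H1 H2].
  replace (x ^ 10) with (x ^ 6 * x ^ 4) by ring.
  apply Rmult_le_compat_l; [apply pow_le; lra |]; apply pow_incr; lra.
Qed.

(* The order 44 of the Euler-Maclaurin expansion is what makes the major arc error this small. *)
Lemma fact_44_bound : 113232 / 1000 * INR (fact 44) * (9 / 4 * x) ^ 43 <= 1 / 20 * x ^ 10.
Proof.
  destruct x_bounds as [[H1 H2] _]; assert (HF := INR_fact_lt_0 44).
  replace ((9 / 4 * x) ^ 43) with ((9 / 4) ^ 43 * (x ^ 33 * x ^ 10)) by (rewrite <- pow_add, Rpow_mult_distr; reflexivity).
  rewrite <- !Rmult_assoc.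
  apply Rmult_le_compat_r; [apply pow_le; lra |].
  assert (Hp : x ^ 33 <= (5875 / 1000000) ^ 33) by (apply pow_incr; lra).
  apply Rle_trans with (113232 / 1000 * INR (fact 44) * (9 / 4) ^ 43 * (5875 / 1000000) ^ 33).
  { apply Rmult_le_compat_l; [| auto].
    apply Rmult_le_pos; [lra | apply pow_le; lra]. }
  rewrite INR_fact.
  let z := eval vm_compute in (zfact 44) in change (zfact 44) with z.
  lra.
Qed.

(** [113232/1000] in [fact_44_bound] is [8 * 14 * 1011/1000]: 8 from [Psi_estimate], 14 as the
    Euler-Maclaurin constant 13 plus 1 for the finiteness of [N], and [1011/1000] from
    [amom_0_le]. *)
Lemma major_error : 8 * (14 * INR (fact 44) * (9 / 4 * x) ^ 43) * (amom L 0 / mom L 0) <= 1 / 20 * (x ^ 6 * (/ L) ^ 4).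
Proof.
  destruct x_bounds as [[H1 H2] _].
  assert (Hm := mom_0_gt_0 L HL); assert (Ha := amom_0_le L HL).
  assert (Q : amom L 0 / mom L 0 <= 1011 / 1000).
  { apply Rmult_le_reg_r with (mom L 0); [lra |]; unfold Rdiv; rewrite Rmult_assoc, Rinv_l by lra; lra. }
  apply Rle_trans with (1 / 20 * x ^ 10); [| apply Rmult_le_compat_l; [lra | apply target_lower]].
  assert (HF := INR_fact_lt_0 44); assert (H44 := fact_44_bound).
  assert (0 <= (9 / 4 * x) ^ 43) by (apply pow_le; lra).
  revert H44 Q; generalize (INR (fact 44)) (amom L 0 / mom L 0) ((9 / 4 * x) ^ 43) HF H.
  intros F q Y HF' HY H44 Q; assert (0 <= F * Y) by (apply Rmult_le_pos; lra).
  apply Rle_trans with (8 * 14 * (F * Y) * (1011 / 1000)); [| lra].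
  replace (8 * (14 * F * Y) * q) with (8 * 14 * (F * Y) * q) by ring.
  apply Rmult_le_compat_l; lra.
Qed.

(** Here [L >= 140] is nearly sharp: the exponent is at least [0.4559 (L - 140) + 63], and
    [(271/100)^63] is only about 1.4 times [24 * 140^12]. The power 12 gathers [L^10] from the
    target, [L] from [1 / x] and [L] from [1 / mom L 0]. *)
Lemma minor_error (N : nat) : exp (- (INR (S N) * x)) / x <= 1 / 1000 ->
  2 * PI / x * exp (- (3 / 8 / x - 126 / 1000 - exp (- (INR (S N) * x)) / x)) / mom L 0 <= 3 / 20 * (x ^ 6 * (/ L) ^ 4).
Proof.
  intros HN; destruct x_bounds as [[H1 H2] _]; assert (HA := a_bounds); assert (HPI := PI_bounds).
  assert (Hm := mom_0_pos L HL); assert (Hm0 := mom_0_gt_0 L HL).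
  set (a := PI ^ 2 / 12) in *.
  assert (Hx : x = a / L) by (rewrite <- HxL; field; lra).
  assert (Hx8 : 3 / 8 / x = 3 / 8 / a * L) by (rewrite Hx; field; lra).
  assert (Ha8 : 4559 / 10000 <= 3 / 8 / a).
  { apply Rmult_le_reg_r with a; [lra |]; replace (3 / 8 / a * a) with (3 / 8) by (field; lra); lra. }
  set (S0 := 3 / 8 / x - 126 / 1000 - exp (- (INR (S N) * x)) / x).
  assert (HS : 4559 / 10000 * (L - 140) + 63 <= S0) by (unfold S0; rewrite Hx8; nra).
  assert (HE : 271 / 100 <= exp 1) by apply exp_1_lower.
  assert (H63 : (271 / 100) ^ 63 <= exp 63).
  { replace (exp 63) with (exp (INR 63 * 1)) by (f_equal; rewrite INR_IZR_INZ; simpl; ring).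
    rewrite exp_pow; apply pow_incr; lra. }
  assert (HP := pow_le_exp_140 L (4559 / 10000) 12 HL ltac:(simpl; lra)).
  assert (HSe : L ^ 12 * (24 * exp (- S0)) <= 1).
  { apply Rle_trans with (140 ^ 12 * exp (4559 / 10000 * (L - 140)) * (24 * exp (- S0))).
    { apply Rmult_le_compat_r; [generalize (exp_pos (- S0)); lra | auto]. }
    replace (140 ^ 12 * exp (4559 / 10000 * (L - 140)) * (24 * exp (- S0)))
      with (140 ^ 12 * 24 * exp (4559 / 10000 * (L - 140) + - S0)) by (rewrite exp_plus; ring).
    assert (M : exp (4559 / 10000 * (L - 140) + - S0) <= / (271 / 100) ^ 63).
    { apply Rle_trans with (exp (Ropp 63)); [apply exp_le_mono; lra |].
      rewrite exp_Ropp; apply Rinv_le_contravar; [apply pow_lt; lra | auto]. }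
    apply Rle_trans with (140 ^ 12 * 24 * / (271 / 100) ^ 63); [apply Rmult_le_compat_l; lra | lra]. }
  assert (HsL : 11 * sqrt L <= L).
  { rewrite <- (sqrt_sqrt L) at 2 by lra; apply Rmult_le_compat_r; [apply sqrt_pos |].
    apply Rle_trans with (sqrt (11 * 11)); [rewrite sqrt_square; lra | apply sqrt_le_1; lra]. }
  assert (Hs : 0 < sqrt L) by (apply sqrt_lt_R0; lra).
  assert (Hm1 : / mom L 0 <= L / (715 / 100)).
  { apply Rle_trans with (/ (65 / 100 / sqrt L)).
    - apply Rinv_le_contravar; [apply Rdiv_lt_0_compat; lra | auto].
    - replace (/ (65 / 100 / sqrt L)) with (sqrt L / (65 / 100)) by (field; lra); lra. }
  assert (HL6 : x ^ 6 * (/ L) ^ 4 = a ^ 6 / L ^ 10) by (rewrite Hx; field; lra).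
  rewrite HL6.
  assert (Ha6 : (8223 / 10000) ^ 6 <= a ^ 6) by (apply pow_incr; lra).
  assert (HL10 : 0 < / L ^ 10) by (apply Rinv_0_lt_compat, pow_lt; lra).
  apply Rle_trans with (3 / 20 * (8223 / 10000) ^ 6 * / L ^ 10).
  2: { replace (3 / 20 * (a ^ 6 / L ^ 10)) with (3 / 20 * a ^ 6 * / L ^ 10) by (field; lra); apply Rmult_le_compat_r; lra. }
  apply Rle_trans with (2 * PI / x * exp (- S0) * (L / (715 / 100))).
  { unfold Rdiv at 1; apply Rmult_le_compat_l; [| auto].
    apply Rmult_le_pos; [apply Rlt_le, Rdiv_lt_0_compat; lra | apply Rlt_le, exp_pos]. }
  replace (2 * PI / x * exp (- S0) * (L / (715 / 100))) with
     (2 * PI / (a * (715 / 100)) / 24 * / L ^ 10 * (L ^ 12 * (24 * exp (- S0)))) by (rewrite Hx; field; lra).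
  assert (Hc : 2 * PI / (a * (715 / 100)) / 24 <= 3 / 20 * (8223 / 10000) ^ 6).
  { apply Rmult_le_reg_r with (a * (715 / 100) * 24); [lra |].
    replace (2 * PI / (a * (715 / 100)) / 24 * (a * (715 / 100) * 24)) with (2 * PI) by (field; lra); nra. }
  assert (Hc0 : 0 < 2 * PI / (a * (715 / 100)) / 24).
  { apply Rdiv_lt_0_compat; [apply Rdiv_lt_0_compat; lra | lra]. }
  assert (0 < L ^ 12 * (24 * exp (- S0))).
  { apply Rmult_lt_0_compat; [apply pow_lt; lra | generalize (exp_pos (- S0)); lra]. }
  apply Rle_trans with (2 * PI / (a * (715 / 100)) / 24 * / L ^ 10 * 1).
  - apply Rmult_le_compat_l; [apply Rmult_le_pos; lra | lra].
  - rewrite Rmult_1_r; apply Rmult_le_compat_r; lra.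
Qed.

End Normalisation.

Section Large.

Variables x L : R.
Variable M : Z.
Hypothesis HL : 140 <= L.
Hypothesis HxL : L * x = PI ^ 2 / 12.
Hypothesis HM : L / x = IZR M + 1 / 24.

(** [H] depends on [N] but not on [j], so it drops out of a homogeneous inequality. [1/5] is [1/20]
    from the arc [|u| <= 2] plus [3/20] from the rest. *)
Lemma normalised_coefficient : exists N0 : nat, forall N, (N0 <= N)%nat -> exists H, 0 < H /\
  forall j : Z, exists r, IZR (dcount N (M + j)) = H * exp (IZR j * x) * (kint L (IZR j * x) / mom L 0 + r) /\
    Rabs r <= 1 / 5 * (x ^ 6 * (/ L) ^ 4).
Proof.
  destruct (x_bounds x L HL HxL) as [[Hx0 Hx] _].
  assert (HPI := PI_bounds); assert (Hm := mom_0_gt_0 L HL).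
  destruct (sigsum_estimate x 42 ltac:(lra)) as [Cst HC].
  set (F := INR (fact 44) * (9 / 4 * x) ^ 43).
  assert (HF : 0 < F) by (apply Rmult_lt_0_compat; [apply INR_fact_lt_0 | apply pow_lt; lra]).
  assert (HF' : 113232 / 1000 * F <= 1 / 20 * x ^ 10).
  { unfold F; rewrite <- Rmult_assoc; apply (fact_44_bound x L HL HxL). }
  assert (Hx10 : x ^ 10 <= 1) by (rewrite <- (pow1 10); apply pow_incr; lra).
  assert (HE : 8 * (14 * F) * (amom L 0 / mom L 0) <= 1 / 20 * (x ^ 6 * (/ L) ^ 4)).
  { unfold F; rewrite <- (Rmult_assoc 14); apply (major_error x L HL HxL). }
  set (delta := 14 * F / x).
  (* [N] is so large that [Cst / N <= F / x], which turns 13 into 14, and that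
     [exp (- (N + 1) x) / x <= 1/1000]. *)
  destruct (INR_unbounded (Rabs Cst * x / F + 1000 / x ^ 2)) as [N0 HN0].
  exists (S N0); intros N HN.
  assert (HN' : Rabs Cst * x / F + 1000 / x ^ 2 <= INR N) by (apply le_INR in HN; rewrite S_INR in HN; lra).
  assert (P1 : 0 <= Rabs Cst * x / F).
  { apply Rmult_le_pos; [apply Rmult_le_pos; [apply Rabs_pos | lra] | apply Rlt_le, Rinv_0_lt_compat; auto]. }
  assert (P2 : 0 < 1000 / x ^ 2) by (apply Rdiv_lt_0_compat; [lra | apply pow_lt; lra]).
  assert (HNpos : 0 < INR N) by lra.
  assert (HCN : Cst / INR N <= F / x).
  { apply Rmult_le_reg_r with (INR N * (x / F)); [apply Rmult_lt_0_compat; [lra | apply Rdiv_lt_0_compat; lra] |].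
    replace (Cst / INR N * (INR N * (x / F))) with (Cst * x / F) by (field; lra).
    replace (F / x * (INR N * (x / F))) with (INR N) by (field; lra).
    assert (Cst * x / F <= Rabs Cst * x / F); [| lra].
    apply Rmult_le_compat_r; [apply Rlt_le, Rinv_0_lt_compat; auto |].
    apply Rmult_le_compat_r; [lra | apply Rle_abs]. }
  assert (Hexp : exp (- (INR (S N) * x)) / x <= 1 / 1000).
  { rewrite S_INR, exp_Ropp.
    assert (H1 : 1000 / x <= exp ((INR N + 1) * x)).
    { apply Rle_trans with ((INR N + 1) * x); [| generalize (exp_ineq1_le ((INR N + 1) * x)); lra].
      replace (1000 / x) with (1000 / x ^ 2 * x) by (field; lra); apply Rmult_le_compat_r; lra. }
    replace (1 / 1000) with (/ (1000 / x) / x) by (field; lra).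
    apply Rmult_le_compat_r; [apply Rlt_le, Rinv_0_lt_compat; lra |].
    apply Rinv_le_contravar; [apply Rdiv_lt_0_compat; lra | auto]. }
  assert (Hd : 0 <= delta) by (unfold delta; apply Rlt_le, Rdiv_lt_0_compat; lra).
  assert (Hxd : x * delta = 14 * F) by (unfold delta; field; lra).
  assert (Hd' : 4 * x * delta <= 1 / 2) by (rewrite Rmult_assoc, Hxd; lra).
  assert (HPsi := Psi_estimate x N delta Hx0 Hd Hd').
  destruct (Psi_0_real x N Hx0) as (P0 & HP0 & EP & EF).
  exists (x * P0 * exp (2 * L) * mom L 0 / (2 * PI)); split.
  { apply Rdiv_lt_0_compat; [| lra]; apply Rmult_lt_0_compat; [| auto].
    apply Rmult_lt_0_compat; [apply Rmult_lt_0_compat; auto | apply exp_pos]. }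
  intros j.
  assert (K := coefficient_estimate x L (IZR j) delta N (M + j) P0 ltac:(lra) HxL
    ltac:(rewrite plus_IZR; lra)).
  assert (HS : forall u, -2 <= u <= 2 ->
    Cmod (sigsum x u N - (RtoC (PI ^ 2 / 12) / (slope x u * slope x u) - RtoC (1 / 24)))%C <= delta).
  { intros u Hu; eapply Rle_trans; [apply HC; [auto | lia] |].
    unfold delta; change (S (S 42)) with 44%nat; change (S 42) with 43%nat.
    replace (13 * INR (fact 44) * (9 / 4 * x) ^ 43 / x) with (13 * F / x) by (unfold F, Rdiv; rewrite !Rmult_assoc; auto).
    replace (14 * F / x) with (13 * F / x + F / x) by (field; lra); lra. }
  specialize (K (HPsi HS) HP0 EP EF).
  set (W := x * P0 * exp (2 * L + IZR j * x)) in *.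
  assert (HW : 0 < W) by (apply Rmult_lt_0_compat; [apply Rmult_lt_0_compat; auto | apply exp_pos]).
  set (D := IZR (dcount N (M + j))) in *.
  exists (2 * PI * D / (W * mom L 0) - kint L (IZR j * x) / mom L 0); split.
  - assert (HW' : W = x * P0 * (exp (2 * L) * exp (IZR j * x))) by (unfold W; rewrite exp_plus; ring).
    rewrite HW'; field; repeat split; try lra; apply Rgt_not_eq, exp_pos.
  - replace (2 * PI * D / (W * mom L 0) - kint L (IZR j * x) / mom L 0)
      with ((2 * PI * D - W * kint L (IZR j * x)) / (W * mom L 0)) by (field; lra).
    unfold Rdiv; rewrite Rabs_mult, (Rabs_pos_eq (/ (W * mom L 0))).
    2: { apply Rlt_le, Rinv_0_lt_compat, Rmult_lt_0_compat; auto. }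
    apply Rle_trans with (8 * (14 * F) * (amom L 0 / mom L 0)
       + 2 * PI / x * exp (- (3 / 8 / x - 126 / 1000 - exp (- (INR (S N) * x)) / x)) / mom L 0).
    + apply Rle_trans with (W * (8 * x * delta * amom L 0 + 2 * PI / x * exp (- (3 / 8 / x - 126 / 1000 - exp (- (INR (S N) * x)) / x))) * / (W * mom L 0)).
      * apply Rmult_le_compat_r; [apply Rlt_le, Rinv_0_lt_compat, Rmult_lt_0_compat; auto | exact K].
      * right; rewrite (Rmult_assoc 8 x), Hxd.
        generalize (exp (- (3 / 8 / x - 126 / 1000 - exp (- (INR (S N) * x)) / x))); intros e; field; lra.
    + assert (Me := minor_error x L HL HxL N Hexp); lra.
Qed.

Theorem dcount_inequality : exists N0 : nat, forall N, (N0 <= N)%nat ->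
  let Q j := IZR (dcount N (M + j)) in
  0 < 15 * (Q (-1)%Z * Q 1%Z) + Q (-3)%Z * Q 3%Z /\
  10 * Q 0%Z ^ 2 + 6 * (Q (-2)%Z * Q 2%Z) <
    (15 * (Q (-1)%Z * Q 1%Z) + Q (-3)%Z * Q 3%Z) * (1 + 15 / 32 * x ^ 6 * (/ L) ^ 3).
Proof.
  destruct normalised_coefficient as [N0 HN0]; exists N0; intros N HN Q.
  destruct (HN0 N HN) as (H & HH & HQ).
  destruct (x_bounds x L HL HxL) as [[Hx0 Hx] HxL'].
  assert (Hm := mom_0_gt_0 L HL).
  set (ev t := kint_even L t / mom L 0); set (od t := kint_odd L t / mom L 0).
  assert (Hev : forall t, ev (- t) = ev t).
  { intros t; unfold ev, kint_even; f_equal; apply Int_ext; intros u.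
    rewrite <- Ropp_mult_distr_l, cos_neg; auto. }
  assert (Hod : forall t, od (- t) = - od t).
  { intros t; unfold od, kint_odd; rewrite (Int_ext _ (fun u => -1 * (sin (t * u) * (kabs L u * sin (kphase L u))))).
    - rewrite Int_scal; [field; lra |].
      intros u; apply continuous_mul; [apply sin_lin_continuous | apply ksin_continuous].
    - intros u; rewrite <- Ropp_mult_distr_l, sin_neg; ring. }
  assert (Hk : forall t, kint L t / mom L 0 = ev t - od t).
  { intros t; unfold ev, od; rewrite kint_split; field; lra. }
  assert (HQ' : forall j : Z, exists r, Rabs r <= 1 / 5 * (x ^ 6 * (/ L) ^ 4) /\
     Q j = H * exp (IZR j * x) * (ev (IZR j * x) - od (IZR j * x) + r)).
  { intros j; destruct (HQ j) as (r & E & Hr); exists r; split; auto.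
    unfold Q; rewrite E, Hk; auto. }
  destruct (HQ' 0%Z) as (r0 & R0 & E0).
  destruct (HQ' 1%Z) as (r1 & R1 & E1); destruct (HQ' (-1)%Z) as (s1 & S1 & F1).
  destruct (HQ' 2%Z) as (r2 & R2 & E2); destruct (HQ' (-2)%Z) as (s2 & S2 & F2).
  destruct (HQ' 3%Z) as (r3 & R3 & E3); destruct (HQ' (-3)%Z) as (s3 & S3 & F3).
  assert (HT1 := kint_even_expansion L HL); assert (HT2 := kint_odd_expansion L HL).
  fold (ev 0) in HT1.
  destruct (nmom_bounds L HL) as (B1 & B2 & B3 & B4 & B5 & B6 & _).
  (* At [t = 0] the error bounds of both expansions vanish, so the values are exact. *)
  assert (Z0 : ev 0 = 1 /\ od 0 = 0).
  { assert (T1 := HT1 0 ltac:(lra)); assert (T2 := HT2 0 ltac:(lra)).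
    fold (ev 0) in T1; fold (od 0) in T2; rewrite Rabs_R0 in T2.
    apply Rabs_le_between in T1; apply Rabs_le_between in T2; split; lra. }
  destruct Z0 as [Z1 Z2].
  assert (Hep : 0 < / L <= 1 / 140).
  { split; [apply Rinv_0_lt_compat; lra |]; replace (1 / 140) with (/ 140) by field; apply Rinv_le_contravar; lra. }
  assert (Htx : forall t, 0 <= t <= 3 -> 0 <= t * x /\ t * x <= 1).
  { intros t Ht; split; [apply Rmult_le_pos; lra |].
    apply Rle_trans with (3 * x); [apply Rmult_le_compat_r |]; lra. }
  assert (TE : forall t, 0 <= t <= 3 -> exists eta,
     ev (t * x) = 1 + (t * x) ^ 2 / 2 * nmom L 2 + (t * x) ^ 4 / 24 * nmom L 4 + (t * x) ^ 6 / 720 * nmom L 6 + eta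
     /\ Rabs eta <= 133 / 10 / 40320 * (t * x) ^ 8 * (/ L) ^ 4).
  { intros t Ht; eexists; split; [| apply (HT1 (t * x)); destruct (Htx t Ht); lra]; unfold ev; ring. }
  assert (TO : forall t, 0 <= t <= 3 -> exists zeta,
     od (t * x) = - (t * x * nmom L 1 + (t * x) ^ 3 / 6 * nmom L 3 + (t * x) ^ 5 / 120 * nmom L 5) + zeta
     /\ Rabs zeta <= 82 / 5040 * (t * x) ^ 7 * (/ L) ^ 4).
  { intros t Ht; destruct (Htx t Ht) as [Hp Hb]; assert (B := HT2 (t * x) ltac:(lra)); rewrite (Rabs_pos_eq (t * x) Hp) in B.
    fold (od (t * x)) in B; revert B.
    generalize (t * x * nmom L 1 + (t * x) ^ 3 / 6 * nmom L 3 + (t * x) ^ 5 / 120 * nmom L 5); intros z B.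
    exists (od (t * x) + z); split; [ring | exact B]. }
  destruct (TE 1 ltac:(lra)) as (eta1 & A1 & A1'); destruct (TE 2 ltac:(lra)) as (eta2 & A2 & A2');
    destruct (TE 3 ltac:(lra)) as (eta3 & A3 & A3').
  destruct (TO 1 ltac:(lra)) as (zeta1 & O1 & O1'); destruct (TO 2 ltac:(lra)) as (zeta2 & O2 & O2');
    destruct (TO 3 ltac:(lra)) as (zeta3 & O3 & O3').
  assert (Main := sextic_inequality x (/ L) _ _ _ _ _ _ Hep (conj Hx0 HxL') B1 B2 B3 B4 B5 B6 (nmom_invariant L HL)
    eta1 eta2 eta3 zeta1 zeta2 zeta3 r0 r1 r2 r3 s1 s2 s3 A1' A2' A3' O1' O2' O3' R0 R1 R2 R3 S1 S2 S3).
  cbv zeta beta in Main; rewrite <- A1, <- A2, <- A3, <- O1, <- O2, <- O3 in Main.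
  (* The two indices are symmetric about [M]: the exponentials cancel, and the parity of [ev] and
     [od] makes the factors conjugate. *)
  assert (Pr : forall t r s, H * exp (- t) * (ev (- t) - od (- t) + s) * (H * exp t * (ev t - od t + r))
     = H ^ 2 * ((ev t - od t + r) * (ev t + od t + s))).
  { intros t r s; rewrite Hev, Hod, exp_Ropp; field; apply Rgt_not_eq, exp_pos. }
  replace (IZR (-1) * x) with (- (1 * x)) in F1 by ring; replace (IZR (-2) * x) with (- (2 * x)) in F2 by ring;
    replace (IZR (-3) * x) with (- (3 * x)) in F3 by ring.
  rewrite Rmult_0_l, exp_0, Z1, Z2 in E0.
  rewrite F1, E1, Pr, F2, E2, Pr, F3, E3, Pr, E0.
  revert Main.
  generalize ((ev (1 * x) - od (1 * x) + r1) * (ev (1 * x) + od (1 * x) + s1))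
    ((ev (2 * x) - od (2 * x) + r2) * (ev (2 * x) + od (2 * x) + s2))
    ((ev (3 * x) - od (3 * x) + r3) * (ev (3 * x) + od (3 * x) + s3)) (1 + 15 / 32 * x ^ 6 * (/ L) ^ 3).
  intros C1 C2 C3 G [M1 M2]; assert (HH2 : 0 < H ^ 2) by (apply pow_lt; auto).
  split.
  - replace (15 * (H ^ 2 * C1) + H ^ 2 * C3) with (H ^ 2 * (15 * C1 + C3)) by ring.
    apply Rmult_lt_0_compat; auto.
  - replace (10 * (H * 1 * (1 - 0 + r0)) ^ 2 + 6 * (H ^ 2 * C2)) with (H ^ 2 * (10 * (1 + r0) ^ 2 + 6 * C2)) by ring.
    replace ((15 * (H ^ 2 * C1) + H ^ 2 * C3) * G) with (H ^ 2 * ((15 * C1 + C3) * G)) by ring.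
    apply Rmult_lt_compat_l; auto.
Qed.

End Large.

(** * The correction factor *)

Lemma Rpower_nine_halves y : 0 < y -> Rpower y (9 / 2) = y ^ 4 * sqrt y.
Proof.
  intros Hy; replace (9 / 2) with (INR 4 + / 2) by (simpl; field).
  rewrite Rpower_plus, Rpower_pow, Rpower_sqrt by auto; reflexivity.
Qed.

(** [97/56] is a continued fraction convergent: [97^2 = 3 * 56^2 + 1]. *)
Lemma sqrt_3_bounds : 0 < sqrt 3 <= 97 / 56.
Proof.
  split; [apply sqrt_lt_R0; lra |].
  rewrite <- (sqrt_square (97 / 56)) by lra; apply sqrt_le_1; lra.
Qed.

Definition correction (y : R) : R := 5 * PI ^ 3 / (256 * sqrt 3 * Rpower y (9 / 2)).

Lemma correction_decr y z : 0 < y <= z -> correction z <= correction y.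
Proof.
  intros Hyz; unfold correction; assert (H3 := sqrt_3_bounds); assert (HPI := PI_bounds).
  rewrite !Rpower_nine_halves by lra.
  assert (Hs : 0 < sqrt y <= sqrt z) by (split; [apply sqrt_lt_R0; lra | apply sqrt_le_1; lra]).
  assert (H4 : 0 < y ^ 4 <= z ^ 4) by (split; [apply pow_lt; lra | apply pow_incr; lra]).
  apply Rmult_le_compat_l; [apply Rmult_le_pos; [lra | apply pow_le; lra] |].
  apply Rinv_le_contravar.
  - repeat apply Rmult_lt_0_compat; lra.
  - apply Rmult_le_compat_l; [lra |]; apply Rmult_le_compat; lra.
Qed.

(* AM-GM: [2 c sqrt y <= y + c^2] *)
Lemma correction_lower X S y c : 0 < y -> 0 < c -> 0 < S ->
  X * (1552 * y ^ 4 * (y + c ^ 2)) <= S * (1085 * c) -> X < S * correction y.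
Proof.
  intros Hy Hc HS H; unfold correction; assert (H3 := sqrt_3_bounds); assert (HPI := PI_bounds).
  rewrite Rpower_nine_halves by lra.
  assert (Hs : 0 < sqrt y) by (apply sqrt_lt_R0; lra).
  assert (Hs2 : sqrt y * sqrt y = y) by (apply sqrt_sqrt; lra).
  assert (H4 : 0 < y ^ 4) by (apply pow_lt; lra).
  assert (AG : 2 * (c * sqrt y) <= y + c ^ 2) by (rewrite <- Hs2 at 2; generalize (pow2_ge_0 (sqrt y - c)); nra).
  assert (HP3 : 31 < PI ^ 3).
  { assert (98683 / 10000 < PI ^ 2) by nra; replace (PI ^ 3) with (PI ^ 2 * PI) by ring; nra. }
  assert (Hcs : 0 < c * sqrt y) by nra.
  assert (Hy2 : 0 < y + c ^ 2) by nra.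
  apply Rmult_lt_reg_r with (1552 * y ^ 4 * (y + c ^ 2)); [repeat apply Rmult_lt_0_compat; lra |].
  eapply Rle_lt_trans; [exact H |].
  replace (S * (5 * PI ^ 3 / (256 * sqrt 3 * (y ^ 4 * sqrt y))) * (1552 * y ^ 4 * (y + c ^ 2)))
    with (S * (5 * PI ^ 3 * 1552 * (y + c ^ 2) / (256 * (sqrt 3 * sqrt y)))) by (field; lra).
  apply Rmult_lt_compat_l; [auto |].
  assert (H3s : 0 < sqrt 3 * sqrt y) by nra.
  apply Rmult_lt_reg_r with (256 * (sqrt 3 * sqrt y)); [lra |].
  replace (5 * PI ^ 3 * 1552 * (y + c ^ 2) / (256 * (sqrt 3 * sqrt y)) * (256 * (sqrt 3 * sqrt y)))
    with (7760 * PI ^ 3 * (y + c ^ 2)) by (field; lra).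
  replace (1085 * c * (256 * (sqrt 3 * sqrt y))) with (277760 * (sqrt 3 * (c * sqrt y))) by ring.
  apply Rle_lt_trans with (277760 * (97 / 56 * ((y + c ^ 2) / 2))).
  - apply Rmult_le_compat_l; [lra |]; apply Rmult_le_compat; lra.
  - assert (31 * (y + c ^ 2) < PI ^ 3 * (y + c ^ 2)) by (apply Rmult_lt_compat_r; auto); lra.
Qed.

(** [24003] is what brings [L = sqrt (a nu)] up to 140. With [x = a / L], the factor
    [15/32 x^6 / L^3] equals [correction nu] exactly. *)
Lemma dcount_inequality_large (M : Z) : (24003 <= M)%Z -> exists N0 : nat, forall N, (N0 <= N)%nat ->
  let Q j := IZR (dcount N (M + j)) in
  0 < 15 * (Q (-1)%Z * Q 1%Z) + Q (-3)%Z * Q 3%Z /\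
  10 * Q 0%Z ^ 2 + 6 * (Q (-2)%Z * Q 2%Z) <
    (15 * (Q (-1)%Z * Q 1%Z) + Q (-3)%Z * Q 3%Z) * (1 + correction (IZR M + 1 / 24)).
Proof.
  intros HM; apply IZR_le in HM; set (nu := IZR M + 1 / 24).
  assert (HA := a_bounds); assert (HPI := PI_bounds).
  set (a := PI ^ 2 / 12) in *.
  assert (Hnu : 24003 <= nu) by (unfold nu; lra).
  set (L := sqrt (a * nu)).
  assert (HL : 140 <= L).
  { rewrite <- (sqrt_square 140) by lra; apply sqrt_le_1; nra. }
  assert (HLL : L * L = a * nu) by (apply sqrt_sqrt; nra).
  assert (HxL : L * (a / L) = a) by (field; lra).
  assert (HMx : L / (a / L) = IZR M + 1 / 24).
  { replace (L / (a / L)) with (L * L / a) by (field; lra); rewrite HLL; fold nu; field; lra. }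
  destruct (dcount_inequality (a / L) L M HL HxL HMx) as [N0 H]; exists N0; intros N HN.
  specialize (H N HN); cbv zeta in H |- *.
  replace (1 + correction nu) with (1 + 15 / 32 * (a / L) ^ 6 * (/ L) ^ 3); [exact H |].
  f_equal; unfold correction; rewrite Rpower_nine_halves by lra.
  assert (Hsa : sqrt a = PI / (2 * sqrt 3)).
  { assert (H3 := sqrt_3_bounds).
    rewrite <- (sqrt_square (PI / (2 * sqrt 3))) by (apply Rlt_le, Rdiv_lt_0_compat; lra); f_equal.
    unfold a; replace (PI / (2 * sqrt 3) * (PI / (2 * sqrt 3))) with (PI ^ 2 / (4 * (sqrt 3 * sqrt 3))) by (field; lra).
    rewrite sqrt_sqrt by lra; field. }
  assert (Hs : L = sqrt a * sqrt nu) by (unfold L; apply sqrt_mult; lra).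
  assert (Hsnu : 0 < sqrt nu) by (apply sqrt_lt_R0; lra).
  assert (H3 := sqrt_3_bounds).
  replace (15 / 32 * (a / L) ^ 6 * (/ L) ^ 3) with (15 / 32 * a ^ 6 / ((L * L) ^ 4 * L)) by (field; lra).
  rewrite HLL, Hs, Hsa.
  replace (15 / 32 * a ^ 6 / ((a * nu) ^ 4 * (PI / (2 * sqrt 3) * sqrt nu)))
    with (15 / 32 * a ^ 2 * (2 * sqrt 3) / (PI * (nu ^ 4 * sqrt nu))) by (field; repeat split; lra).
  unfold a.
  replace (15 / 32 * (PI ^ 2 / 12) ^ 2 * (2 * sqrt 3) / (PI * (nu ^ 4 * sqrt nu)))
    with (5 * PI ^ 3 * (sqrt 3 * sqrt 3) / (3 * (256 * sqrt 3 * (nu ^ 4 * sqrt nu)))) by (field; repeat split; lra).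
  rewrite (sqrt_sqrt 3) by lra; field; repeat split; lra.
Qed.

(** * Numerals in base 64 *)

Local Open Scope Z_scope.

(* Enumerated digits turn sums and products of digits into case distinctions, so that evaluation by plain
   reduction stays feasible. *)
Inductive digit :=
  | D0 | D1 | D2 | D3 | D4 | D5 | D6 | D7 | D8 | D9 | D10 | D11 | D12 | D13 | D14 | D15 | D16 | D17 | D18 | D19
  | D20 | D21 | D22 | D23 | D24 | D25 | D26 | D27 | D28 | D29 | D30 | D31 | D32 | D33 | D34 | D35 | D36 | D37
  | D38 | D39 | D40 | D41 | D42 | D43 | D44 | D45 | D46 | D47 | D48 | D49 | D50 | D51 | D52 | D53 | D54 | D55
  | D56 | D57 | D58 | D59 | D60 | D61 | D62 | D63.

Definition digits : list digit :=
  (D0 :: D1 :: D2 :: D3 :: D4 :: D5 :: D6 :: D7 :: D8 :: D9 :: D10 :: D11 :: D12 :: D13 :: D14 :: D15 :: D16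
   :: D17 :: D18 :: D19 :: D20 :: D21 :: D22 :: D23 :: D24 :: D25 :: D26 :: D27 :: D28 :: D29 :: D30 :: D31 ::
   D32 :: D33 :: D34 :: D35 :: D36 :: D37 :: D38 :: D39 :: D40 :: D41 :: D42 :: D43 :: D44 :: D45 :: D46 ::
   D47 :: D48 :: D49 :: D50 :: D51 :: D52 :: D53 :: D54 :: D55 :: D56 :: D57 :: D58 :: D59 :: D60 :: D61 ::
   D62 :: D63 :: nil)%list.

Definition dval (d : digit) : Z :=
  match d with
  | D0 => 0 | D1 => 1 | D2 => 2 | D3 => 3 | D4 => 4 | D5 => 5 | D6 => 6 | D7 => 7 | D8 => 8 | D9 => 9 | D10 =>
  10 | D11 => 11 | D12 => 12 | D13 => 13 | D14 => 14 | D15 => 15 | D16 => 16 | D17 => 17 | D18 => 18 | D19 =>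
  19 | D20 => 20 | D21 => 21 | D22 => 22 | D23 => 23 | D24 => 24 | D25 => 25 | D26 => 26 | D27 => 27 | D28 =>
  28 | D29 => 29 | D30 => 30 | D31 => 31 | D32 => 32 | D33 => 33 | D34 => 34 | D35 => 35 | D36 => 36 | D37 =>
  37 | D38 => 38 | D39 => 39 | D40 => 40 | D41 => 41 | D42 => 42 | D43 => 43 | D44 => 44 | D45 => 45 | D46 =>
  46 | D47 => 47 | D48 => 48 | D49 => 49 | D50 => 50 | D51 => 51 | D52 => 52 | D53 => 53 | D54 => 54 | D55 =>
  55 | D56 => 56 | D57 => 57 | D58 => 58 | D59 => 59 | D60 => 60 | D61 => 61 | D62 => 62 | D63 => 63
  end.

(** Forces a case distinction on [d], so that [Eval cbv] turns the functions below into literal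
    tables. *)
Definition dcase {A : Type} (f : digit -> A) (d : digit) : A :=
  match d with
  | D0 => f D0 | D1 => f D1 | D2 => f D2 | D3 => f D3 | D4 => f D4 | D5 => f D5 | D6 => f D6 | D7 => f D7 | D8
  => f D8 | D9 => f D9 | D10 => f D10 | D11 => f D11 | D12 => f D12 | D13 => f D13 | D14 => f D14 | D15 => f
  D15 | D16 => f D16 | D17 => f D17 | D18 => f D18 | D19 => f D19 | D20 => f D20 | D21 => f D21 | D22 => f D22
  | D23 => f D23 | D24 => f D24 | D25 => f D25 | D26 => f D26 | D27 => f D27 | D28 => f D28 | D29 => f D29 |
  D30 => f D30 | D31 => f D31 | D32 => f D32 | D33 => f D33 | D34 => f D34 | D35 => f D35 | D36 => f D36 | D37
  => f D37 | D38 => f D38 | D39 => f D39 | D40 => f D40 | D41 => f D41 | D42 => f D42 | D43 => f D43 | D44 =>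
  f D44 | D45 => f D45 | D46 => f D46 | D47 => f D47 | D48 => f D48 | D49 => f D49 | D50 => f D50 | D51 => f
  D51 | D52 => f D52 | D53 => f D53 | D54 => f D54 | D55 => f D55 | D56 => f D56 | D57 => f D57 | D58 => f D58
  | D59 => f D59 | D60 => f D60 | D61 => f D61 | D62 => f D62 | D63 => f D63
  end.

Definition dig (z : Z) : digit := nth (Z.to_nat z) digits D0.

Inductive dsum := Low (d : digit) | Carry (d : digit).
Inductive dprod := Prod (lo hi : digit).

Definition split_sum (z : Z) : dsum := if z <? 64 then Low (dig z) else Carry (dig (z - 64)).

Definition tab0 : digit -> digit -> dsum :=
  Eval cbv in fun a b => dcase (fun a => dcase (fun b => split_sum (dval a + dval b)) b) a.
Definition tab1 : digit -> digit -> dsum :=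
  Eval cbv in fun a b => dcase (fun a => dcase (fun b => split_sum (dval a + dval b + 1)) b) a.
Definition tabm : digit -> digit -> dprod :=
  Eval cbv in fun a b => dcase (fun a => dcase (fun b => Prod (dig (dval a * dval b mod 64)) (dig (dval a * dval b / 64))) b) a.
Definition dcomp : digit -> digit := Eval cbv in dcase (fun a => dig (63 - dval a)).
(** Applied to the high digit of a product, at most 62; on [D63] it would return the default [D0] of
    [dig]. *)
Definition dsucc : digit -> digit := Eval cbv in dcase (fun a => dig (dval a + 1)).

Definition sumval (s : dsum) : Z := match s with Low d => dval d | Carry d => dval d + 64 end.
Definition prodval (p : dprod) : Z := match p with Prod lo hi => dval lo + 64 * dval hi end.

Lemma digits_forall (p : digit -> bool) : forallb p digits = true -> forall d, p d = true.
Proof.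
  intros H d; assert (I : In d digits) by (destruct d; cbv; tauto).
  rewrite forallb_forall in H; auto.
Qed.

Lemma digits_forall2 (p : digit -> digit -> bool) :
  forallb (fun a => forallb (p a) digits) digits = true -> forall a b, p a b = true.
Proof. intros H a; apply digits_forall, (digits_forall (fun a => forallb (p a) digits) H). Qed.

Lemma dval_range d : 0 <= dval d < 64.
Proof. destruct d; cbv; split; congruence. Qed.

Lemma tab0_val a b : sumval (tab0 a b) = dval a + dval b.
Proof. apply Z.eqb_eq; revert a b; apply digits_forall2; vm_compute; reflexivity. Qed.

Lemma tab1_val a b : sumval (tab1 a b) = dval a + dval b + 1.
Proof. apply Z.eqb_eq; revert a b; apply digits_forall2; vm_compute; reflexivity. Qed.

Lemma tabm_val a b : prodval (tabm a b) = dval a * dval b.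
Proof. apply Z.eqb_eq; revert a b; apply digits_forall2; vm_compute; reflexivity. Qed.

Lemma dcomp_val a : dval (dcomp a) = 63 - dval a.
Proof. destruct a; reflexivity. Qed.

Lemma dsucc_val a : dval a < 63 -> dval (dsucc a) = dval a + 1.
Proof. destruct a; cbv; congruence. Qed.

(** Least significant digit first; zeros at the far end are allowed, whence [is0] in comparisons. *)
Inductive num := Zero | Dig (d : digit) (n : num).
Inductive truth := Yes | No.

Fixpoint val (x : num) : Z := match x with Zero => 0 | Dig d x => dval d + 64 * val x end.

Fixpoint incr (x : num) : num :=
  match x with
  | Zero => Dig D1 Zero
  | Dig a x => match tab1 a D0 with Low d => Dig d x | Carry d => Dig d (incr x) end
  end.

Fixpoint add0 (x y : num) : num :=
  match x with
  | Zero => y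
  | Dig a x' => match y with
    | Zero => x
    | Dig b y' => match tab0 a b with Low d => Dig d (add0 x' y') | Carry d => Dig d (add1 x' y') end
    end
  end
with add1 (x y : num) : num :=
  match x with
  | Zero => incr y
  | Dig a x' => match y with
    | Zero => incr x
    | Dig b y' => match tab1 a b with Low d => Dig d (add0 x' y') | Carry d => Dig d (add1 x' y') end
    end
  end.

(** Adds the complement [63 - b], a carry meaning that nothing is borrowed; [sub1] has a borrow
    pending. The value is meaningful only if the result is nonnegative, which callers test by
    [geq0]. *)
Fixpoint sub0 (x y : num) : num :=
  match x with
  | Zero => Zero
  | Dig a x' => match y with
    | Zero => x
    | Dig b y' => match tab1 a (dcomp b) with Low d => Dig d (sub1 x' y') | Carry d => Dig d (sub0 x' y') end
    end
  end
with sub1 (x y : num) : num :=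
  match x with
  | Zero => Zero
  | Dig a x' => match y with
    | Zero => match tab0 a D63 with Low d => Dig d (sub1 x' Zero) | Carry d => Dig d x' end
    | Dig b y' => match tab0 a (dcomp b) with Low d => Dig d (sub1 x' y') | Carry d => Dig d (sub0 x' y') end
    end
  end.

Fixpoint is0 (x : num) : truth := match x with Zero => Yes | Dig d x => match d with D0 => is0 x | _ => No end end.

(** Tracks only the borrow of [sub0]; [geq1] is the strict comparison. *)
Fixpoint geq0 (x y : num) : truth :=
  match x with
  | Zero => is0 y
  | Dig a x' => match y with
    | Zero => Yes
    | Dig b y' => match tab1 a (dcomp b) with Low _ => geq1 x' y' | Carry _ => geq0 x' y' end
    end
  end
with geq1 (x y : num) : truth :=
  match x with
  | Zero => No
  | Dig a x' => match y with
    | Zero => match tab0 a D63 with Low _ => geq1 x' Zero | Carry _ => Yes end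
    | Dig b y' => match tab0 a (dcomp b) with Low _ => geq1 x' y' | Carry _ => geq0 x' y' end
    end
  end.

Fixpoint muld (d : digit) (x : num) (k : digit) : num :=
  match x with
  | Zero => Dig k Zero
  | Dig a x => match tabm a d with Prod lo hi =>
      match tab0 lo k with Low e => Dig e (muld d x hi) | Carry e => Dig e (muld d x (dsucc hi)) end
    end
  end.

Fixpoint mul (x y : num) : num :=
  match y with
  | Zero => Zero
  | Dig D0 y => match mul x y with Zero => Zero | z => Dig D0 z end
  | Dig d y => add0 (muld d x D0) (Dig D0 (mul x y))
  end.

Lemma val_nonneg x : 0 <= val x.
Proof. induction x as [| d x IH]; cbn [val]; [lia | generalize (dval_range d); lia]. Qed.

Lemma incr_val x : val (incr x) = val x + 1.
Proof.
  induction x as [| a x IH]; [reflexivity |].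
  cbn [incr]; assert (H := tab1_val a D0); change (dval D0) with 0 in H.
  destruct (tab1 a D0) as [d | d]; cbn [val sumval] in *; lia.
Qed.

Lemma add_val x : forall y, val (add0 x y) = val x + val y /\ val (add1 x y) = val x + val y + 1.
Proof.
  induction x as [| a x IH]; intros y.
  - cbn [add0 add1]; rewrite incr_val; cbn [val]; lia.
  - destruct y as [| b y]; [cbn [add0 add1]; rewrite incr_val; cbn [val]; lia |].
    destruct (IH y) as [I0 I1]; assert (T0 := tab0_val a b); assert (T1 := tab1_val a b); cbn [add0 add1].
    destruct (tab0 a b), (tab1 a b); cbn [val sumval] in *; lia.
Qed.

Lemma add0_val x y : val (add0 x y) = val x + val y.
Proof. apply add_val. Qed.

Lemma sub_val x : forall y, (val y <= val x -> val (sub0 x y) = val x - val y) /\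
  (val y < val x -> val (sub1 x y) = val x - val y - 1).
Proof.
  induction x as [| a x IH]; intros y.
  - assert (H := val_nonneg y); cbn [sub0 sub1 val]; lia.
  - assert (Ra := dval_range a); destruct y as [| b y].
    + assert (T := tab0_val a D63); change (dval D63) with 63 in T.
      destruct (IH Zero) as [_ I1]; cbn [sub0 sub1 val] in *; split; [lia |]; intros H.
      assert (Hx := val_nonneg x).
      destruct (tab0 a D63) as [d | d]; cbn [val sumval] in *; generalize (dval_range d); lia.
    + assert (Rb := dval_range b); destruct (IH y) as [I0 I1].
      assert (T0 := tab0_val a (dcomp b)); assert (T1 := tab1_val a (dcomp b)); rewrite dcomp_val in T0, T1.
      cbn [sub0 sub1 val]; split; intros H.
      * destruct (tab1 a (dcomp b)) as [d | d]; cbn [val sumval] in *; generalize (dval_range d); lia.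
      * destruct (tab0 a (dcomp b)) as [d | d]; cbn [val sumval] in *; generalize (dval_range d); lia.
Qed.

Lemma sub0_val x y : val y <= val x -> val (sub0 x y) = val x - val y.
Proof. apply sub_val. Qed.

Lemma is0_val x : is0 x = Yes -> val x = 0.
Proof.
  induction x as [| d x IH]; [reflexivity |].
  cbn [is0 val]; destruct d; try discriminate; intros H; rewrite IH by auto; reflexivity.
Qed.

Lemma geq_val x : forall y, (geq0 x y = Yes -> val y <= val x) /\ (geq1 x y = Yes -> val y < val x).
Proof.
  induction x as [| a x IH]; intros y.
  - cbn [geq0 geq1 val]; split; [intros H; rewrite (is0_val y H); lia | discriminate].
  - assert (Ra := dval_range a); assert (Hx := val_nonneg x); destruct y as [| b y].
    + assert (T := tab0_val a D63); change (dval D63) with 63 in T.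
      destruct (IH Zero) as [_ I1]; cbn [geq0 geq1 val] in *; split; [lia |].
      destruct (tab0 a D63) as [d | d]; cbn [sumval] in *; generalize (dval_range d); [intros R H; specialize (I1 H) |]; lia.
    + assert (Rb := dval_range b); destruct (IH y) as [I0 I1].
      assert (T0 := tab0_val a (dcomp b)); assert (T1 := tab1_val a (dcomp b)); rewrite dcomp_val in T0, T1.
      cbn [geq0 geq1 val]; split; intros H.
      * destruct (tab1 a (dcomp b)) as [d | d]; cbn [sumval] in *; generalize (dval_range d);
          [specialize (I1 H) | specialize (I0 H)]; lia.
      * destruct (tab0 a (dcomp b)) as [d | d]; cbn [sumval] in *; generalize (dval_range d);
          [specialize (I1 H) | specialize (I0 H)]; lia.
Qed.

Lemma geq0_val x y : geq0 x y = Yes -> val y <= val x.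
Proof. apply geq_val. Qed.

Lemma muld_val d x : forall k, val (muld d x k) = dval d * val x + dval k.
Proof.
  induction x as [| a x IH]; intros k; cbn [muld val]; [lia |].
  assert (H := tabm_val a d); destruct (tabm a d) as [lo hi]; cbn [prodval] in H.
  assert (T := tab0_val lo k).
  assert (Ra := dval_range a); assert (Rd := dval_range d); assert (Rl := dval_range lo); assert (Rk := dval_range k).
  destruct (tab0 lo k) as [e | e]; cbn [val sumval] in *; rewrite IH; [nia |].
  rewrite dsucc_val; nia.
Qed.

Lemma mul_val x y : val (mul x y) = val x * val y.
Proof.
  induction y as [| d y IH]; [cbn [mul val]; lia |].
  assert (H : val (add0 (muld d x D0) (Dig D0 (mul x y))) = val x * val (Dig d y)).
  { rewrite add0_val, muld_val; cbn [val]; rewrite IH; change (dval D0) with 0; lia. }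
  destruct d; try exact H.
  cbn [mul val] in *; destruct (mul x y); cbn [val] in *; change (dval D0) with 0 in *; lia.
Qed.

(** * Tabulation of distinct partitions *)

Inductive tally := TZ | TS (n : tally).
Inductive numlist := Nil | Cons (x : num) (l : numlist).

Fixpoint tally_of (n : nat) : tally := match n with O => TZ | S n => TS (tally_of n) end.
Fixpoint tval (n : tally) : Z := match n with TZ => 0 | TS n => tval n + 1 end.

Fixpoint revapp (l acc : numlist) : numlist :=
  match l with Nil => acc | Cons x l => revapp l (Cons x acc) end.

Fixpoint zeros (r : tally) (acc : numlist) : numlist :=
  match r with TZ => acc | TS r => zeros r (Cons Zero acc) end.

(* Walking through the digits of a sum forces its evaluation, which keeps lazy reduction from piling up suspended sums. *)
Fixpoint walk (x : num) : truth := match x with Zero => Yes | Dig _ x => walk x end.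

(* Multiplication of the power series [l] by [1 / (1 - z^r)]: the queue [f ++ rev b] holds the last [r] outputs. *)
Fixpoint geometric (l f b acc : numlist) : numlist :=
  match l with
  | Nil => acc
  | Cons x l =>
      match f with
      | Cons v f =>
          let s := add0 x v in
          match walk s with Yes => geometric l f (Cons s b) (Cons s acc) | No => Nil end
      | Nil =>
          match revapp b Nil with
          | Cons v f =>
              let s := add0 x v in
              match walk s with Yes => geometric l f (Cons s Nil) (Cons s acc) | No => Nil end
          | Nil => Nil
          end
      end
  end.

(* [1 + z^r / (1 - z^r) l], with [r] the successor of the first argument *)
Definition step (r : tally) (l : numlist) : numlist :=
  Cons (Dig D1 Zero) (zeros r (revapp (geometric l (zeros (TS r) Nil) Nil Nil) Nil)).

(** Horner's scheme for Euler's series [sum_k z^(k (k + 1) / 2) / ((1 - z) ... (1 - z^k))] of the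
    distinct partitions. The pass with exponent [r] lengthens the known part by [r], so about
    [sqrt (2 n)] passes reach the index [n]. *)
Fixpoint run (r : tally) (l : numlist) : numlist :=
  match r with TZ => l | TS r => run r (step r l) end.

(** The list holds [f i] up to [f (j - 1)], and for [rentries] [f (i - 1)] down to [f j]. Leaving
    [j] existential spares all computation of lengths. *)
Fixpoint entries (f : Z -> Z) (l : numlist) (i j : Z) : Prop :=
  match l with Nil => i = j | Cons x l => val x = f i /\ entries f l (i + 1) j end.

Fixpoint rentries (f : Z -> Z) (l : numlist) (i j : Z) : Prop :=
  match l with Nil => i = j | Cons x l => val x = f (i - 1) /\ rentries f l (i - 1) j end.

Lemma walk_yes x : walk x = Yes.
Proof. induction x; auto. Qed.

Lemma entries_revapp f a : forall t i j k, rentries f a i j -> entries f t i k -> entries f (revapp a t) j k.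
Proof.
  induction a as [| x a IH]; intros t i j k Ha Ht; cbn [revapp rentries] in *; [subst; auto |].
  destruct Ha as [H1 H2]; apply (IH _ (i - 1)); auto.
  cbn [entries]; replace (i - 1 + 1) with i by lia; auto.
Qed.

Lemma entries_zeros f r : forall acc i j, (forall k, i <= k < i + tval r -> f k = 0) ->
  entries f acc (i + tval r) j -> entries f (zeros r acc) i j.
Proof.
  induction r as [| r IH]; intros acc i j H0 H; cbn [zeros tval] in *.
  - rewrite Z.add_0_r in H; auto.
  - apply IH; [intros k Hk; apply H0; lia |].
    cbn [entries val]; split.
    + symmetry; apply H0; assert (0 <= tval r) by (clear; induction r; cbn [tval]; lia); lia.
    + replace (i + tval r + 1) with (i + (tval r + 1)) by lia; auto.
Qed.

Lemma dcount_neg N : forall k, k < 0 -> dcount N k = 0.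
Proof.
  induction N as [| N IH]; intros k Hk; cbn [dcount].
  - destruct (Z.eqb_spec k 0); lia.
  - rewrite !IH by lia; reflexivity.
Qed.

(* Partitions of [k] into distinct parts whose largest part [a <= N] is counted with weight [r]. *)
Fixpoint usum (N : nat) (r k : Z) : Z :=
  match N with O => 0 | S n => usum n r k + dcount n (k - r * Z.of_nat (S n)) end.

(* Lowering the largest part by one leaves either a weight [r], or, if it meets the next part, a weight [r + 1]. *)
Lemma usum_rec N r k :
  usum (S N) r k = (if k =? r then 1 else 0) + usum N (r + 1) (k - r) + usum N r (k - r).
Proof.
  induction N as [| N IH].
  - cbn [usum dcount]; rewrite Z.mul_1_r.
    destruct (Z.eqb_spec (k - r) 0), (Z.eqb_spec k r); lia.
  - transitivity (usum (S N) r k + dcount (S N) (k - r * Z.of_nat (S (S N)))); [reflexivity |].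
    rewrite IH; cbn [usum]; cbn [dcount].
    replace (k - r - r * Z.of_nat (S N)) with (k - r * Z.of_nat (S (S N))) by lia.
    replace (k - r - (r + 1) * Z.of_nat (S N)) with (k - r * Z.of_nat (S (S N)) - Z.of_nat (S N)) by lia.
    lia.
Qed.

(** For [r >= 1] no part beyond [k] contributes, so this is the stable value of [usum N r k]. *)
Definition weighted (r k : Z) : Z := usum (Z.to_nat k) r k.

Lemma usum_weighted N r k : 1 <= r -> k <= Z.of_nat N -> usum N r k = weighted r k.
Proof.
  intros Hr; induction N as [| N IH]; intros Hk; unfold weighted in *.
  - replace (Z.to_nat k) with O by lia; reflexivity.
  - destruct (Z.eq_dec k (Z.of_nat (S N))) as [E | E].
    + replace (Z.to_nat k) with (S N) by lia; reflexivity.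
    + cbn [usum]; rewrite IH, dcount_neg by nia; lia.
Qed.

Lemma weighted_nonpos r k : k <= 0 -> weighted r k = 0.
Proof. intros H; unfold weighted; replace (Z.to_nat k) with O by lia; reflexivity. Qed.

Lemma weighted_rec r k : 1 <= r ->
  weighted r k = (if k =? r then 1 else 0) + weighted (r + 1) (k - r) + weighted r (k - r).
Proof.
  intros Hr; destruct (Z.le_gt_cases k 0) as [H | H].
  - rewrite !weighted_nonpos by lia; destruct (Z.eqb_spec k r); lia.
  - rewrite <- (usum_weighted (S (Z.to_nat k)) r k) by lia.
    rewrite usum_rec, !usum_weighted by lia; reflexivity.
Qed.

Lemma weighted_small r k : 1 <= r -> k < r -> weighted r k = 0.
Proof.
  intros Hr Hk; destruct (Z.le_gt_cases k 0) as [H | H]; [apply weighted_nonpos; auto |].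
  rewrite weighted_rec, !weighted_nonpos by lia; destruct (Z.eqb_spec k r); lia.
Qed.

Lemma weighted_1 N k : k <= Z.of_nat N -> dcount N k = (if k =? 0 then 1 else 0) + weighted 1 k.
Proof.
  intros Hk; rewrite <- (usum_weighted N) by lia; clear Hk.
  induction N as [| N IH]; cbn [dcount usum]; [lia |].
  rewrite IH, Z.mul_1_l; lia.
Qed.

(** Coefficients of [1 + sum_a z^(r a) prod_(b < a) (1 + z^b)]; for [r = 1] this is the product over
    all parts. *)
Definition series (r k : Z) : Z := (if k =? 0 then 1 else 0) + weighted r k.

(** Loop invariant: the queue holds [weighted r] at [i, ..., i + r - 1], and the next value is
    [weighted r (i + r) = series (r + 1) i + weighted r i]. *)
Lemma geometric_entries r l : 1 <= r -> forall f b acc i p j,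
  entries (series (r + 1)) l i j ->
  entries (weighted r) f i p -> rentries (weighted r) b (i + r) p ->
  rentries (fun k => weighted r (k + r)) acc i 0 ->
  exists j', rentries (fun k => weighted r (k + r)) (geometric l f b acc) j' 0.
Proof.
  intros Hr; induction l as [| x l IH]; intros f b acc i p j Hl Hf Hb Ha; cbn [geometric]; [exists i; auto |].
  cbn [entries] in Hl; destruct Hl as [Hx Hl].
  assert (New : forall v, val v = weighted r i -> val (add0 x v) = weighted r (i + r)).
  { intros v Hv; rewrite add0_val, Hx, Hv; unfold series; rewrite (weighted_rec r (i + r)) by lia.
    replace (i + r - r) with i by lia; destruct (Z.eqb_spec i 0), (Z.eqb_spec (i + r) r); lia. }
  destruct f as [| v f].
  - cbn [entries] in Hf; subst p.
    assert (E : entries (weighted r) (revapp b Nil) i (i + r)).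
    { apply (entries_revapp _ b _ (i + r)); [auto | reflexivity]. }
    destruct (revapp b Nil) as [| v f]; [exists 0; reflexivity |].
    cbn [entries] in E; destruct E as [Hv E]; cbv zeta; rewrite walk_yes.
    apply (IH _ _ _ (i + 1) (i + r) j); auto; cbn [rentries].
    + replace (i + 1 + r - 1) with (i + r) by lia; split; auto.
    + replace (i + 1 - 1) with i by lia; split; auto.
  - cbn [entries] in Hf; destruct Hf as [Hv Hf]; cbv zeta; rewrite walk_yes.
    apply (IH _ _ _ (i + 1) p j); auto; cbn [rentries].
    + replace (i + 1 + r - 1) with (i + r) by lia; split; auto.
    + replace (i + 1 - 1) with i by lia; split; auto.
Qed.

Lemma entries_shift (f g : Z -> Z) d l : (forall k, g (k + d) = f k) -> forall i j,
  entries f l i j -> entries g l (i + d) (j + d).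
Proof.
  intros H; induction l as [| x l IH]; intros i j E; cbn [entries] in *; [lia |].
  destruct E as [E1 E2]; rewrite H; split; auto.
  replace (i + d + 1) with (i + 1 + d) by lia; auto.
Qed.

Lemma tval_nonneg r : 0 <= tval r.
Proof. induction r; cbn [tval]; lia. Qed.

Lemma entries_ext (f g : Z -> Z) l : forall i j, (forall k, i <= k -> f k = g k) ->
  entries f l i j -> entries g l i j.
Proof.
  induction l as [| x l IH]; intros i j H E; cbn [entries] in *; auto.
  destruct E as [E1 E2]; split; [rewrite <- H by lia; auto |].
  apply IH; auto; intros k Hk; apply H; lia.
Qed.

Lemma step_entries r l j : entries (series (tval r + 2)) l 0 j ->
  exists j', entries (series (tval r + 1)) (step r l) 0 j'.
Proof.
  intros Hl; assert (Hr := tval_nonneg r).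
  assert (S0 : forall k, 0 < k -> series (tval r + 1) k = weighted (tval r + 1) k).
  { intros k Hk; unfold series; destruct (Z.eqb_spec k 0); lia. }
  destruct (geometric_entries (tval r + 1) l ltac:(lia) (zeros (TS r) Nil) Nil Nil 0 (tval r + 1) j) as [j' G].
  - replace (tval r + 1 + 1) with (tval r + 2) by lia; auto.
  - apply entries_zeros; [intros k Hk; cbn [tval] in Hk; apply weighted_small; lia |].
    cbn [entries tval]; lia.
  - cbn [rentries]; lia.
  - cbn [rentries]; lia.
  - exists (j' + (tval r + 1)); unfold step; cbn [entries]; split.
    + unfold series; rewrite weighted_nonpos by lia; reflexivity.
    + apply entries_zeros.
      * intros k Hk; rewrite S0, weighted_small by lia; lia.
      * apply entries_ext with (weighted (tval r + 1)); [intros k Hk; rewrite S0; lia |].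
        replace (0 + 1 + tval r) with (0 + (tval r + 1)) by lia.
        apply entries_shift with (fun k => weighted (tval r + 1) (k + (tval r + 1))); [auto |].
        apply (entries_revapp _ _ _ j'); [auto | reflexivity].
Qed.

Lemma run_entries r : forall l j, entries (series (tval r + 1)) l 0 j ->
  exists j', entries (series 1) (run r l) 0 j'.
Proof.
  induction r as [| r IH]; intros l j H; cbn [run]; [exists j; auto |].
  cbn [tval] in H; replace (tval r + 1 + 1) with (tval r + 2) in H by lia.
  destruct (step_entries r l j H) as [j' H']; eauto.
Qed.

(** * Verification below 24000 *)

Fixpoint drop (k : tally) (x : num) : num :=
  match k with TZ => x | TS k => match x with Zero => Zero | Dig _ x => drop k x end end.

Fixpoint len (x : num) : tally := match x with Zero => TZ | Dig _ x => TS (len x) end.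

Fixpoint tdouble (k : tally) : tally := match k with TZ => TZ | TS k => TS (TS (tdouble k)) end.

Definition D0s (x : num) : num := Dig D0 (Dig D0 (Dig D0 (Dig D0 (Dig D0 (Dig D0 x))))).

(* With [f_i] the [i]-th backward difference at [a_6], the left-hand side minus the right-hand side of the
   inequality without its correction factor is [f0 f6 - 6 f1 f5 + 15 f2 f4 - 10 f3^2]; the truncation
   drops [s + 6 - i] digits from [f_i], so that all four products are aligned. *)
Definition window (s : tally) (a0 a2 a4 f0 f1 f2 f3 f4 f5 f6 n c c2 : num) : truth :=
  let s1 := TS s in let s2 := TS s1 in let s3 := TS s2 in let s4 := TS s3 in let s5 := TS s4 in let s6 := TS s5 in
  let u0 := drop s6 a0 in let u2 := drop s6 a2 in let u4 := drop s6 a4 in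
  let t0 := drop s6 f0 in let t1 := incr (drop s5 f1) in let t2 := drop s4 f2 in let t3 := incr (drop s3 f3) in
  let t4 := drop s2 f4 in let t5 := incr (drop s1 f5) in let t6 := drop s f6 in
  let p := add0 (muld D6 (mul t1 t5) D0) (muld D10 (mul t3 t3) D0) in
  let m := add0 (mul t0 t6) (muld D15 (mul t2 t4) D0) in
  let n2 := mul n n in
  let k := mul (mul (mul n2 n2) (add0 n c2)) (Dig D16 (Dig D24 Zero)) in
  let sum := mul (mul (add0 (muld D15 (mul u2 u4) D0) (mul u0 t0)) (Dig D61 (Dig D16 Zero))) c in
  match geq0 p m with No => No | Yes => geq0 (D0s sum) (mul k (sub0 p m)) end.

Definition bound : num := Dig D0 (Dig D55 (Dig D5 Zero)).

(** The digits of [f0] beyond the thirteenth set the truncation; [window] drops six more and so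
    keeps at most seven leading digits of [f0]. *)
Definition significant : tally := tally_of 13.

(** [e0, ..., e5] are the backward differences at the previous index, so a new coefficient costs six
    subtractions. Any positive [c] is sound; the counters [ct] and [k] raise it every [2 c + 1]
    steps, which keeps it within 1 of [sqrt n], where AM-GM loses little. A list that ends before
    [bound] is rejected. *)
Fixpoint scan (l : numlist) (e0 e1 e2 e3 e4 e5 n c c2 : num) (ct k : tally) : truth :=
  match l with
  | Cons a0 l =>
      match l with
      | Cons _ (Cons a2 (Cons _ (Cons a4 (Cons _ (Cons f0 _))))) =>
          let f1 := sub0 f0 e0 in let f2 := sub0 f1 e1 in let f3 := sub0 f2 e2 in
          let f4 := sub0 f3 e3 in let f5 := sub0 f4 e4 in let f6 := sub0 f5 e5 in
          match geq0 f0 e0 with No => No | Yes =>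
          match geq0 f1 e1 with No => No | Yes =>
          match geq0 f2 e2 with No => No | Yes =>
          match geq0 f3 e3 with No => No | Yes =>
          match geq0 f4 e4 with No => No | Yes =>
          match geq0 f5 e5 with No => No | Yes =>
          match window (len (drop significant f0)) a0 a2 a4 f0 f1 f2 f3 f4 f5 f6 n c c2 with No => No | Yes =>
          match k with
          | TS k => scan l f0 f1 f2 f3 f4 f5 (incr n) c c2 ct k
          | TZ => scan l f0 f1 f2 f3 f4 f5 (incr n) (incr c) (add0 c2 (add1 c c)) (TS ct) (tdouble (TS ct))
          end end end end end end end end
      | _ => geq0 n bound
      end
  | Nil => geq0 n bound
  end.

Definition start (l : numlist) (n c c2 : num) (ct k : tally) : truth :=
  match l with
  | Cons a0 (Cons a1 (Cons a2 (Cons a3 (Cons a4 (Cons a5 _))))) =>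
      let b1 := sub0 a1 a0 in let b2 := sub0 a2 a1 in let b3 := sub0 a3 a2 in let b4 := sub0 a4 a3 in let b5 := sub0 a5 a4 in
      let c2' := sub0 b2 b1 in let c3 := sub0 b3 b2 in let c4 := sub0 b4 b3 in let c5 := sub0 b5 b4 in
      let d3 := sub0 c3 c2' in let d4 := sub0 c4 c3 in let d5 := sub0 c5 c4 in
      let g4 := sub0 d4 d3 in let g5 := sub0 d5 d4 in
      match geq0 a1 a0, geq0 a2 a1, geq0 a3 a2, geq0 a4 a3, geq0 a5 a4 with Yes, Yes, Yes, Yes, Yes =>
      match geq0 b2 b1, geq0 b3 b2, geq0 b4 b3, geq0 b5 b4 with Yes, Yes, Yes, Yes =>
      match geq0 c3 c2', geq0 c4 c3, geq0 c5 c4, geq0 d4 d3, geq0 d5 d4, geq0 g5 g4 with Yes, Yes, Yes, Yes, Yes, Yes =>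
        scan l a5 b5 c5 d5 g5 (sub0 g5 g4) n c c2 ct k
      | _, _, _, _, _, _ => No end | _, _, _, _ => No end | _, _, _, _, _ => No end
  | _ => No
  end.

Fixpoint tail (k : tally) (l : numlist) : numlist :=
  match k with TZ => l | TS k => match l with Nil => Nil | Cons _ l => tail k l end end.

(** 219 passes give [219 * 220 / 2 = 24090] coefficients, the first triangular number to include the
    index 24005 needed at [n = 23999]. The numerals are 715, 27 and [27^2]; 27 is nearest to
    [sqrt 715], and the counter 41 retires it after [n = 756]. *)
Definition check : truth :=
  start (tail (tally_of 715) (run (tally_of 219) Nil)) (Dig D11 (Dig D11 Zero))
    (Dig D27 Zero) (Dig D25 (Dig D11 Zero)) (tally_of 27) (tally_of 41).

Lemma check_yes : check = Yes.
Proof. vm_cast_no_check (eq_refl Yes). Qed.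

Lemma drop_val k : forall x, 64 ^ tval k * val (drop k x) <= val x < 64 ^ tval k * (val (drop k x) + 1).
Proof.
  induction k as [| k IH]; intros x; cbn [drop tval]; [change (64 ^ 0) with 1; lia |].
  assert (Hk := tval_nonneg k); rewrite Z.pow_add_r, Z.pow_1_r by lia.
  assert (0 < 64 ^ tval k) by (apply Z.pow_pos_nonneg; lia).
  destruct x as [| d x]; cbn [val]; [nia |].
  assert (H1 := IH x); assert (Rd := dval_range d); nia.
Qed.

Lemma D0s_val x : val (D0s x) = 64 ^ 6 * val x.
Proof. unfold D0s; cbn [val]; change (dval D0) with 0; lia. Qed.

Lemma mul_le_mul a b c d : 0 <= a <= b -> 0 <= c <= d -> a * c <= b * d.
Proof. intros; apply Z.mul_le_mono_nonneg; lia. Qed.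

(** [6 f1 f5 + 10 f3^2 - f0 f6 - 15 f2 f4] increases with the odd differences and decreases with the
    even ones, so the former are rounded up and the latter down. The four products carry the same
    power of 64; those of the coefficients carry [64^6] more. *)
Lemma window_arith w a0 a2 a4 f0 f1 f2 f3 f4 f5 f6 u0 u2 u4 t0 t1 t2 t3 t4 t5 t6 k c :
  0 < w -> 0 <= k -> 0 <= c -> 0 <= f1 -> 0 <= f3 -> 0 <= f5 ->
  0 <= u0 -> 0 <= u2 -> 0 <= u4 -> 0 <= t0 -> 0 <= t2 -> 0 <= t4 -> 0 <= t6 ->
  64 ^ 6 * w * u0 <= a0 -> 64 ^ 6 * w * u2 <= a2 -> 64 ^ 6 * w * u4 <= a4 ->
  64 ^ 6 * w * t0 <= f0 -> f1 <= 64 ^ 5 * w * t1 -> 64 ^ 4 * w * t2 <= f2 -> f3 <= 64 ^ 3 * w * t3 ->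
  64 ^ 2 * w * t4 <= f4 -> f5 <= 64 ^ 1 * w * t5 -> w * t6 <= f6 ->
  (6 * (t1 * t5) + 10 * (t3 * t3) - (t0 * t6 + 15 * (t2 * t4))) * k <= 64 ^ 6 * ((15 * (u2 * u4) + u0 * t0) * c) ->
  (6 * (f1 * f5) + 10 * (f3 * f3) - (f0 * f6 + 15 * (f2 * f4))) * k <= (15 * (a2 * a4) + a0 * f0) * c.
Proof.
  intros Hw Hk Hc N1 N3 N5 V0 V2 V4 W0 W2 W4 W6 A0 A2 A4 F0 F1 F2 F3 F4 F5 F6 G.
  assert (H15 := mul_le_mul _ _ _ _ (conj N1 F1) (conj N5 F5)).
  assert (H33 := mul_le_mul _ _ _ _ (conj N3 F3) (conj N3 F3)).
  assert (P : forall e t, 0 <= e -> 0 <= t -> 0 <= e * w * t) by (intros; apply Z.mul_nonneg_nonneg; nia).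
  assert (F6' : 1 * w * t6 <= f6) by lia.
  assert (H06 := mul_le_mul _ _ _ _ (conj (P (64 ^ 6) t0 ltac:(lia) W0) F0) (conj (P 1 t6 ltac:(lia) W6) F6')).
  assert (H24 := mul_le_mul _ _ _ _ (conj (P (64 ^ 4) t2 ltac:(lia) W2) F2) (conj (P (64 ^ 2) t4 ltac:(lia) W4) F4)).
  assert (K24 := mul_le_mul _ _ _ _ (conj (P (64 ^ 6) u2 ltac:(lia) V2) A2) (conj (P (64 ^ 6) u4 ltac:(lia) V4) A4)).
  assert (K06 := mul_le_mul _ _ _ _ (conj (P (64 ^ 6) u0 ltac:(lia) V0) A0) (conj (P (64 ^ 6) t0 ltac:(lia) W0) F0)).
  set (W := 64 ^ 6 * (w * w)).
  apply Z.le_trans with (W * (6 * (t1 * t5) + 10 * (t3 * t3) - (t0 * t6 + 15 * (t2 * t4))) * k).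
  - apply Z.mul_le_mono_nonneg_r; [auto |].
    replace (64 ^ 5 * w * t1 * (64 ^ 1 * w * t5)) with (W * (t1 * t5)) in H15 by (unfold W; ring).
    replace (64 ^ 3 * w * t3 * (64 ^ 3 * w * t3)) with (W * (t3 * t3)) in H33 by (unfold W; ring).
    replace (64 ^ 6 * w * t0 * (1 * w * t6)) with (W * (t0 * t6)) in H06 by (unfold W; ring).
    replace (64 ^ 4 * w * t2 * (64 ^ 2 * w * t4)) with (W * (t2 * t4)) in H24 by (unfold W; ring).
    lia.
  - apply Z.le_trans with (W * (64 ^ 6 * ((15 * (u2 * u4) + u0 * t0) * c))).
    + rewrite <- Z.mul_assoc; apply Z.mul_le_mono_nonneg_l; [unfold W; nia | exact G].
    + replace (W * (64 ^ 6 * ((15 * (u2 * u4) + u0 * t0) * c)))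
        with ((15 * (64 ^ 6 * w * u2 * (64 ^ 6 * w * u4)) + 64 ^ 6 * w * u0 * (64 ^ 6 * w * t0)) * c) by (unfold W; ring).
      apply Z.mul_le_mono_nonneg_r; lia.
Qed.

Lemma window_sound s a0 a2 a4 f0 f1 f2 f3 f4 f5 f6 n c c2 :
  window s a0 a2 a4 f0 f1 f2 f3 f4 f5 f6 n c c2 = Yes ->
  (6 * (val f1 * val f5) + 10 * (val f3 * val f3) - (val f0 * val f6 + 15 * (val f2 * val f4)))
    * (1552 * val n ^ 4 * (val n + val c2))
  <= (15 * (val a2 * val a4) + val a0 * val f0) * (1085 * val c).
Proof.
  unfold window; cbv zeta.
  set (s1 := TS s); set (s2 := TS s1); set (s3 := TS s2); set (s4 := TS s3); set (s5 := TS s4); set (s6 := TS s5).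
  set (p := add0 (muld D6 _ D0) _); set (m := add0 (mul _ _) (muld D15 (mul (drop s4 f2) _) _)).
  destruct (geq0 p m) eqn:G1; [| discriminate]; intros G2.
  apply geq0_val in G1; apply geq0_val in G2.
  rewrite D0s_val, (mul_val _ (sub0 p m)), (sub0_val p m G1), (Z.mul_comm _ (val p - val m)), !mul_val, !add0_val, muld_val, !mul_val in G2.
  set (w := 64 ^ tval s).
  assert (Hw : 0 < w) by (apply Z.pow_pos_nonneg; [lia | apply tval_nonneg]).
  assert (Hs := tval_nonneg s).
  assert (U0 := drop_val s6 a0); assert (U2 := drop_val s6 a2); assert (U4 := drop_val s6 a4).
  assert (T0 := drop_val s6 f0); assert (T1 := drop_val s5 f1); assert (T2 := drop_val s4 f2);
  assert (T3 := drop_val s3 f3); assert (T4 := drop_val s2 f4); assert (T5 := drop_val s1 f5); assert (T6 := drop_val s f6).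
  assert (Pw : forall i, 0 <= i -> 64 ^ (tval s + i) = 64 ^ i * w) by (intros; unfold w; rewrite Z.pow_add_r by lia; lia).
  assert (E : tval s1 = tval s + 1 /\ tval s2 = tval s + 2 /\ tval s3 = tval s + 3 /\ tval s4 = tval s + 4 /\
    tval s5 = tval s + 5 /\ tval s6 = tval s + 6).
  { unfold s6, s5, s4, s3, s2, s1; cbn [tval]; lia. }
  destruct E as (E1 & E2 & E3 & E4 & E5 & E6).
  rewrite E6, Pw in U0, U2, U4, T0 by lia; rewrite E5, Pw in T1 by lia; rewrite E4, Pw in T2 by lia;
    rewrite E3, Pw in T3 by lia; rewrite E2, Pw in T4 by lia; rewrite E1, Pw in T5 by lia.
  change (64 ^ (tval s)) with w in T6.
  unfold p, m in G2; rewrite !add0_val, !muld_val, !mul_val, !incr_val in G2.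
  change (dval D0) with 0 in G2; change (dval D6) with 6 in G2; change (dval D10) with 10 in G2;
    change (dval D15) with 15 in G2.
  change (val (Dig D16 (Dig D24 Zero))) with 1552 in G2; change (val (Dig D61 (Dig D16 Zero))) with 1085 in G2.
  assert (N := val_nonneg).
  apply (window_arith w _ _ _ _ _ _ _ _ _ _ (val (drop s6 a0)) (val (drop s6 a2)) (val (drop s6 a4)) (val (drop s6 f0))
    (val (drop s5 f1) + 1) (val (drop s4 f2)) (val (drop s3 f3) + 1) (val (drop s2 f4)) (val (drop s1 f5) + 1)
    (val (drop s f6))); auto; try lia.
  - apply Z.mul_nonneg_nonneg; [| generalize (N n) (N c2); lia].
    apply Z.mul_nonneg_nonneg; [lia | apply Z.pow_nonneg, N].
  - generalize (N c); lia.
Qed.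

(** The hypothesis of [correction_lower] over the integers. [1085 / 1552] is
    [5 * 31 * 2 * 56 / (256 * 97)], from [pi^3 > 31], [sqrt 3 <= 97/56] and
    [sqrt n <= (n + c^2) / (2 c)]. *)
Definition checked (A : Z -> Z) (n : Z) : Prop := exists c, 0 < c /\
  (10 * A (n + 3) ^ 2 + 6 * A (n + 1) * A (n + 5) - (15 * A (n + 2) * A (n + 4) + A n * A (n + 6)))
    * (1552 * n ^ 4 * (n + c ^ 2))
  <= (15 * A (n + 2) * A (n + 4) + A n * A (n + 6)) * (1085 * c).

Lemma scan_sound A l : forall e0 e1 e2 e3 e4 e5 n c c2 ct k j,
  entries A l (val n) j -> 0 < val c -> val c2 = val c ^ 2 ->
  (let a i := A (val n + i) in
   val e0 = a 5 /\ val e1 = a 5 - a 4 /\ val e2 = a 5 - 2 * a 4 + a 3 /\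
   val e3 = a 5 - 3 * a 4 + 3 * a 3 - a 2 /\ val e4 = a 5 - 4 * a 4 + 6 * a 3 - 4 * a 2 + a 1 /\
   val e5 = a 5 - 5 * a 4 + 10 * a 3 - 10 * a 2 + 5 * a 1 - a 0) ->
  scan l e0 e1 e2 e3 e4 e5 n c c2 ct k = Yes -> forall m, val n <= m < 24000 -> checked A m.
Proof.
  induction l as [| a0 l IH]; intros e0 e1 e2 e3 e4 e5 n c c2 ct k j Hl Hc Hc2 He H m Hm.
  { apply geq0_val in H; change (val bound) with 24000 in H; lia. }
  cbn [scan] in H.
  assert (Stop : geq0 n bound = Yes -> checked A m).
  { intros G; apply geq0_val in G; change (val bound) with 24000 in G; lia. }
  destruct l as [| a1 [| a2 [| a3 [| a4 [| a5 [| f0 l]]]]]]; auto.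
  set (f1 := sub0 f0 e0) in *; set (f2 := sub0 f1 e1) in *; set (f3 := sub0 f2 e2) in *;
    set (f4 := sub0 f3 e3) in *; set (f5 := sub0 f4 e4) in *; set (f6 := sub0 f5 e5) in *.
  destruct (geq0 f0 e0) eqn:G0; [| discriminate]; apply geq0_val, sub0_val in G0; fold f1 in G0.
  destruct (geq0 f1 e1) eqn:G1; [| discriminate]; apply geq0_val, sub0_val in G1; fold f2 in G1.
  destruct (geq0 f2 e2) eqn:G2; [| discriminate]; apply geq0_val, sub0_val in G2; fold f3 in G2.
  destruct (geq0 f3 e3) eqn:G3; [| discriminate]; apply geq0_val, sub0_val in G3; fold f4 in G3.
  destruct (geq0 f4 e4) eqn:G4; [| discriminate]; apply geq0_val, sub0_val in G4; fold f5 in G4.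
  destruct (geq0 f5 e5) eqn:G5; [| discriminate]; apply geq0_val, sub0_val in G5; fold f6 in G5.
  destruct (window _ _ _ _ _ _ _ _ _ _ _ _ _ _) eqn:Hw; [| discriminate]; apply window_sound in Hw.
  clearbody f1 f2 f3 f4 f5 f6.
  cbv beta zeta in He; destruct He as (E0 & E1 & E2 & E3 & E4 & E5).
  assert (Hl' := Hl); cbn [entries] in Hl; destruct Hl as (V0 & V1 & V2 & V3 & V4 & V5 & V6 & _).
  replace (val n + 1 + 1 + 1 + 1 + 1 + 1) with (val n + 6) in V6 by ring.
  replace (val n + 1 + 1 + 1 + 1 + 1) with (val n + 5) in V5 by ring.
  replace (val n + 1 + 1 + 1 + 1) with (val n + 4) in V4 by ring.
  replace (val n + 1 + 1 + 1) with (val n + 3) in V3 by ring.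
  replace (val n + 1 + 1) with (val n + 2) in V2 by ring.
  rewrite Z.add_0_r in E5.
  destruct (Z.eq_dec m (val n)) as [-> | Hmn].
  - exists (val c); split; [auto |].
    rewrite G5, G4, G3, G2, G1, G0, E0, E1, E2, E3, E4, E5, V0, V2, V4, V6, Hc2 in Hw.
    (* [ring] verifies here that the quadratic form takes the same value on the coefficients and on
       their differences. *)
    match type of Hw with _ * ?K <= _ =>
      match goal with |- ?X * _ <= ?Y * _ =>
        replace (X * K) with (X * K) by reflexivity;
        match type of Hw with ?X' * _ <= ?Y' * _ => replace X with X' by ring; replace Y with Y' by ring end end end.
    exact Hw.
  - assert (Next : forall c c2 ct k, 0 < val c -> val c2 = val c ^ 2 ->
      scan (Cons a1 (Cons a2 (Cons a3 (Cons a4 (Cons a5 (Cons f0 l)))))) f0 f1 f2 f3 f4 f5 (incr n) c c2 ct k = Yes -> checked A m).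
    { intros c' c2' ct' k' Hc' Hc2' HS.
      apply (IH f0 f1 f2 f3 f4 f5 (incr n) c' c2' ct' k' j); auto; rewrite ?incr_val; [| | lia].
      - cbn [entries] in Hl' |- *; tauto.
      - cbv beta zeta.
        replace (val n + 1 + 5) with (val n + 6) by ring; replace (val n + 1 + 4) with (val n + 5) by ring;
        replace (val n + 1 + 3) with (val n + 4) by ring; replace (val n + 1 + 2) with (val n + 3) by ring;
        replace (val n + 1 + 1) with (val n + 2) by ring; replace (val n + 1 + 0) with (val n + 1) by ring.
        lia. }
    destruct k as [| k].
    + apply (Next _ _ _ _) in H; auto; rewrite ?add0_val, ?incr_val; [lia |].
      destruct (add_val c c) as [_ H1]; rewrite H1, Hc2; ring.
    + apply (Next _ _ _ _) in H; auto.
Qed.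

Lemma start_sound A l n c c2 ct k j : entries A l (val n) j -> 0 < val c -> val c2 = val c ^ 2 ->
  start l n c c2 ct k = Yes -> forall m, val n <= m < 24000 -> checked A m.
Proof.
  intros Hl Hc Hc2; unfold start; cbv zeta.
  destruct l as [| a0 [| a1 [| a2 [| a3 [| a4 [| a5 l]]]]]]; try discriminate.
  repeat match goal with |- match geq0 ?x ?y with Yes => _ | No => _ end = Yes -> _ =>
    let G := fresh "G" in destruct (geq0 x y) eqn:G; [apply geq0_val, sub0_val in G | discriminate] end.
  apply (scan_sound A _ _ _ _ _ _ _ _ _ _ _ _ j Hl Hc Hc2).
  cbn [entries] in Hl; destruct Hl as (V0 & V1 & V2 & V3 & V4 & V5 & _).
  cbv beta zeta; rewrite Z.add_0_r.
  replace (val n + 1 + 1 + 1 + 1 + 1) with (val n + 5) in V5 by ring.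
  replace (val n + 1 + 1 + 1 + 1) with (val n + 4) in V4 by ring.
  replace (val n + 1 + 1 + 1) with (val n + 3) in V3 by ring.
  replace (val n + 1 + 1) with (val n + 2) in V2 by ring.
  repeat split; lia.
Qed.

Lemma tail_entries f k : forall l i j, entries f l i j -> exists j', entries f (tail k l) (i + tval k) j' \/ tail k l = Nil.
Proof.
  induction k as [| k IH]; intros l i j H; cbn [tail tval].
  - exists j; left; rewrite Z.add_0_r; auto.
  - destruct l as [| x l]; [exists 0; auto |].
    destruct H as [_ H]; apply IH in H; replace (i + (tval k + 1)) with (i + 1 + tval k) by ring; auto.
Qed.

Lemma start_run_sound R K n c c2 ct k : tval K = val n -> 0 < val c -> val c2 = val c ^ 2 ->
  start (tail K (run R Nil)) n c c2 ct k = Yes -> forall m, val n <= m < 24000 -> checked (series 1) m.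
Proof.
  intros HK Hc Hc2 H.
  destruct (run_entries R Nil 0 eq_refl) as [j Hj].
  destruct (tail_entries _ K _ _ _ Hj) as [j' [E | E]]; [| rewrite E in H; discriminate].
  rewrite Z.add_0_l, HK in E; exact (start_sound _ _ _ _ _ _ _ j' E Hc Hc2 H).
Qed.

Lemma check_sound : check = Yes -> forall n, 715 <= n < 24000 -> checked (series 1) n.
Proof.
  unfold check; intros H n Hn.
  assert (Hn' : val (Dig D11 (Dig D11 Zero)) <= n < 24000) by exact Hn.
  refine (start_run_sound _ _ _ _ _ _ _ _ _ _ H n Hn'); reflexivity.
Qed.

(** * Counting subsets *)

From mathcomp Require Import all_boot.

Local Open Scope nat_scope.

Section Subsets.

Variable n : nat.

Definition subset_count (S : {set 'I_n.+1}) (k : nat) : nat :=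
  \sum_(A : {set 'I_n.+1} | A \subset S) (\sum_(i in A) i == k).

(** Subsets of [j |: S] that contain [j] correspond to subsets of [S] by removal of [j], which
    lowers the sum by [j]. *)
Lemma subset_countU1 (j : 'I_n.+1) (S : {set 'I_n.+1}) k : j \notin S ->
  subset_count (j |: S) k = subset_count S k + (if j <= k then subset_count S (k - j) else 0).
Proof.
move=> jS; rewrite /subset_count (bigID (fun A : {set 'I_n.+1} => j \in A)) /= addnC; congr (_ + _).
  apply: eq_bigl => A; apply/andP/idP => [[/subsetP AS jA] | AS].
    by apply/subsetP => i iA; case/setU1P: (AS i iA) => // ij; rewrite ij in iA; rewrite iA in jA.
  split; first exact: subset_trans AS (subsetUr _ _).
  by apply: contra jS => jA; exact: (subsetP AS).
rewrite (reindex_onto (fun B => j |: B) (fun A => A :\ j)) /=; last by move=> A /andP [_ jA]; rewrite setD1K.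
have E (B : {set 'I_n.+1}) : (j |: B \subset j |: S) && (j \in j |: B) && ((j |: B) :\ j == B) = (B \subset S).
  rewrite setU11 andbT; apply/andP/idP => [[/subsetP BS /eqP EB] | BS].
    apply/subsetP => i iB; have := BS i; rewrite !in_setU1 iB orbT => /(_ isT) /orP [/eqP ij | //].
    by move: iB; rewrite -EB ij !inE eqxx.
  split; first exact: setUS.
  by rewrite setU1K //; apply: contra jS; exact: (subsetP BS).
rewrite (eq_bigl _ _ E).
have EB (B : {set 'I_n.+1}) : B \subset S -> \sum_(i in j |: B) i = j + \sum_(i in B) i.
  by move=> BS; rewrite big_setU1 //=; apply: contra jS; exact: (subsetP BS).
case: leqP => jk.
  apply: eq_bigr => B BS; rewrite EB //; congr (nat_of_bool _).
  by rewrite -{1}(subnKC jk) eqn_add2l.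
apply: big1 => B BS; rewrite EB //; apply/eqP; rewrite eqb0; apply/eqP => H.
by move: jk; rewrite -H ltnNge leq_addr.
Qed.

Definition initial_parts (m : nat) : {set 'I_n.+1} := [set i : 'I_n.+1 | 0 < i <= m].

Lemma subset_count_dcount m : m <= n -> forall k : nat,
  dcount m (Z.of_nat k) = Z.of_nat (subset_count (initial_parts m) k).
Proof.
elim: m => [|m IH] mn k.
  have -> : initial_parts 0 = set0 by apply/setP => i; rewrite !inE; case: (nat_of_ord i).
  rewrite /subset_count (eq_bigl _ _ (fun A => subset0 A)).
  by rewrite big_pred1_eq big_set0 /=; case: k.
have -> : initial_parts m.+1 = inord m.+1 |: initial_parts m.
  apply/setP => i; rewrite !inE -val_eqE /= inordK ?ltnS //.
  by rewrite [i <= m.+1]leq_eqVlt ltnS andb_orr; case: eqP => [-> | _]; rewrite ?andbF.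
rewrite subset_countU1; last by rewrite inE inordK ?ltnS // ltnn andbF.
rewrite inordK ?ltnS //.
change (dcount m (Z.of_nat k) + dcount m (Z.of_nat k - Z.of_nat m.+1) =
  Z.of_nat (subset_count (initial_parts m) k + (if m < k then subset_count (initial_parts m) (k - m.+1) else 0))%N)%Z.
rewrite (IH (ltnW mn)); case: ltnP => mk.
  have -> : (Z.of_nat k - Z.of_nat m.+1)%Z = Z.of_nat (k - m.+1).
    by rewrite -[(k - m.+1)]/(Nat.sub k m.+1) Nat2Z.inj_sub //; apply/leP.
  by rewrite (IH (ltnW mn)) -[(_ + _)%N]/(Nat.add _ _) Nat2Z.inj_add.
(* Here the integer recursion meets a negative argument, where [dcount] vanishes, whereas
   subtraction in [nat] would truncate to 0. *)
have Hneg : (Z.of_nat k - Z.of_nat m.+1 < 0)%Z by move/leP: mk => mk; lia.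
by rewrite dcount_neg // addn0 Z.add_0_r.
Qed.

End Subsets.

Lemma q_dcount (n : nat) : Z.of_nat (q n) = dcount n (Z.of_nat n).
Proof.
rewrite (subset_count_dcount n) // /q cardsE -sum1_card /subset_count; congr Z.of_nat.
rewrite big_mkcond [RHS]big_mkcond; apply: eq_bigr => A _ /=.
have -> : (A \subset initial_parts n n) = (ord0 \notin A).
  apply/subsetP/idP => [H | H i iA].
    by apply/negP => /H; rewrite inE.
  by rewrite inE leq_ord andbT lt0n; apply: contra H => /eqP i0; rewrite (_ : ord0 = i) //; apply/val_inj.
by rewrite unfold_in /=; case: (ord0 \notin A) => //=; case: eqP.
Qed.

Lemma q_pos (n : nat) : (0 < n) -> (0 < q n)%N.
Proof.
move=> n0; rewrite /q card_gt0; apply/set0Pn; exists [set ord_max].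
by rewrite !inE big_set1 /= eqxx andbT -val_eqE /= eq_sym -lt0n.
Qed.

(** * Conclusion *)

Local Open Scope R_scope.

Lemma q_series (n : nat) : series 1 (Z.of_nat n) = Z.of_nat (q n).
Proof. by rewrite q_dcount (weighted_1 n) //; lia. Qed.

Lemma dcount_q (N n : nat) : (Z.of_nat n <= Z.of_nat N)%Z -> dcount N (Z.of_nat n) = Z.of_nat (q n).
Proof. by move=> H; rewrite -q_series (weighted_1 N). Qed.

Lemma INR_q_pos (n : nat) : (0 < n)%N -> 0 < INR (q n).
Proof. by move=> n0; apply/lt_0_INR/ltP/q_pos. Qed.

Lemma inequality_small (n : nat) : (715 <= Z.of_nat n < 24000)%Z ->
  10 * INR (q (n + 3)%N) ^ 2 + 6 * INR (q (n + 1)%N) * INR (q (n + 5)%N) <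
  (15 * INR (q (n + 2)%N) * INR (q (n + 4)%N) + INR (q n) * INR (q (n + 6)%N)) * (1 + correction (INR n)).
Proof.
move=> Hn; have n0 : (0 < n)%N by apply/ltP; lia.
have [c [Hc H]] := check_sound check_yes (Z.of_nat n) Hn.
have E (i : nat) : series 1 (Z.of_nat n + Z.of_nat i) = Z.of_nat (q (n + i)%N).
  by rewrite -q_series -[(n + i)%N]/(Nat.add n i) Nat2Z.inj_add.
have P (i : nat) : 0 < INR (q (n + i)%N).
  by apply: INR_q_pos; rewrite addn_gt0 n0.
have P0 : 0 < INR (q n) by apply: INR_q_pos.
have := (P 2%N, P 4%N, P 6%N); move=> [[P2 P4] P6].
rewrite (E 1%N) (E 2%N) (E 3%N) (E 4%N) (E 5%N) (E 6%N) q_series in H.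
move/IZR_le: H; rewrite !(mult_IZR, plus_IZR, minus_IZR) -!INR_IZR_INZ.
set S := 15 * _ * _ + _ * _; set X := 10 * _ + _ - S => H.
have HS : 0 < S by apply: Rplus_lt_0_compat; repeat apply: Rmult_lt_0_compat; lra.
have HX : X < S * correction (INR n).
  apply: (correction_lower _ _ _ (IZR c)); [exact/lt_0_INR/ltP | exact: IZR_lt | exact: HS |].
  by move: H; rewrite /pow.
by rewrite /X /= in HX *; lra.
Qed.

Lemma inequality_large (n : nat) : (24000 <= Z.of_nat n)%Z ->
  10 * INR (q (n + 3)%N) ^ 2 + 6 * INR (q (n + 1)%N) * INR (q (n + 5)%N) <
  (15 * INR (q (n + 2)%N) * INR (q (n + 4)%N) + INR (q n) * INR (q (n + 6)%N)) * (1 + correction (INR n)).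
Proof.
move=> Hn; have [N0 H] := dcount_inequality_large (Z.of_nat n + 3) ltac:(lia).
have [HS HD] := H (N0 + (n + 6))%coq_nat ltac:(lia).
have E (i : nat) (j : Z) : Z.of_nat i = (3 + j)%Z -> (i <= 6)%coq_nat ->
    IZR (dcount (N0 + (n + 6))%coq_nat (Z.of_nat n + 3 + j)) = INR (q (n + i)%N).
  move=> Hij Hi; rewrite INR_IZR_INZ -(dcount_q (N0 + (n + 6))%coq_nat).
    by rewrite -[(n + i)%N]/(Nat.add n i) Nat2Z.inj_add; do 2 f_equal; lia.
  by rewrite -[(n + i)%N]/(Nat.add n i) !Nat2Z.inj_add; lia.
have E0 := E 0%N (-3)%Z erefl ltac:(lia); rewrite addn0 in E0.
rewrite E0 (E 1%N (-2)%Z erefl ltac:(lia)) (E 2%N (-1)%Z erefl ltac:(lia)) (E 3%N 0%Z erefl ltac:(lia))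
  (E 4%N 1%Z erefl ltac:(lia)) (E 5%N 2%Z erefl ltac:(lia)) (E 6%N 3%Z erefl ltac:(lia)) in HS HD.
(* The centre of the window is [n + 3], and the correction at [n + 3 + 1/24] is below the one at
   [n]. *)
have Hc : correction (IZR (Z.of_nat n + 3) + 1 / 24) <= correction (INR n).
  have Hn' := IZR_le _ _ Hn; apply: correction_decr; rewrite plus_IZR INR_IZR_INZ; lra.
rewrite (Rmult_assoc 6) (Rmult_assoc 15); apply: Rlt_le_trans HD _.
by apply: Rmult_le_compat_l; lra.
Qed.

Theorem theorem1p10 (n : nat) (hn : (715 <= n)%N) :
  10 * INR (q (n + 3)%N) ^ 2 + 6 * INR (q (n + 1)%N) * INR (q (n + 5)%N) <
  (15 * INR (q (n + 2)%N) * INR (q (n + 4)%N) + INR (q n) * INR (q (n + 6)%N))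
  * (1 + 5 * PI ^ 3 / (256 * sqrt 3 * Rpower (INR n) (9 / 2))).
Proof.
have hn' : (715 <= Z.of_nat n)%Z by move/leP/inj_le: hn.
have [Hlt | Hge] := Z.lt_ge_cases (Z.of_nat n) 24000.
- exact: inequality_small.
- exact: inequality_large.
Qed.
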